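(* Let $K\ge 0$, $1<\gamma\le 2$ and $0<\alpha<\frac14$. Let the initial conditions be $\rho_0\in L^1(\mathbb{T})$ (more generally a positive bounded Radon measure), $\rho_0\ge 0$, and $u_0\in L^\infty(\mathbb{T})$. Approximate the initial conditions by a family $\rho_0^\epsilon,u_0^\epsilon\in\mathcal{C}(\mathbb{T})$, $\epsilon>0$, such that $\rho_0^\epsilon(x)>0$ for all $x$, $\|\rho_0-\rho_0^\epsilon\|_{L^1(\mathbb{T})}\to 0$ and $\|u_0-u_0^\epsilon\|_\infty\to 0$ when $\epsilon\to 0$. For each $\epsilon$ consider the following system of ODEs in $\mathcal{C}(\mathbb{T})$ for the unknowns $t\mapsto\rho(\cdot,t,\epsilon)$ and $t\mapsto(\rho u)(\cdot,t,\epsilon)$: $$\frac{d}{dt}\rho(x,t,\epsilon)=\frac1\epsilon\big[(\rho u^+)(x-\epsilon,t,\epsilon)-(\rho|u|)(x,t,\epsilon)+(\rho u^-)(x+\epsilon,t,\epsilon)\big],$$ $$\frac{d}{dt}(\rho u)(x,t,\epsilon)=\frac1\epsilon\big[(\rho u u^+)(x-\epsilon,t,\epsilon)-(\rho u|u|)(x,t,\epsilon)+(\rho u u^-)(x+\epsilon,t,\epsilon)\big]-\rho(x,t,\epsilon)\frac{\partial}{\partial x}\Phi(x,t,\epsilon),$$ where $$u(x,t,\epsilon)=\frac{(\rho u)(x,t,\epsilon)}{\rho(x,t,\epsilon)},\qquad \Phi(x,t,\epsilon)=\frac{K\gamma}{\gamma-1}\big[(\rho(\cdot,t,\epsilon))^{\gamma-1}*\phi_{\epsilon^\alpha}\big](x),$$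 with initial conditions $\rho(\cdot,0,\epsilon)=\rho_0^\epsilon$, $u(\cdot,0,\epsilon)=u_0^\epsilon$. Then the solution of this system (which exists, is unique, has $\rho>0$, and is defined for all $t\in[0,+\infty[$ and $x\in\mathbb{T}$) provides a weak asymptotic solution, global in time $t\in[0,+\infty[$ and in space $x\in\mathbb{T}$, of the 1-D isentropic gas equations $$\partial_t\rho+\partial_x(\rho u)=0,\qquad \partial_t(\rho u)+\partial_x(\rho u^2)+\rho\,\partial_x\Phi=0,\qquad \Phi=\frac{K\gamma}{\gamma-1}\rho^{\gamma-1}.$$
   Context: $\mathbb{T}=\mathbb{R}/(2\pi\mathbb{Z})$; functions on $\mathbb{T}$ are identified with $2\pi$-periodic functions on $\mathbb{R}$, and $\mathcal{C}(\mathbb{T})$ is the Banach space of continuous functions on $\mathbb{T}$ with the sup norm $\|\cdot\|_\infty$. For real $u$: $u^+=\max(u,0)$, $u^-=\max(-u,0)$, so $u=u^+-u^-$ and $|u|=u^++u^-$. Products such as $\rho u^\pm$, $\rho u|u|$ are evaluated at the indicated point. A function $\phi\in\mathcal{C}_c^\infty(\mathbb{R})$ is fixed with $\phi\ge 0$, $\phi(-x)=\phi(x)$ for all $x$, $\int\phi(x)\,dx=1$; for $\mu>0$, $\phi_\mu(x)=\frac1\mu\phi(\frac x\mu)$; $*$ denotes convolution on $\mathbb{R}$. A solution of the system of ODEs is a continuously differentiable map $t\mapsto(\rho(\cdot,t,\epsilon),(\rho u)(\cdot,t,\epsilon))\in\mathcal{C}(\mathbb{T})^2$ (one-sided derivative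 at $t=0$) with $\rho>0$ that satisfies the equations. The family $(\rho,\rho u,\Phi)(\cdot,\cdot,\epsilon)$ is a weak asymptotic solution of the isentropic gas equations (strong derivative in $t$, weak derivative in $x$) if for every $t>0$ and every $\psi\in\mathcal{C}_c^\infty(\mathbb{R})$, as $\epsilon\to 0$ (integrals over $\mathbb{R}$), $$\int\frac{d}{dt}\rho(x,t,\epsilon)\psi(x)dx-\int(\rho u)(x,t,\epsilon)\psi'(x)dx\to 0,$$ $$\int\frac{d}{dt}(\rho u)(x,t,\epsilon)\psi(x)dx-\int(\rho u^2)(x,t,\epsilon)\psi'(x)dx+\int\rho(x,t,\epsilon)\frac{\partial}{\partial x}\Phi(x,t,\epsilon)\psi(x)dx\to 0,$$ $$\int\Big[\Phi(x,t,\epsilon)-\frac{K\gamma}{\gamma-1}(\rho(x,t,\epsilon))^{\gamma-1}\Big]\psi(x)dx\to 0 .$$ *)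

(* Defs.v *)
From HB Require Import structures.
From mathcomp Require Import all_boot all_order all_algebra.
From mathcomp Require Import all_classical all_reals all_analysis.

Set Implicit Arguments.
Unset Strict Implicit.
Unset Printing Implicit Defensive.

Import Order.TTheory GRing.Theory Num.Theory.
Import numFieldNormedType.Exports.

Local Open Scope classical_set_scope.
Local Open Scope ring_scope.

Section FunctionSpaces.
Context {R : realType}.

(* Functions on the torus R / (2 pi Z) are 2 pi-periodic functions on R. *)
Definition torus_fun (f : R -> R) : Prop := periodic f (pi *+ 2).

Definition torus_continuous (f : R -> R) : Prop :=
  torus_fun f /\ continuous f.

Definition test_function (f : R -> R) : Prop :=
  (forall n x, derivable (derive1n n f) x 1) /\
  compact (closure [set x | f x != 0]).

Definition torus_L1 (f : R -> R) : Prop :=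
  torus_fun f /\ lebesgue_measure.-integrable `[0, pi *+ 2] (EFin \o f).

Definition torus_L1_norm (f : R -> R) : \bar R :=
  (\int[lebesgue_measure]_(x in `[0%R, (pi *+ 2)%R]) `|f x|%:E)%E.

(* For a periodic function the essential supremum over R coincides with the
   one over a period. *)
Definition torus_Linfty_norm (f : R -> R) : \bar R :=
  ('N[lebesgue_measure]_+oo [EFin \o f])%E.

Definition torus_Linfty (f : R -> R) : Prop :=
  [/\ torus_fun f, measurable_fun setT f & (torus_Linfty_norm f < +oo)%E].

(* An initial density is either an integrable function or a positive bounded
   Radon measure; measures on the torus are finite Borel measures on R carried
   by the fundamental domain [0, 2 pi[. *)
Variant initial_density : Type :=
| Density of (R -> R)
| RadonMeasure of {finite_measure set (measurableTypeR R) -> \bar R}.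

Definition nonneg_initial_density (r0 : initial_density) : Prop :=
  match r0 with
  | Density f => torus_L1 f /\ {ae lebesgue_measure, forall x, 0 <= f x}
  | RadonMeasure m => m (~` `[0, pi *+ 2[) = 0%E
  end.

(* Convergence as eps -> 0+ of the approximations r0e eps: in L^1-norm to a
   function, and against all continuous functions on the torus to a measure.
   The latter is implied by convergence in total variation, which would allow
   absolutely continuous measures only. *)
Definition density_approximation (r0 : initial_density) (r0e : R -> R -> R) :
    Prop :=
  match r0 with
  | Density f =>
      torus_L1_norm (fun x => f x - r0e eps x) @[eps --> 0^'+] --> 0%E
  | RadonMeasure m => forall g, torus_continuous g ->
      \int[lebesgue_measure]_(x in `[0, pi *+ 2]) (g x * r0e eps x)
        @[eps --> 0^'+] --> \int[m]_x g x
  end.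

End FunctionSpaces.

Section System.
Context {R : realType}.

Definition convolution (f g : R -> R) (x : R) : R :=
  \int[lebesgue_measure]_y (f (x - y) * g y).

Definition mollifier (phi : R -> R) (mu x : R) : R := mu^-1 * phi (x / mu).

Definition velocity (r q : R -> R) (x : R) : R := q x / r x.

(* With w = rho (resp. w = rho u), the bracket of the first (resp. second)
   equation divided by eps. *)
Definition transport (eps : R) (u w : R -> R) (x : R) : R :=
  eps^-1 * (w (x - eps) * u^\+ (x - eps) - w x * `|u x|
            + w (x + eps) * u^\- (x + eps)).

Definition potential (K gamma alpha : R) (phi : R -> R) (eps : R)
    (r : R -> R) (x : R) : R :=
  K * gamma / (gamma - 1) *
    convolution (fun y => r y `^ (gamma - 1)) (mollifier phi (eps `^ alpha)) x.

Definition density_rhs (eps : R) (r q : R -> R) : R -> R :=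
  transport eps (velocity r q) r.

Definition momentum_rhs (K gamma alpha : R) (phi : R -> R) (eps : R)
    (r q : R -> R) (x : R) : R :=
  transport eps (velocity r q) q x
  - r x * derive1 (potential K gamma alpha phi eps r) x.

(* [0, T[, with T possibly infinite. *)
Definition time_interval (T : \bar R) : set R :=
  [set t | 0 <= t /\ (t%:E < T)%E].

(* t |-> f t is a C^1 map from D to the continuous functions on the torus with
   the sup norm, with derivative f'; restricting to D makes the derivative
   one-sided at an endpoint of D. *)
Definition C1_torus_curve (D : set R) (f f' : R -> R -> R) : Prop :=
  forall t, D t ->
    [/\ torus_continuous (f t), torus_continuous (f' t),
        {uniform, (fun s x => (f s x - f t x) / (s - t)) @ within D t^'
                    --> f' t}
      & {uniform, f' @ within D (nbhs t) --> f' t}].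

Definition ode_solution (K gamma alpha : R) (phi : R -> R) (eps : R)
    (r0 u0 : R -> R) (T : \bar R) (r q : R -> R -> R) : Prop :=
  [/\ C1_torus_curve (time_interval T) r
        (fun t => density_rhs eps (r t) (q t)),
      C1_torus_curve (time_interval T) q
        (fun t => momentum_rhs K gamma alpha phi eps (r t) (q t)),
      forall t, time_interval T t -> forall x, 0 < r t x,
      r 0 = r0
    & velocity (r 0) (q 0) = u0].

(* The arguments of the families rho, rhou and Phi are eps, t, x. *)
Definition weak_asymptotic_solution (K gamma : R)
    (rho rhou Phi : R -> R -> R -> R) : Prop :=
  forall (t : R) (psi : R -> R), 0 < t -> test_function psi ->
  [/\ (\int[lebesgue_measure]_x (derive1 (fun s => rho eps s x) t * psi x)
       - \int[lebesgue_measure]_x (rhou eps t x * derive1 psi x))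
        @[eps --> 0^'+] --> 0,
      (\int[lebesgue_measure]_x (derive1 (fun s => rhou eps s x) t * psi x)
       - \int[lebesgue_measure]_x
           (rho eps t x * velocity (rho eps t) (rhou eps t) x ^+ 2 * derive1 psi x)
       + \int[lebesgue_measure]_x (rho eps t x * derive1 (Phi eps t) x * psi x))
        @[eps --> 0^'+] --> 0
    & \int[lebesgue_measure]_x
        ((Phi eps t x - K * gamma / (gamma - 1) * rho eps t x `^ (gamma - 1))
         * psi x)
        @[eps --> 0^'+] --> 0].

End System.

(* Main.v *)
Require Import Defs.
From HB Require Import structures.
From mathcomp Require Import all_boot all_order all_algebra.
From mathcomp Require Import all_classical all_reals all_analysis.
From mathcomp Require Import measurable_realfun ess_sup_inf.
From mathcomp Require Import ring lra.
Import Order.TTheory GRing.Theory Num.Theory.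
Import numFieldNormedType.Exports.
Local Open Scope classical_set_scope.
Local Open Scope ring_scope.

(** Write [u = q / r]. The total mass of [r] is conserved and
    [r `^ (gamma - 1) <= 1 + r], so convolution at scale [eps `^ alpha] bounds the
    force by [C * eps `^ (- 2 alpha)]. At a spatial maximum of [u] the transport
    terms can only decrease it, whence [|u| <= U + C * eps `^ (- 2 alpha) * t], and
    then [r] lies between two positive exponentials in time. On a bounded time
    interval every solution thus stays in a box; clamping the state to a slightly
    larger box makes the right-hand side globally Lipschitz, and the solution of
    the clamped system, obtained by Picard iteration, never leaves the box.

    Against a test function, summation by parts turns the transport terms into
    difference quotients, with an error at most [C * eps * \int r * |u|^k], [k <= 2],
    that is [C * eps `^ (1 - 4 alpha)]; the force terms cancel exactly. In the third
    relation the convolution is moved onto the test function, with an error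
    [C * eps `^ alpha]. *)

(** * Integrals of continuous functions *)

Section IntegralsOfContinuousFunctions.
Context {R : realType}.
Local Notation mu := (@lebesgue_measure R).
Implicit Types (f g F : R -> R) (a b c x : R).

(** Two kinds of constants have to be kept apart. For fixed [eps] any bound will do: the lower bound
    of the density, exponentially small in [1 / eps], serves only to make [q / r] and r^(gamma - 1)
    Lipschitz. The limit may use only what is uniform in [eps]: the mass and the sup norm of the
    initial velocity. Hence the sup norm is put on the derivative of the mollifier and the L1 norm
    on the density. The velocity inherits the rate eps^(-2 alpha) of the force, the momentum flux
    its square, and the upwind scheme gains one factor [eps]: this is the origin of [alpha < 1 / 4].

    The other obstacle is a circularity: the a priori bounds hold for the true system, and the
    clamped curve is known to solve it only while it stays in the box. It is broken by a box chosen
    from the data and a horizon alone, valid on every shorter interval of existence.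

    Sup norms are handled by estimates uniform in [x] on families of scalar functions: derivatives
    and integrals are taken pointwise in [x], through antiderivatives of continuous functions. *)

Lemma continuous_integrable_segment f a b :
  continuous f -> mu.-integrable `[a, b] (EFin \o f).
Proof.
move=> cf; apply: continuous_compact_integrable; first exact: segment_compact.
exact: continuous_subspaceT.
Qed.

Lemma Rintegral_segment_split f a b c : a <= b -> b <= c -> continuous f ->
  \int[mu]_(x in `[a, c]) f x =
  \int[mu]_(x in `[a, b]) f x + \int[mu]_(x in `[b, c]) f x.
Proof.
move=> ab bc cf.
have := @Rintegral_itvB R f (BLeft a) (BRight c) b
  (continuous_integrable_segment _ _ _ cf).
rewrite !bnd_simp => /(_ ab bc).
rewrite Rintegral_itv_obnd_cbnd; last first.
  apply: integrableS (continuous_integrable_segment _ b c cf) => //.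
  exact: subset_itv_oc_cc.
lra.
Qed.

(** An integral from a fixed base point is an antiderivative only to the right of that point.
    Subtracting the integral up to 0 makes the value independent of the base point ([GE]), which can
    then move with [x]; the base point [- |x| - 2] serves all [y] at distance less than 1 from
    [x]. *)
Lemma ex_antiderivative f : continuous f ->
  exists F, forall x, is_derive x 1 F (f x).
Proof.
move=> cf.
pose G a x := \int[mu]_(t in `[a, x]) f t - \int[mu]_(t in `[a, 0]) f t.
have GE a a' x : a <= a' -> a' <= x -> a' <= 0 -> G a x = G a' x.
  move=> aa' a'x a'0; rewrite /G (@Rintegral_segment_split f a a')//.
  by rewrite (@Rintegral_segment_split f a a' 0)//; lra.
exists (fun x => G (- `|x| - 1) x) => x.
have [dG G'] := @continuous_FTC1_closed R f (- `|x| - 2) x (x + 1)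
  ltac:(lra) (continuous_integrable_segment f _ _ cf)
  ltac:(have := ler_norm (- x); rewrite normrN; lra) (cf x).
have dG2 : is_derive x 1 (G (- `|x| - 2)) (f x).
  rewrite /G -[f x]subr0 -[X in is_derive _ _ _ (X - _)]G'.
  apply: is_deriveB; rewrite derive1E; exact: DeriveDef.
apply: near_eq_is_derive dG2; near=> y.
have yx : `|x - y| < 1 by near: y; exact: (@cvgr_dist_lt _ _ _ (nbhs x) _ id _ cvg_id).
have := ler_norm (- y); have := normr_ge0 y; have := normr_ge0 x.
have : `|y| <= `|x| + `|x - y|.
  by rewrite -{1}[y](subKr x) (le_trans (ler_normB _ _)).
rewrite normrN => *.
by apply: GE; lra.
Unshelve. all: by end_near. Qed.

Lemma Rintegral_segmentE f F a b : a <= b -> continuous f ->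
  (forall x, is_derive x 1 F (f x)) ->
  \int[mu]_(x in `[a, b]) f x = F b - F a.
Proof.
move=> ab cf dF.
have cF : continuous F.
  by move=> x; apply/differentiable_continuous/derivable1_diffP; have [] := dF x.
move: ab; rewrite le_eqVlt => /predU1P[->|ab].
  by rewrite set_itv1 Rintegral_set1 subrr.
rewrite /Rintegral (@continuous_FTC2 _ f F)//.
- exact: continuous_subspaceT.
- split.
  + by move=> x _; have [] := dF x.
  + exact/cvg_at_right_filter/cF.
  + exact/cvg_at_left_filter/cF.
- by move=> x _; rewrite derive1E; have [] := dF x.
Qed.

Lemma is_derive_comp_affine F (dF : R) a b x : is_derive (a * x + b) 1 F dF ->
  is_derive x 1 (fun y => F (a * y + b)) (a * dF).
Proof.
move=> dFx; rewrite mulrC.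
apply: (@is_derive1_comp _ F (fun y => a * y + b)).
rewrite -[X in is_derive _ _ _ X]addr0.
apply: (@is_deriveD _ _ _ (fun y => a * y) (cst b)).
rewrite -[X in is_derive _ _ _ X]mulr1.
exact: (is_deriveZ a (is_derive_id x (1 : R))).
Qed.

Lemma continuous_comp_affine f a b : continuous f ->
  continuous (fun y => f (a * y + b)).
Proof.
move=> cf x; apply: continuous_comp; last exact: cf.
by apply: cvgD; [apply: cvgM; [exact: cvg_cst|exact: cvg_id]|exact: cvg_cst].
Qed.

(** Given an antiderivative [F] of [f], the change of variables is the chain rule for
    [F (c * x + d)]. *)
Lemma Rintegral_segment_affine f a b c d : a <= b -> continuous f ->
  c * a + d <= c * b + d ->
  \int[mu]_(x in `[a, b]) (c * f (c * x + d)) =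
  \int[mu]_(x in `[c * a + d, c * b + d]) f x.
Proof.
move=> ab cf cd; have [F dF] := ex_antiderivative f cf.
rewrite (Rintegral_segmentE f F _ _ cd cf dF).
apply: (Rintegral_segmentE _ (fun x => F (c * x + d))) => //.
- by move=> x; apply: cvgM; [exact: cvg_cst|exact: continuous_comp_affine].
- by move=> x; exact: is_derive_comp_affine.
Qed.

Lemma Rintegral_segment_shift f a b c : a <= b -> continuous f ->
  \int[mu]_(x in `[a, b]) f (x + c) = \int[mu]_(x in `[a + c, b + c]) f x.
Proof.
move=> ab cf; have := @Rintegral_segment_affine f a b 1 c ab cf.
rewrite !mul1r lerD2r => <- //; apply: eq_Rintegral => x _.
by rewrite !mul1r.
Qed.

Lemma Rintegral_segment_reflect f a b c : a <= b -> continuous f ->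
  \int[mu]_(x in `[a, b]) f (c - x) = \int[mu]_(x in `[c - b, c - a]) f x.
Proof.
move=> ab cf; have [F dF] := ex_antiderivative f cf.
rewrite (Rintegral_segmentE f F (c - b) (c - a) _ cf dF) ?lerD2l ?lerN2//.
rewrite (_ : F (c - a) - F (c - b) =
  - F (- 1 * b + c) - - F (- 1 * a + c)); last first.
  by rewrite !mulN1r ![- _ + c]addrC; ring.
apply: (Rintegral_segmentE _ (fun x => - F (- 1 * x + c))) => //.
- under eq_fun do rewrite addrC -mulN1r.
  exact: continuous_comp_affine.
- move=> x; rewrite -[f _]opprK; apply: is_deriveN.
  rewrite -[X in is_derive _ _ _ X]mulN1r.
  by apply: is_derive_comp_affine; rewrite mulN1r addrC.
Qed.

Lemma Rintegral_segment_scale f a b c : a <= b -> 0 < c -> continuous f ->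
  \int[mu]_(x in `[c * a, c * b]) (c^-1 * f (x / c)) = \int[mu]_(x in `[a, b]) f x.
Proof.
move=> ab c0 cf.
have := @Rintegral_segment_affine f (c * a) (c * b) c^-1 0.
rewrite !addr0 !mulKf ?gt_eqF// ler_pM2l// => /(_ ab cf ab) <-.
by apply: eq_Rintegral => x _; rewrite addr0 [_ * x]mulrC.
Qed.

End IntegralsOfContinuousFunctions.

Section ContinuousFunctions.
Context {R : realType} {T : topologicalType}.
Implicit Types f g : T -> R.

Lemma continuous_add f g : continuous f -> continuous g ->
  continuous (fun x => f x + g x).
Proof. by move=> cf cg x; apply: cvgD; [exact: cf|exact: cg]. Qed.

Lemma continuous_opp f : continuous f -> continuous (fun x => - f x).
Proof. by move=> cf x; apply: cvgN; exact: cf. Qed.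

Lemma continuous_sub f g : continuous f -> continuous g ->
  continuous (fun x => f x - g x).
Proof. by move=> cf cg x; apply: cvgB; [exact: cf|exact: cg]. Qed.

Lemma continuous_mul f g : continuous f -> continuous g ->
  continuous (fun x => f x * g x).
Proof. by move=> cf cg x; apply: cvgM; [exact: cf|exact: cg]. Qed.

Lemma continuous_norm f : continuous f -> continuous (fun x => `|f x|).
Proof. by move=> cf x; apply: cvg_norm; exact: cf. Qed.

Lemma continuous_inv f : (forall x, f x != 0) -> continuous f ->
  continuous (fun x => (f x)^-1).
Proof. by move=> f0 cf x; apply: cvgV; [exact: f0|exact: cf]. Qed.

Lemma continuous_maxr f g : continuous f -> continuous g ->
  continuous (fun x => Num.max (f x) (g x)).
Proof. by move=> cf cg x; apply: continuous_max; [exact: cf|exact: cg]. Qed.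

Lemma continuous_minr f g : continuous f -> continuous g ->
  continuous (fun x => Num.min (f x) (g x)).
Proof. by move=> cf cg x; apply: continuous_min; [exact: cf|exact: cg]. Qed.

Lemma continuous_powR f (a : R) : (forall x, 0 < f x) -> continuous f ->
  continuous (fun x => f x `^ a).
Proof.
move=> f0 cf x; apply: (@continuous_comp _ _ _ f (fun y => y `^ a)).
  exact: cf.
have [d _] := @is_derive1_powR R a (f x) (f0 x).
exact/differentiable_continuous/derivable1_diffP.
Qed.

End ContinuousFunctions.

Section SegmentIntegrals.
Context {R : realType}.
Local Notation mu := (@lebesgue_measure R).
Implicit Types (f g F : R -> R) (a b c x T : R).

Lemma Rintegral_segmentD f g a b : continuous f -> continuous g ->
  \int[mu]_(x in `[a, b]) (f x + g x) =
  \int[mu]_(x in `[a, b]) f x + \int[mu]_(x in `[a, b]) g x.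
Proof.
by move=> cf cg; apply: RintegralD => //; exact: continuous_integrable_segment.
Qed.

Lemma Rintegral_segmentB f g a b : continuous f -> continuous g ->
  \int[mu]_(x in `[a, b]) (f x - g x) =
  \int[mu]_(x in `[a, b]) f x - \int[mu]_(x in `[a, b]) g x.
Proof.
by move=> cf cg; apply: RintegralB => //; exact: continuous_integrable_segment.
Qed.

Lemma Rintegral_segmentZ f a b c : continuous f ->
  \int[mu]_(x in `[a, b]) (c * f x) = c * \int[mu]_(x in `[a, b]) f x.
Proof.
by move=> cf; apply: RintegralZl => //; exact: continuous_integrable_segment.
Qed.

Lemma le_Rintegral_segment f g a b : continuous f -> continuous g ->
  (forall x, a <= x <= b -> f x <= g x) ->
  \int[mu]_(x in `[a, b]) f x <= \int[mu]_(x in `[a, b]) g x.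
Proof.
by move=> cf cg fg; apply: le_Rintegral => //;
  exact: continuous_integrable_segment.
Qed.

Lemma Rintegral_segment_cst a b c : a <= b ->
  \int[mu]_(x in `[a, b]) c = c * (b - a).
Proof.
move=> ab; rewrite Rintegral_cst//= lebesgue_measure_itv/= lte_fin.
move: ab; rewrite le_eqVlt => /predU1P[->|->]; last by [].
by rewrite ltxx subrr.
Qed.

Lemma norm_Rintegral_segment_le f g a b : continuous f -> continuous g ->
  (forall x, a <= x <= b -> `|f x| <= g x) ->
  `|\int[mu]_(x in `[a, b]) f x| <= \int[mu]_(x in `[a, b]) g x.
Proof.
move=> cf cg fg; apply: le_trans (le_normr_Rintegral _ _) _ => //.
  exact: continuous_integrable_segment.
by apply: le_Rintegral_segment => //; exact: continuous_norm.
Qed.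

Lemma le_Rintegral_subsegment f a b c d : continuous f ->
  (forall x, 0 <= f x) -> c <= a -> a <= b -> b <= d ->
  \int[mu]_(x in `[a, b]) f x <= \int[mu]_(x in `[c, d]) f x.
Proof.
move=> cf f0 ca ab bd.
rewrite (@Rintegral_segment_split _ f c a d)//; last exact: le_trans bd.
rewrite (@Rintegral_segment_split _ f a b d)//.
have I0 u v : 0 <= \int[mu]_(x in `[u, v]) f x by exact: Rintegral_ge0.
by rewrite addrCA lerDl addr_ge0.
Qed.

(** As a function of [a], the difference [F (a + T) - F a] has derivative [f (a + T) - f a = 0]. *)
Lemma Rintegral_periodic f a T : 0 <= T -> continuous f -> periodic f T ->
  \int[mu]_(x in `[a, a + T]) f x = \int[mu]_(x in `[0, T]) f x.
Proof.
move=> T0 cf pf; have [F dF] := ex_antiderivative f cf.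
rewrite (Rintegral_segmentE f F _ _ _ cf dF) ?lerDl//.
rewrite (Rintegral_segmentE f F _ _ _ cf dF)//.
rewrite -[X in F X - F 0]add0r.
apply: (@is_derive_0_is_cst _ (fun a => F (a + T) - F a)) => x.
rewrite -[X in is_derive _ _ _ X](subrr (f x)).
apply: is_deriveB.
have := @is_derive_comp_affine R F (f (x + T)) 1 T x.
under eq_fun do rewrite mul1r; rewrite !mul1r pf; apply.
by rewrite -pf.
Qed.

Lemma Rintegral_periodicn f a T n : 0 <= T -> continuous f -> periodic f T ->
  \int[mu]_(x in `[a, a + T *+ n]) f x = \int[mu]_(x in `[0, T]) f x *+ n.
Proof.
move=> T0 cf pf; elim: n => [|n ih].
  by rewrite !mulr0n addr0 set_itv1 Rintegral_set1.
rewrite (@Rintegral_segment_split _ f a (a + T *+ n))//.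
- by rewrite ih (mulrSr T) addrA Rintegral_periodic// -mulrSr.
- by rewrite lerDl mulrn_wge0.
- by rewrite lerD2l mulrSr lerDl.
Qed.

(** This turns the conserved mass over one period into a bound over any bounded window, covered by
    [n] periods. *)
Lemma le_Rintegral_periodic f a b T n : 0 <= T -> continuous f ->
  periodic f T -> (forall x, 0 <= f x) -> a <= b -> b - a <= T *+ n ->
  \int[mu]_(x in `[a, b]) f x <= \int[mu]_(x in `[0, T]) f x *+ n.
Proof.
move=> T0 cf pf f0 ab bn; rewrite -(@Rintegral_periodicn _ a)//.
by apply: le_Rintegral_subsegment => //; rewrite -lerBlDl.
Qed.

Lemma Rintegral_periodic_shift f T c : 0 <= T -> continuous f -> periodic f T ->
  \int[mu]_(x in `[0, T]) f (x + c) = \int[mu]_(x in `[0, T]) f x.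
Proof.
move=> T0 cf pf; rewrite Rintegral_segment_shift// add0r addrC.
exact: Rintegral_periodic.
Qed.

Lemma Rintegral_supportE f a b : (forall x, ~~ (a <= x <= b) -> f x = 0) ->
  \int[mu]_x f x = \int[mu]_(x in `[a, b]) f x.
Proof.
move=> f0; rewrite [RHS]Rintegral_mkcond; congr Rintegral; apply/funext => x.
rewrite patchE; case: ifPn => //.
rewrite notin_setE/= in_itv/= => /negP; exact: f0.
Qed.

Lemma Rintegral_shift f a b c : a <= b -> continuous f ->
  (forall x, ~~ (a <= x <= b) -> f x = 0) ->
  \int[mu]_x f (x + c) = \int[mu]_x f x.
Proof.
move=> ab cf f0; rewrite (@Rintegral_supportE f a b)//.
rewrite (@Rintegral_supportE _ (a - c) (b - c)); last first.
  by move=> x; rewrite lerBlDr lerBrDr => /f0.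
by rewrite Rintegral_segment_shift ?lerD2r// !subrK.
Qed.

End SegmentIntegrals.

(** * Extrema of continuous functions on the torus *)

Section TorusFunctions.
Context {R : realType}.
Implicit Types (f g : R -> R).

Lemma periodic_representative (T : R) x : 0 < T ->
  exists y, 0 <= y <= T /\ forall f, periodic f T -> f x = f y.
Proof.
move=> T0; pose k := Num.floor (x / T).
have /andP[k1 k2] := floor_itv (x / T); rewrite -/k in k1 k2.
exists (x - k%:~R * T); split.
  rewrite subr_ge0 -ler_pdivlMr// k1/= lerBlDl -{2}[T]mul1r -mulrDl.
  by rewrite -ler_pdivrMr// ltW// -[1]/(1%:~R) -intrD.
move=> f pf; case: (k) => n.
  by rewrite -[in LHS](subrK (n%:~R * T) x) mulrC mulr_natr (periodicn pf).
by rewrite NegzE mulrNz mulNr opprK mulrC mulr_natr (periodicn pf).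
Qed.

Lemma pi2_gt0 : 0 < pi *+ 2 :> R.
Proof. by rewrite pmulrn_lgt0// pi_gt0. Qed.

Lemma torus_argmax f : torus_continuous f ->
  exists c, forall x, f x <= f c.
Proof.
move=> [pf cf].
have [c _ fc] := EVT_max (ltW pi2_gt0) (continuous_subspaceT cf).
exists c => x; have [y [yT /(_ f pf) ->]] := periodic_representative _ x pi2_gt0.
by apply: fc; rewrite in_itv.
Qed.

Lemma torus_comp f (h : R -> R) : torus_fun f -> torus_fun (h \o f).
Proof. by move=> pf x /=; rewrite pf. Qed.

Lemma torus_bounded f : torus_continuous f ->
  exists2 C, 0 <= C & forall x, `|f x| <= C.
Proof.
move=> [pf cf].
have [c fc] : exists c, forall x, `|f x| <= `|f c|.
  by apply: torus_argmax; split; [exact: torus_comp|exact: continuous_norm].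
by exists `|f c|.
Qed.

Lemma torus_lower_bound f : torus_continuous f -> (forall x, 0 < f x) ->
  exists2 m, 0 < m & forall x, m <= f x.
Proof.
move=> [pf cf] f0.
have [c fc] : exists c, forall x, - f x <= - f c.
  apply: torus_argmax; split; last exact: continuous_opp.
  exact: (torus_comp f (fun x => - x)).
by exists (f c) => // x; rewrite -lerN2.
Qed.

End TorusFunctions.

(** * Picard iteration *)

Section Comparison.
Context {R : realType}.
Implicit Types (f df h dh : R -> R) (a b c s t x : R).

Lemma is_derive_continuous f df : (forall x, is_derive x 1 f (df x)) ->
  continuous f.
Proof.
by move=> dF x; apply/differentiable_continuous/derivable1_diffP; have [] := dF x.
Qed.

(** The bound on [c - t] is what converts a Lipschitz derivative into a quadratic Taylor remainder,
    on either side of [t]. *)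
Lemma MVT_two_sided f df s t : (forall x, is_derive x 1 f (df x)) ->
  exists c, [/\ `|c - t| <= `|s - t|, Num.min s t <= c & f s - f t = df c * (s - t)].
Proof.
move=> dF; have cf := is_derive_continuous _ _ dF.
have [st|ts|->] := ltgtP s t.
- have [c + e] := MVT st (fun x _ => dF x) (continuous_subspaceT cf).
  rewrite in_itv/= => /andP[sc ct]; exists c; split; last lra.
  + by rewrite !ltr0_norm; lra.
  + exact: ltW.
- have [c + e] := MVT ts (fun x _ => dF x) (continuous_subspaceT cf).
  rewrite in_itv/= => /andP[sc ct]; exists c; split; last lra.
  + by rewrite !gtr0_norm; lra.
  + exact: ltW.
- by exists t; split => //; rewrite !subrr mulr0.
Qed.

Lemma derivative_bound_lipschitz f df C s t : (forall x, is_derive x 1 f (df x)) ->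
  (forall x, `|df x| <= C) -> `|f s - f t| <= C * `|s - t|.
Proof.
move=> dF dC; have [c [_ _ ->]] := MVT_two_sided _ _ s t dF.
by rewrite normrM ler_wpM2r.
Qed.

(** This plays the part of Grönwall's inequality, with an explicit majorant [h]: both [f - h] and
    [- f - h] are nonincreasing. Derivatives are asked for only inside the interval, since solutions
    have one-sided derivatives at time 0. *)
Lemma derivative_comparison f df h dh b : 0 <= b ->
  {within `[0, b], continuous f} ->
  (forall t, 0 < t < b -> is_derive t 1 f (df t)) ->
  (forall t, is_derive t 1 h (dh t)) ->
  (forall t, 0 < t < b -> `|df t| <= dh t) ->
  `|f 0| <= h 0 -> `|f b| <= h b.
Proof.
move=> b0 cf dF dH fh fh0.
have ch := is_derive_continuous _ _ dH.
have main (g dg : R -> R) : {within `[0, b], continuous g} ->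
    (forall t, 0 < t < b -> is_derive t 1 g (dg t)) ->
    (forall t, 0 < t < b -> dg t <= dh t) -> g 0 <= h 0 -> g b <= h b.
  move=> cg dG gh gh0.
  have D t : 0 < t < b -> is_derive t 1 (g - h) (dg t - dh t).
    by move=> tb; have := dG t tb => ?; have := dH t => ?; exact: is_deriveB.
  suff : (g - h) b <= (g - h) 0 by rewrite !fctE; lra.
  apply: (@ler0_derive1_nincr _ (g - h) 0 b) => //.
  - by move=> t; rewrite in_itv/= => tb; have [] := D t tb.
  - move=> t; rewrite in_itv/= => tb; rewrite derive1E.
    by have [_ ->] := D t tb; rewrite subr_le0 gh.
  - move=> t; apply: cvgB; first exact: cg.
    exact: (continuous_subspaceT ch).
rewrite ler_norml; apply/andP; split.
  rewrite lerNl; apply: (main (- f) (fun t => - df t)).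
  - by move=> t; apply: cvgN; exact: cf.
  - by move=> t tb; apply: is_deriveN; exact: dF.
  - by move=> t tb; have := fh t tb; rewrite ler_norml; lra.
  - by move: fh0; rewrite fctE ler_norml; lra.
apply: (main f df) => //.
- by move=> t tb; have := fh t tb; rewrite ler_norml; lra.
- by move: fh0; rewrite ler_norml; lra.
Qed.

Lemma ler_geometric_half a b K : (forall n, a <= b + K / 2 ^+ n) -> a <= b.
Proof.
move=> h; apply/ler_addgt0Pr => e e0.
have [K0|K0] := leP K 0.
  have := h 0%N; rewrite expr0 divr1; lra.
near \oo => n.
apply: le_trans (h n) _; rewrite lerD2l ler_pdivrMr ?exprn_gt0//.
rewrite mulrC -ler_pdivrMr//.
apply: (@le_trans _ _ n%:R); last by rewrite -natrX ler_nat ltnW// ltn_expl.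
near: n; exact: nbhs_infty_ger.
Unshelve. all: by end_near. Qed.

(** Nested intervals: with [w n] the tail of the geometric series, [c n - w n] increases and
    [c n + w n] decreases, so the supremum of the lower ends lies in every interval. This gives the
    limit together with its rate. *)
Lemma geometric_half_limit (c : nat -> R) D :
  (forall n, `|c n.+1 - c n| <= D / 2 ^+ n) ->
  exists l, forall n, `|c n - l| <= 2 * D / 2 ^+ n.
Proof.
move=> hc.
have D0 : 0 <= D by have := hc 0%N; rewrite expr0 divr1; apply: le_trans.
pose w n := 2 * D / 2 ^+ n.
have wS n : w n = D / 2 ^+ n + w n.+1.
  rewrite /w exprS; field; rewrite expf_neq0 ?andbT//; lra.
have w0 n : 0 <= w n by rewrite divr_ge0 ?mulr_ge0// exprn_ge0.
pose u n := c n + w n; pose v n := c n - w n.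
have uD n m : u (n + m)%N <= u n.
  elim: m => [|m ih]; rewrite ?addn0// addnS; apply: le_trans ih.
  by rewrite /u (wS (n + m)%N); have := hc (n + m)%N; rewrite ler_norml; lra.
have vI n m : v n <= v (n + m)%N.
  elim: m => [|m ih]; rewrite ?addn0// addnS; apply: le_trans ih _.
  by rewrite /v (wS (n + m)%N); have := hc (n + m)%N; rewrite ler_norml; lra.
have vu n m : v n <= u m.
  apply: (le_trans (vI n m)); apply: le_trans (_ : u (n + m)%N <= _).
    by rewrite /u /v; have := w0 (n + m)%N; lra.
  by rewrite addnC.
have hs : has_sup (range v).
  split; first by exists (v 0%N), 0%N.
  by exists (u 0%N) => _ [n _ <-].
exists (sup (range v)) => n; rewrite -/(w n) ler_norml.
have : v n <= sup (range v) by apply: sup_upper_bound => //; exists n.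
have : sup (range v) <= u n by apply: ge_sup; [case: hs|move=> _ [m _ <-]].
rewrite /u /v; lra.
Qed.

End Comparison.

Section Picard.
Context {R : realType} {I : Type}.
Variables (P : (I -> R) -> Prop) (G : (I -> R) -> I -> R) (B L : R) (w0 : I -> R).
Hypothesis Pclosed : forall f,
  (forall e : R, 0 < e -> exists2 g, P g & forall i, `|f i - g i| <= e) -> P f.
Hypothesis Plin : forall a f g, P f -> P g -> P (fun i => f i + a * g i).
Hypotheses (B0 : 0 <= B) (L0 : 0 < L).
Hypothesis GP : forall w, P w -> P (G w).
Hypothesis GB : forall w i, P w -> `|G w i| <= B.
Hypothesis GL : forall w v (d : R) i, P w -> P v ->
  (forall j, `|w j - v j| <= d) -> `|G w i - G v i| <= L * d.
Hypothesis Pw0 : P w0.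

(** Iterates are curves on the whole line, which avoids endpoint derivatives; the convergence
    estimate is made for nonnegative times only. The Lipschitz constant [B] is preserved because [B]
    bounds the vector field on [P]. *)
Let good (v : R -> I -> R) := [/\ forall t : R, P (v t), v 0 = w0 &
  forall (s t : R) i, `|v s i - v t i| <= B * `|s - t|].

Let picard_step (v v' : R -> I -> R)   := forall (t : R) (i : I),
  is_derive t 1 (v' ^~ i) (G (v t) i).

Let picard_step_taylor v v' (s t : R) (i : I) : good v -> picard_step v v' ->
  `|v' s i - v' t i - (s - t) * G (v t) i| <= L * B * `|s - t| ^+ 2.
Proof.
move=> [Pv _ vB] vv'.
have [c [cst _ ->]] := MVT_two_sided _ _ s t (vv' ^~ i).
rewrite [_ * G _ _]mulrC -mulrBl normrM expr2 mulrA ler_wpM2r//.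
rewrite -mulrA; apply: GL => // j; apply: le_trans (vB _ _ _) _.
by rewrite ler_wpM2l.
Qed.

(** The new curve is built one index at a time by scalar antiderivatives. Membership in [P] is the
    only property that involves all indices together, and so needs an argument of its own. *)
Let picard_step_exists v : exists v', good v -> good v' /\ picard_step v v'.
Proof.
(* The step has to be a total function in order to be iterated; a curve that is not good is sent to
   itself. *)
have [gv|ngv] := pselect (good v); last by exists v.
have [Pv v0 vB] := gv.
have GBL (s t : R) i : `|G (v s) i - G (v t) i| <= L * (B * `|s - t|).
  by apply: GL.
have cG (i : I) : continuous (fun s => G (v s) i).
  move=> t; apply/cvgrPdist_le => e e0; near=> s.
  apply: le_trans (GBL _ _ _) _; rewrite mulrA.
  apply: (@le_trans _ _ ((L * B + 1) * `|t - s|)).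
    by rewrite ler_wpM2r// lerDl.
  rewrite mulrC -ler_pdivlMr ?ltr_wpDl ?mulr_ge0 ?(ltW L0)//.
  near: s; apply: (@cvgr_dist_le _ _ _ (nbhs t) _ id t cvg_id).
  by rewrite divr_gt0// ltr_wpDl// mulr_ge0// ltW.
have [F dF] := @choice _ _ _ (fun i : I => ex_antiderivative _ (cG i)).
pose v' (t : R) i := w0 i + (F i t - F i 0).
have sv' : picard_step v v'.
  move=> t i; rewrite (_ : G (v t) i = 0 + (G (v t) i - 0)); last by rewrite add0r subr0.
  have h := is_deriveD (is_derive_cst (w0 i) t (1 : R))
    (is_deriveB (dF i t) (is_derive_cst (F i 0) t (1 : R))).
  exact: h.
exists v' => _; split=> //.
have v'0 : v' 0 = w0 by apply/funext => i; rewrite /v' subrr addr0.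
split=> // [t|s t i].
- (* [v' t] is a uniform limit of Euler sums of elements of [P]. *)
  apply: Pclosed => e e0.
  near \oo => N.
  have N0 : 0 < N%:R :> R by rewrite ltr0n; near: N; exact: nbhs_infty_gt.
  have euler k : exists2 g, P g &
      forall i, `|v' (k%:R * (t / N%:R)) i - g i| <=
                k%:R * (L * B * `|t / N%:R| ^+ 2).
    elim: k => [|k [g Pg kg]].
      by exists w0 => // i; rewrite !mul0r v'0 subrr normr0.
    exists (fun i => g i + (t / N%:R) * G (v (k%:R * (t / N%:R))) i).
      by apply: Plin => //; exact: GP.
    move=> i; have := picard_step_taylor _ _ (k.+1%:R * (t / N%:R)) (k%:R * (t / N%:R)) i gv sv'.
    rewrite -mulrBl -natrB// subSnn mul1r => h.
    set E := L * B * _.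
    have -> : k.+1%:R * E = E + k%:R * E by rewrite -natr1; ring.
    apply: le_trans (lerD h (kg i)); apply: le_trans (ler_normD _ _).
    by rewrite le_eqVlt; apply/orP; left; apply/eqP; congr (`|_|); ring.
  have [g Pg] := euler N.
  rewrite mulrCA mulfV ?gt_eqF// mulr1 => kg.
  exists g => // i; apply: le_trans (kg i) _.
  rewrite normrM exprMn normfV normr_nat.
  have -> : N%:R * (L * B * (`|t| ^+ 2 * N%:R^-1 ^+ 2)) =
            L * B * `|t| ^+ 2 / N%:R :> R.
    by field; rewrite gt_eqF.
  rewrite ler_pdivrMr// (mulrC e) -ler_pdivrMr//.
  near: N; exact: nbhs_infty_ger.
- by apply: (derivative_bound_lipschitz _ _ _ s t (sv' ^~ i)) => x; exact: GB.
Unshelve. all: by end_near. Qed.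

(** The equation is stated through increments with a quadratic remainder. The bound is uniform in
    [i], so it is differentiability in the sup norm, includes the one-sided derivative at 0, and
    survives the limit of the iterates without exchanging limits. *)
Theorem picard_lindelof : exists w : R -> I -> R,
  [/\ w 0 = w0, forall t : R, 0 <= t -> P (w t),
    forall (s t : R) i, 0 <= s -> 0 <= t -> `|w s i - w t i| <= B * `|s - t| &
    forall (s t : R) i, 0 <= s -> 0 <= t ->
      `|w s i - w t i - (s - t) * G (w t) i| <= L * B * `|s - t| ^+ 2].
Proof.
have [step hstep] := choice picard_step_exists.
pose v n : R -> I -> R := iter n step (fun _ => w0).
have gv n : good (v n).
  elim: n => [|n ih]; last by have [] := hstep _ ih.
  by split=> // s t i; rewrite subrr normr0 mulr_ge0.
have sv n : picard_step (v n) (v n.+1) by have [] := hstep _ (gv n).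
(* The first iterate moves by at most [B * t], and [l * t <= expR (l * t)] bounds this by
   [C * expR (l * t)]. *)
pose l := 2 * L; pose C := B / l.
have l0 : 0 < l by rewrite mulr_gt0.
have C0 : 0 <= C by rewrite divr_ge0// ltW.
have dexp n (t : R) : is_derive t 1 (fun t => C / 2 ^+ n * expR (l * t))
    (C / 2 ^+ n * (l * expR (l * t))).
  have := @is_derive_comp_affine R expR (expR (l * t)) l 0 t.
  under eq_fun do rewrite addr0.
  rewrite addr0 => /(_ (is_derive_expR _)) h.
  exact: (is_deriveZ (C / 2 ^+ n) h).
(* The weight [expR (2 * L * t)] makes each iteration halve the distance. *)
have near_step n (t : R) i : 0 <= t ->
    `|v n.+1 t i - v n t i| <= C * expR (l * t) / 2 ^+ n.
  elim: n t i => [|n ih] t i t0.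
    rewrite expr0 divr1.
    have [_ _ /(_ t 0 i)] := gv 1%N; have [_ -> _] := gv 1%N.
    move=> /le_trans; apply; rewrite subr0 ger0_norm// /C.
    rewrite -mulrA ler_wpM2l// mulrC ler_pdivlMr// mulrC.
    by apply: le_trans (expR_ge1Dx _); rewrite lerDr.
  have -> : C * expR (l * t) / 2 ^+ n.+1 = C / 2 ^+ n.+1 * expR (l * t).
    by rewrite mulrAC.
  have D (s : R) : is_derive s 1 (fun s => v n.+2 s i - v n.+1 s i)
      (G (v n.+1 s) i - G (v n s) i).
    exact: is_deriveB (sv n.+1 s i) (sv n s i).
  apply: (derivative_comparison (fun t => v n.+2 t i - v n.+1 t i) _
    (fun t => C / 2 ^+ n.+1 * expR (l * t)) _ t t0 _ (fun s _ => D s) (dexp n.+1)).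
  - exact/continuous_subspaceT/is_derive_continuous.
  - move=> s /andP[s0 _].
    have -> : C / 2 ^+ n.+1 * (l * expR (l * s)) = L * (C * expR (l * s) / 2 ^+ n).
      by rewrite /l exprS; field; rewrite expf_neq0 ?andbT//; lra.
    apply: GL; [by have [] := gv n.+1|by have [] := gv n|].
    by move=> j; apply: ih; exact: ltW.
  - have [_ -> _] := gv n.+2; have [_ -> _] := gv n.+1.
    by rewrite subrr normr0 mulr_ge0 ?expR_ge0// divr_ge0// exprn_ge0.
have lim (t : R) (i : I) : exists x, 0 <= t ->
    forall n, `|v n t i - x| <= 2 * (C * expR (l * t)) / 2 ^+ n.
  have [t0|_] := leP 0 t; last by exists 0.
  have [x hx] := geometric_half_limit (fun n => v n t i) _ (fun n => near_step n t i t0).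
  by exists x => _.
have /choice[w hw] : forall t : R, exists x : I -> R, 0 <= t ->
    forall n i, `|v n t i - x i| <= 2 * (C * expR (l * t)) / 2 ^+ n.
  move=> t; have [x hx] := choice (lim t); exists x => t0 n i; exact: hx.
have Pw (t : R) : 0 <= t -> P (w t).
  move=> t0; apply: Pclosed => e e0; near \oo => n.
  exists (v n t); first by have [] := gv n.
  move=> i; rewrite distrC; apply: le_trans (hw t t0 n i) _.
  rewrite ler_pdivrMr ?exprn_gt0// (mulrC e) -ler_pdivrMr//.
  apply: (@le_trans _ _ n%:R); last by rewrite -natrX ler_nat ltnW// ltn_expl.
  near: n; exact: nbhs_infty_ger.
exists w; split=> //.
- apply/funext => i; apply/eqP; rewrite -subr_eq0 -normr_le0.
  apply: (@ler_geometric_half _ _ _ (2 * (C * expR (l * 0)))) => n.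
  rewrite add0r; apply: le_trans (hw 0 (lexx _) n i).
  by have [_ -> _] := gv n; rewrite distrC.
- move=> s t i s0 t0.
  apply: (@ler_geometric_half _ _ _
    (2 * (C * expR (l * s)) + 2 * (C * expR (l * t)))) => n.
  rewrite mulrDl.
  have -> : w s i - w t i =
    (v n s i - v n t i) + (- (v n s i - w s i) + (v n t i - w t i)) by ring.
  apply: le_trans (ler_normD _ _) (lerD _ _); first by have [] := gv n.
  apply: le_trans (ler_normD _ _) _.
  by rewrite normrN lerD// hw.
- move=> s t i s0 t0.
  apply: (@ler_geometric_half _ _ _
    (2 * (C * expR (l * s)) + 2 * (C * expR (l * t)) +
     `|s - t| * (L * (2 * (C * expR (l * t)))))) => n.
  (* The derivative of iterate [n.+1] is the field along iterate [n], so the remainder estimate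
     pairs consecutive iterates; the other terms are of order [2 ^- n]. *)
  have -> : w s i - w t i - (s - t) * G (w t) i =
    (v n.+1 s i - v n.+1 t i - (s - t) * G (v n t) i) +
    (- (v n.+1 s i - w s i) + (v n.+1 t i - w t i) +
     (s - t) * (G (v n t) i - G (w t) i)) by ring.
  apply: le_trans (ler_normD _ _) (lerD _ _); first exact: picard_step_taylor.
  rewrite [leRHS]mulrDl; apply: le_trans (ler_normD _ _) (lerD _ _).
    have hS (r : R) j : 0 <= r -> `|v n.+1 r j - w r j| <= 2 * (C * expR (l * r)) / 2 ^+ n.
      move=> r0; apply: le_trans (hw r r0 n.+1 j) _.
      apply: ler_wpM2l; first by apply: mulr_ge0 => //; apply: mulr_ge0 => //; exact: expR_ge0.
      by rewrite lef_pV2 ?posrE ?exprn_gt0// ler_weXn2l// ler1n.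
    by apply: le_trans (ler_normD _ _) _; rewrite normrN mulrDl lerD// hS.
  rewrite normrM -!mulrA ler_wpM2l//.
  apply: GL => [||j]; [by have [] := gv n|exact: Pw|].
  by have := hw t t0 n j; rewrite -!mulrA.
Unshelve. all: by end_near. Qed.

End Picard.

(** * Curves in the space of continuous functions on the torus *)

Section Curves.
Context {R : realType}.
Implicit Types (D : set R) (f : R -> R -> R).

Lemma cvg_uniformP (F : set_system R) (g : R -> R -> R) (f : R -> R) :
  Filter F -> {uniform, g @ F --> f} <->
  forall e : R, 0 < e -> F [set s | forall x, `|g s x - f x| <= e].
Proof.
move=> FF; split.
- move=> gf e e0; apply: (gf [set h | forall x, `|h x - f x| <= e]).
  apply/uniform_nbhs; exists [set xy | ball xy.1 e xy.2]; split.
    exact: (entourage_ball _ (PosNum e0)).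
  move=> h /= hf x; rewrite distrC; apply: ltW; exact: hf.
- move=> h P /uniform_nbhs[E [+ EP]].
  rewrite -entourage_from_ballE => -[e /= e0 eE].
  apply: filterS (h (e / 2) _); last by rewrite divr_gt0.
  move=> s /= hs; apply: EP => x _; apply: eE.
  rewrite /= /ball/= distrC; apply: le_lt_trans (hs x) _.
  by rewrite ltr_pdivrMr// ltr_pMr// ltr1n.
Qed.

Definition uniform_curve D f := forall t, D t -> forall e, 0 < e ->
  exists2 d, 0 < d & forall s, D s -> `|s - t| < d ->
    forall x, `|f s x - f t x| <= e.

(** Differentiability in the sup norm with the denominator cleared, so that [s = t] need not be
    excluded; restricting [s] to [D] makes it one-sided at endpoints. *)
Definition uniform_diff_curve D f f' := forall t, D t -> forall e, 0 < e ->
  exists2 d, 0 < d & forall s, D s -> `|s - t| < d ->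
    forall x, `|f s x - f t x - (s - t) * f' t x| <= e * `|s - t|.

Lemma C1_torus_curveP D f f' : C1_torus_curve D f f' <->
  [/\ forall t, D t -> torus_continuous (f t),
      forall t, D t -> torus_continuous (f' t),
      uniform_diff_curve D f f' & uniform_curve D f'].
Proof.
split=> [h|[h1 h2 h3 h4] t Dt].
- split=> [t /h[]//|t /h[]//|t Dt e e0|t Dt e e0]; have [_ _ h3 h4] := h t Dt.
  + have [d /= d0 hd] := (cvg_uniformP _ _ _ _).1 h3 e e0.
    exists d => // s Ds std x.
    have [->|st] := eqVneq s t; first by rewrite !subrr mul0r subr0 normr0 mulr0.
    have := hd s; rewrite /ball/= distrC => /(_ std st Ds x).
    rewrite -(@ler_pM2r _ `|s - t|) ?normr_gt0 ?subr_eq0// -normrM.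
    by rewrite mulrBl divfK ?subr_eq0// [f' _ _ * _]mulrC.
  + have [d /= d0 hd] := (cvg_uniformP _ _ _ _).1 h4 e e0.
    exists d => // s Ds std; apply: hd => //.
    by rewrite /ball/= distrC.
- split; [exact: h1|exact: h2| |].
  + apply/cvg_uniformP => e e0; have [d d0 hd] := h3 t Dt e e0.
    exists d => //= s /=; rewrite /ball/= distrC => std st Ds x.
    rewrite -(@ler_pM2r _ `|s - t|) ?normr_gt0 ?subr_eq0// -normrM.
    by rewrite mulrBl divfK ?subr_eq0// [f' _ _ * _]mulrC; exact: hd.
  + apply/cvg_uniformP => e e0; have [d d0 hd] := h4 t Dt e e0.
    exists d => //= s /=; rewrite /ball/= distrC => std Ds.
    exact: hd.
Qed.

Lemma uniform_diff_curve_continuous D f f' : uniform_diff_curve D f f' ->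
  (forall t, D t -> torus_continuous (f' t)) -> uniform_curve D f.
Proof.
move=> h f't t Dt e e0.
have [d d0 hd] := h t Dt 1 ltr01.
have [C C0 hC] := torus_bounded _ (f't t Dt).
exists (Num.min d (e / (1 + C))).
  by rewrite lt_min d0 divr_gt0// ltr_wpDr.
move=> s Ds; rewrite lt_min => /andP[sd se] x.
have -> : f s x - f t x = (f s x - f t x - (s - t) * f' t x) + (s - t) * f' t x.
  by ring.
apply: le_trans (ler_normD _ _) _.
apply: le_trans (lerD (hd s Ds sd x) (lexx _)) _.
rewrite normrM mulrC -mulrDr.
apply: (@le_trans _ _ (`|s - t| * (1 + C))); first by rewrite ler_wpM2l// lerD2l.
by rewrite -ler_pdivlMr ?ltr_wpDr// ltW.
Qed.

Lemma uniform_diff_curve_is_derive D f f' (t x : R) :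
  uniform_diff_curve D f f' -> nbhs t D -> is_derive t 1 (f ^~ x) (f' t x).
Proof.
move=> h tD; have Dt : D t := nbhs_singleton tD.
have lim : h^-1 *: (((f ^~ x) \o shift t) (h *: (1 : R)) - f t x) @[h --> 0^'] --> f' t x.
  apply/cvgrPdist_le => e e0; have [d d0 hd] := h t Dt e e0.
  near=> k.
  have k0 : k != 0 by near: k; exact: nbhs_dnbhs_neq.
  rewrite /= /GRing.scale/= mulr1 -(@ler_pM2r _ `|k|) ?normr_gt0//.
  rewrite -normrM mulrBl mulrAC mulVf// mul1r distrC.
  have := hd (k + t) _ _ x; rewrite addrK [f' t x * k]mulrC; apply.
    near: k; apply: nbhs_dnbhs.
    have : (fun k : R => k + t) @ nbhs 0 --> t.
      by rewrite -[X in _ --> X]add0r; apply: cvgD; [exact: cvg_id|exact: cvg_cst].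
    by apply.
  near: k; apply: nbhs_dnbhs.
  exists d => //= k; rewrite /ball/= sub0r normrN; exact.
apply: DeriveDef; first by apply/cvg_ex; exists (f' t x).
exact: cvg_lim lim.
Unshelve. all: by end_near. Qed.

Lemma uniform_curve_continuous D f x b : uniform_curve D f -> `[0, b] `<=` D ->
  {within `[0, b], continuous (f ^~ x)}.
Proof.
move=> h bD; apply/subspace_continuousP => t /bD Dt.
apply/cvgrPdist_le => e e0; have [d d0 hd] := h t Dt e e0.
exists d => //= s /=; rewrite /ball/= distrC => std sb; rewrite distrC.
by apply: hd => //; exact: bD.
Qed.

Lemma uniform_curve_subset D D' f : D' `<=` D -> uniform_curve D f ->
  uniform_curve D' f.
Proof.
move=> DD h t /DD Dt e e0; have [d d0 hd] := h t Dt e e0.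
by exists d => // s /DD; exact: hd.
Qed.

Lemma uniform_diff_curve_subset D D' f f' : D' `<=` D ->
  uniform_diff_curve D f f' -> uniform_diff_curve D' f f'.
Proof.
move=> DD h t /DD Dt e e0; have [d d0 hd] := h t Dt e e0.
by exists d => // s /DD; exact: hd.
Qed.

(* The hypothesis on positive times excludes an interior (or final) maximum,
   hence the maximum over [0, b] x T is attained at time 0. *)
Lemma torus_maximum_principle (z : R -> R -> R) b C : 0 <= b ->
  uniform_curve `[0, b] z ->
  (forall t, 0 <= t <= b -> torus_continuous (z t)) ->
  (forall t x, 0 < t <= b -> (forall y, z t y <= z t x) ->
    exists2 s, 0 <= s <= b & z t x < z s x) ->
  (forall y, z 0 y <= C) ->
  forall t x, 0 <= t <= b -> z t x <= C.
Proof.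
move=> b0 uz tz hz z0.
pose K : set (R * R) := `[0, b] `*` `[0, pi *+ 2].
have cK : compact K by apply: compact_setX; exact: segment_compact.
have K0 : K !=set0.
  by exists (0, 0); split; rewrite /= in_itv/= lexx//= ltW// pi2_gt0.
have cz : {within K, continuous (fun p : R * R => z p.1 p.2)}.
  apply/subspace_continuousP => -[t x] [/= tb _].
  have tb' : 0 <= t <= b by move: tb; rewrite in_itv.
  apply/cvgrPdist_le => e e0.
  have e20 : 0 < e / 2 by rewrite divr_gt0.
  have [d d0 hd] := uz t tb (e / 2) e20.
  have [_ /(_ x)/cvgrPdist_le/(_ _ e20)] := tz t tb'.
  move=> /nbhs_ballP[d' /= d'0 hd'].
  apply/nbhs_ballP; exists (Num.min d d'); first by rewrite /= lt_min d0.
  move=> [s y] [/= std xyd] [/= sb _].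
  have -> : z t x - z s y = (z t x - z t y) + - (z s y - z t y) by ring.
  apply: le_trans (ler_normD _ _) _; rewrite [e]splitr normrN lerD//.
    by apply: hd'; apply: le_ball xyd; rewrite ge_min lexx orbT.
  apply: hd => //; rewrite distrC.
  by have := std; rewrite /ball/= lt_min => /andP[].
have [[t0 x0] /set_mem[/= t0b _] max] := compact_EVT_max K0 cK cz.
have gmax t x : 0 <= t <= b -> z t x <= z t0 x0.
  move=> tb; have [y [yT zy]] := periodic_representative _ x (@pi2_gt0 R).
  have [pz _] := tz t tb; rewrite (zy _ pz).
  by apply: (max (t, y)); apply/mem_set; split; rewrite /= in_itv.
move: t0b; rewrite /= in_itv/= => t0b.
have t00 : t0 = 0.
  apply/eqP/negP => /negP t0N.
  have [|y|s sb] := hz t0 x0; last by rewrite ltNge gmax.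
    by rewrite lt_neqAle eq_sym t0N.
  exact: gmax.
by move=> t x tb; apply: le_trans (gmax t x tb) _; rewrite t00.
Qed.

End Curves.

(** * Convolution with smooth kernels *)

Section Bumps.
Context {R : realType}.
Local Notation mu := (@lebesgue_measure R).
Implicit Types (f g h F p : R -> R) (a b c x y k l A D : R).

Lemma is_derive_of_little_o F x l :
  (forall e, 0 < e -> exists2 d, 0 < d & forall k, `|k| < d ->
    `|F (x + k) - F x - k * l| <= e * `|k|) ->
  is_derive x 1 F l.
Proof.
move=> h.
have lim : k^-1 *: ((F \o shift x) (k *: (1 : R)) - F x) @[k --> 0^'] --> l.
  apply/cvgrPdist_le => e e0; have [d d0 hd] := h e e0.
  near=> k.
  have k0 : k != 0 by near: k; exact: nbhs_dnbhs_neq.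
  rewrite /= /GRing.scale/= mulr1 -(@ler_pM2r _ `|k|) ?normr_gt0//.
  rewrite -normrM mulrBl mulrAC mulVf// mul1r distrC addrC.
  rewrite [l * k]mulrC [k + x]addrC [X in `|X|]addrC; apply: hd.
  near: k; apply: nbhs_dnbhs.
  exists d => //= k; rewrite /ball/= sub0r normrN; exact.
apply: DeriveDef; first by apply/cvg_ex; exists l.
exact: cvg_lim lim.
Unshelve. all: by end_near. Qed.

Lemma is_derive_of_quadratic F x l C : 0 <= C ->
  (forall k, `|k| <= 1 -> `|F (x + k) - F x - k * l| <= C * `|k| ^+ 2) ->
  is_derive x 1 F l.
Proof.
move=> C0 h; apply: is_derive_of_little_o => e e0.
exists (Num.min 1 (e / (C + 1))).
  by rewrite lt_min ltr01 divr_gt0// ltr_wpDl.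
move=> k; rewrite lt_min => /andP[k1 ke].
apply: le_trans (h k (ltW k1)) _; rewrite expr2 mulrA ler_wpM2r//.
rewrite ltr_pdivlMr ?ltr_wpDl// in ke.
have := normr_ge0 k; nra.
Qed.

(** Only two derivatives, a support radius and one common bound are ever used of a compactly
    supported smooth function. Recording them explicitly lets the constants be followed through the
    rescaling by [eps], and treats mollifier and test function alike. *)
Record bump A D p p1 p2 : Prop := {
  bump_radius : 0 < A;
  bump_derive : forall x, is_derive x 1 p (p1 x);
  bump_derive1 : forall x, is_derive x 1 p1 (p2 x);
  bump_support : forall x, A < `|x| -> p x = 0 /\ p1 x = 0;
  bump_le : forall x, `|p x| <= D;
  bump1_le : forall x, `|p1 x| <= D;
  bump2_le : forall x, `|p2 x| <= D }.

Lemma compact_support_bounded f A : 0 < A -> continuous f ->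
  (forall x, A < `|x| -> f x = 0) -> exists2 C, 0 <= C & forall x, `|f x| <= C.
Proof.
move=> A0 cf f0.
have [c _ fc] := @EVT_max _ (fun x => `|f x|) (- A) A ltac:(lra)
  (continuous_subspaceT (continuous_norm f cf)).
exists `|f c| => // x; have [Ax|xA] := ltP A `|x|.
  by rewrite f0// normr0.
by apply: fc; rewrite in_itv/= -ler_norml.
Qed.

Lemma test_function_bump p : test_function p -> exists A D,
  bump A D p (derive1 p) (derive1 (derive1 p)).
Proof.
move=> [dp cp].
have der n x : is_derive x 1 (derive1n n p) (derive1n n.+1 p x).
  by rewrite derive1nS derive1E; apply: DeriveDef => //; exact: dp.
have cont n : continuous (derive1n n p) := is_derive_continuous _ _ (der n).
have [M [_ hM]] := compact_bounded cp.
(* Boundedness of the closed support gives a bound by every number greater than [M]; this one is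
   moreover positive. *)
pose A := `|M| + 1.
have A0 : 0 < A by rewrite ltr_wpDl.
have p0 x : A < `|x| -> p x = 0.
  move=> Ax; apply/eqP/negP => /negP px.
  have MA : M < A by rewrite (le_lt_trans (ler_norm M))// ltrDl.
  have cx : closure [set y | p y != 0] x by exact: subset_closure.
  by have := hM A MA x cx; rewrite /= leNgt Ax.
(* The set [A < |x|] is open and [p] vanishes on it, hence so does every derivative. *)
have supp n x : A < `|x| -> derive1n n p x = 0.
  elim: n x => [|n ih] x Ax; first exact: p0.
  rewrite derive1nS derive1E.
  have : is_derive x 1 (derive1n n p) 0.
    apply: near_eq_is_derive (is_derive_cst (0 : R) x (1 : R)).
    have : \forall y \near x, A < `|y|.
      have := @continuous_norm R R id (fun _ => cvg_id) x.
      by move=> /cvgr_gt/(_ _ Ax).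
    by apply: filterS => y Ay; rewrite ih.
  by case.
have bd n : exists2 C, 0 <= C & forall x, `|derive1n n p x| <= C.
  by apply: (compact_support_bounded _ A) => // x; exact: supp.
have [C0 C0p h0] := bd 0%N; have [C1 C1p h1] := bd 1%N.
have [C2 C2p h2] := bd 2%N.
exists A, (C0 + C1 + C2); split; first exact: A0.
- exact: (der 0%N).
- exact: (der 1%N).
- by move=> x Ax; split; [exact: (supp 0%N)|exact: (supp 1%N)].
- by move=> x; apply: le_trans (h0 x) _; rewrite -addrA lerDl addr_ge0.
- by move=> x; apply: le_trans (h1 x) _; rewrite addrAC lerDr addr_ge0.
- by move=> x; apply: le_trans (h2 x) _; rewrite lerDr addr_ge0.
Qed.

Lemma derivative_taylor f g h D x k : (forall y, is_derive y 1 f (g y)) ->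
  (forall y, is_derive y 1 g (h y)) -> (forall y, `|h y| <= D) ->
  `|f (x + k) - f x - k * g x| <= D * `|k| ^+ 2.
Proof.
move=> df dg hD.
have [c [cx _]] := MVT_two_sided _ _ (x + k) x df.
rewrite addrAC subrr add0r => ->; rewrite [k * g x]mulrC -mulrBl normrM.
rewrite expr2 mulrA ler_wpM2r//.
apply: le_trans (derivative_bound_lipschitz _ _ _ c x dg hD) _.
rewrite ler_wpM2l ?(le_trans (normr_ge0 _) (hD 0))//.
by move: cx; rewrite addrAC subrr add0r.
Qed.

Lemma continuous_convolution_integrand h f x : continuous h -> continuous f ->
  continuous (fun z => h z * f (x - z)).
Proof.
move=> ch cf; apply: continuous_mul => // z.
by apply: continuous_comp; [apply: cvgB; [exact: cvg_cst|exact: cvg_id]|exact: cf].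
Qed.

(** After the substitution, [x] appears only in the smooth kernel and the window may be taken
    independent of [x]: this is how [h], merely continuous, gets out of the way of
    differentiation. *)
Lemma convolution_window A h f x a b : 0 < A -> continuous h -> continuous f ->
  (forall x, A < `|x| -> f x = 0) -> a <= x - A -> x + A <= b ->
  convolution h f x = \int[mu]_(z in `[a, b]) (h z * f (x - z)).
Proof.
move=> A0 ch cf f0 ax xb; rewrite /convolution.
have ab : x - b <= x - a by lra.
rewrite (@Rintegral_supportE _ _ (x - b) (x - a)); last first.
  move=> y yab; rewrite f0 ?mulr0// ltNge; apply/negP => yA.
  by move/negP: yab; apply; move: yA; rewrite ler_norml; lra.
have := @Rintegral_segment_reflect R (fun z => h z * f (x - z)) (x - b) (x - a) x.
rewrite !subKr => <- //; first by apply: eq_Rintegral => y _; rewrite subKr.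
apply: continuous_mul => // z.
by apply: continuous_comp; [apply: cvgB; [exact: cvg_cst|exact: cvg_id]|exact: cf].
Qed.

(** The Taylor remainder of the kernel is at most [D * k ^ 2] uniformly, and can be integrated
    against [|h|]. The window has a margin 1 for the increments [|k| <= 1]. *)
Lemma is_derive_convolution A D g g1 g2 h x : bump A D g g1 g2 ->
  continuous h ->
  is_derive x 1 (convolution h g) (convolution h g1 x).
Proof.
move=> bg ch.
have A0 := bump_radius _ _ _ _ _ bg.
have cg := is_derive_continuous _ _ (bump_derive _ _ _ _ _ bg).
have cg1 := is_derive_continuous _ _ (bump_derive1 _ _ _ _ _ bg).
pose a := x - A - 1; pose b := x + A + 1.
have gs y : A < `|y| -> g y = 0 by move=> /(bump_support _ _ _ _ _ bg)[].
have g1s y : A < `|y| -> g1 y = 0 by move=> /(bump_support _ _ _ _ _ bg)[].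
apply: (@is_derive_of_quadratic _ _ _ (D * \int[mu]_(z in `[a, b]) `|h z|)).
  by rewrite mulr_ge0// ?Rintegral_ge0// (le_trans (normr_ge0 _) (bump_le _ _ _ _ _ bg 0)).
move=> k; rewrite ler_norml => k1.
rewrite !(@convolution_window A h _ _ a b)//; rewrite ?/a ?/b; try lra.
rewrite -Rintegral_segmentZ; last exact: continuous_convolution_integrand.
rewrite -Rintegral_segmentB; [|exact: continuous_convolution_integrand..].
rewrite -Rintegral_segmentB; last first.
- by apply: continuous_mul; [move=> ?; exact: cvg_cst|exact: continuous_convolution_integrand].
- by apply: continuous_sub; exact: continuous_convolution_integrand.
rewrite mulrAC -Rintegral_segmentZ; last exact: continuous_norm.
apply: norm_Rintegral_segment_le.
- apply: continuous_sub; first by apply: continuous_sub; exact: continuous_convolution_integrand.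
  by apply: continuous_mul; [move=> ?; exact: cvg_cst|exact: continuous_convolution_integrand].
- by apply: continuous_mul; [move=> ?; exact: cvg_cst|exact: continuous_norm].
move=> z _.
have -> : h z * g (x + k - z) - h z * g (x - z) - k * (h z * g1 (x - z)) =
  h z * (g (x - z + k) - g (x - z) - k * g1 (x - z)).
  by rewrite (_ : x + k - z = x - z + k); ring.
rewrite normrM mulrC ler_wpM2r//.
exact: derivative_taylor (bump_derive _ _ _ _ _ bg) (bump_derive1 _ _ _ _ _ bg)
  (bump2_le _ _ _ _ _ bg).
Qed.

Lemma continuous_convolution1 A D g g1 g2 h : bump A D g g1 g2 ->
  continuous h -> continuous (convolution h g1).
Proof.
move=> bg ch x.
have A0 := bump_radius _ _ _ _ _ bg.
have cg := is_derive_continuous _ _ (bump_derive _ _ _ _ _ bg).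
have cg1 := is_derive_continuous _ _ (bump_derive1 _ _ _ _ _ bg).
pose a := x - A - 1; pose b := x + A + 1.
have g1s y : A < `|y| -> g1 y = 0 by move=> /(bump_support _ _ _ _ _ bg)[].
have lip k : `|k| <= 1 -> `|convolution h g1 (x + k) - convolution h g1 x| <=
    (D * \int[mu]_(z in `[a, b]) `|h z|) * `|k|.
  rewrite ler_norml => k1.
  rewrite !(@convolution_window A h _ _ a b)//; rewrite ?/a ?/b; try lra.
  rewrite -Rintegral_segmentB; [|exact: continuous_convolution_integrand..].
  rewrite mulrAC -Rintegral_segmentZ; last exact: continuous_norm.
  apply: norm_Rintegral_segment_le.
  - by apply: continuous_sub; exact: continuous_convolution_integrand.
  - by apply: continuous_mul; [move=> ?; exact: cvg_cst|exact: continuous_norm].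
  move=> z _; rewrite -mulrBr normrM mulrC ler_wpM2r// addrAC.
  have := derivative_bound_lipschitz _ _ _ (x - z + k) (x - z)
    (bump_derive1 _ _ _ _ _ bg) (bump2_le _ _ _ _ _ bg).
  by rewrite (addrAC (x - z)) subrr add0r.
set C := D * _ in lip.
have C0 : 0 <= C.
  by rewrite mulr_ge0// ?Rintegral_ge0// (le_trans (normr_ge0 _) (bump_le _ _ _ _ _ bg 0)).
apply/cvgrPdist_le => e e0; apply/nbhs_ballP.
exists (Num.min 1 (e / (C + 1))).
  by rewrite /= lt_min ltr01 divr_gt0// ltr_wpDl.
move=> y; rewrite /ball/= distrC lt_min => /andP[y1 ye].
have := lip (y - x) (ltW y1); rewrite (addrC x) subrK distrC => /le_trans; apply.
rewrite ltr_pdivlMr ?ltr_wpDl// in ye.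
have := normr_ge0 (y - x); nra.
Qed.

Lemma periodic_convolution h f (T : R) : periodic h T -> periodic (convolution h f) T.
Proof.
move=> ph x; rewrite /convolution; apply: eq_Rintegral => y _.
by rewrite addrAC ph.
Qed.

(** Sup norm on the kernel and L1 norm on [h]: for the density, the mass is the only bound uniform
    in [eps]. *)
Lemma convolution1_le A D g g1 g2 h C x : bump A D g g1 g2 ->
  continuous h -> (forall x, `|g1 x| <= C) ->
  `|convolution h g1 x| <= C * \int[mu]_(z in `[x - A, x + A]) `|h z|.
Proof.
move=> bg ch gC.
have A0 := bump_radius _ _ _ _ _ bg.
have cg := is_derive_continuous _ _ (bump_derive _ _ _ _ _ bg).
have cg1 := is_derive_continuous _ _ (bump_derive1 _ _ _ _ _ bg).
have g1s y : A < `|y| -> g1 y = 0 by move=> /(bump_support _ _ _ _ _ bg)[].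
rewrite (@convolution_window A h _ _ (x - A) (x + A))//.
rewrite -Rintegral_segmentZ; last exact: continuous_norm.
apply: norm_Rintegral_segment_le; first exact: continuous_convolution_integrand.
  by apply: continuous_mul; [move=> ?; exact: cvg_cst|exact: continuous_norm].
by move=> z _; rewrite normrM mulrC ler_wpM2r.
Qed.

Lemma convolution1_lipschitz A D g g1 g2 h h' C d x : bump A D g g1 g2 ->
  continuous h -> continuous h' ->
  (forall x, `|g1 x| <= C) -> (forall x, `|h x - h' x| <= d) ->
  `|convolution h g1 x - convolution h' g1 x| <= 2 * A * C * d.
Proof.
move=> bg ch ch' gC hh.
have A0 := bump_radius _ _ _ _ _ bg.
have cg := is_derive_continuous _ _ (bump_derive _ _ _ _ _ bg).
have cg1 := is_derive_continuous _ _ (bump_derive1 _ _ _ _ _ bg).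
have g1s y : A < `|y| -> g1 y = 0 by move=> /(bump_support _ _ _ _ _ bg)[].
have xA : x - A <= x + A by move: A0; lra.
rewrite (@convolution_window A h _ _ (x - A) (x + A))//.
rewrite (@convolution_window A h' _ _ (x - A) (x + A))//.
rewrite -Rintegral_segmentB; [|exact: continuous_convolution_integrand..].
have -> : 2 * A * C * d = \int[mu]_(z in `[x - A, x + A]) (C * d).
  by rewrite Rintegral_segment_cst//; ring.
apply: norm_Rintegral_segment_le.
- by apply: continuous_sub; exact: continuous_convolution_integrand.
- by move=> ?; exact: cvg_cst.
- by move=> z _; rewrite -mulrBl normrM mulrC ler_pM.
Qed.


(** The function and its two derivatives scale like [m^-1], [m^-2] and [m^-3]; their sum is a crude
    common bound. The precise factor [m^-2] stays visible in the first derivative, where the force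
    estimate needs it. *)
Lemma bump_mollifier A D p p1 p2 (m : R) : 0 < m -> bump A D p p1 p2 ->
  bump (m * A) (D * (m^-1 + m^-1 ^+ 2 + m^-1 ^+ 3)) (mollifier p m)
    (fun x => m^-1 ^+ 2 * p1 (x / m)) (fun x => m^-1 ^+ 3 * p2 (x / m)).
Proof.
move=> m0 bp.
have i0 : 0 < m^-1 by rewrite invr_gt0.
have dscale f f' x : (forall x, is_derive x 1 f (f' x)) ->
    is_derive x 1 (fun x => f (x / m)) (m^-1 * f' (x / m)).
  move=> df; have := @is_derive_comp_affine R f (f' (x / m)) m^-1 0 x.
  rewrite addr0 [m^-1 * x]mulrC => /(_ (df _)).
  by under eq_fun do rewrite addr0 mulrC.
have D0 : 0 <= D := le_trans (normr_ge0 _) (bump_le _ _ _ _ _ bp 0).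
have ie n : 0 <= m^-1 ^+ n by rewrite exprn_ge0// ltW.
split.
- by rewrite mulr_gt0// (bump_radius _ _ _ _ _ bp).
- move=> x; rewrite expr2 -mulrA.
  have h := is_deriveZ m^-1 (dscale _ _ x (bump_derive _ _ _ _ _ bp)).
  exact: h.
- move=> x; rewrite [X in is_derive _ _ _ X](_ : _ = m^-1 ^+ 2 * (m^-1 * p2 (x / m))); last by ring.
  have h := is_deriveZ (m^-1 ^+ 2) (dscale _ _ x (bump_derive1 _ _ _ _ _ bp)).
  exact: h.
- move=> x xm; have [|p0 p10] := bump_support _ _ _ _ _ bp (x / m).
    by rewrite normrM normfV (gtr0_norm m0) ltr_pdivlMr// mulrC.
  by rewrite /mollifier p0 p10 !mulr0.
- move=> x; rewrite /mollifier normrM gtr0_norm// mulrC.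
  apply: ler_pM => //; first exact: ltW; first exact: (bump_le _ _ _ _ _ bp).
  by rewrite -addrA lerDl addr_ge0.
- move=> x; rewrite normrM ger0_norm// mulrC.
  apply: ler_pM => //; first exact: (bump1_le _ _ _ _ _ bp).
  by rewrite addrAC lerDr addr_ge0// ltW.
- move=> x; rewrite normrM ger0_norm// mulrC.
  apply: ler_pM => //; first exact: (bump2_le _ _ _ _ _ bp).
  by rewrite lerDr addr_ge0// ltW.
Qed.

End Bumps.

(** * Stability of torus continuity and the transport operator *)

Section TorusContinuous.
Context {R : realType}.
Implicit Types (f g u w : R -> R) (c m x eps : R).

Lemma torus_continuous_cst c : torus_continuous (fun _ : R => c).
Proof. by split; [|move=> ?; exact: cvg_cst]. Qed.

Lemma torus_continuousD f g : torus_continuous f -> torus_continuous g ->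
  torus_continuous (fun x => f x + g x).
Proof.
by move=> [pf cf] [pg cg]; split; [move=> x; rewrite pf pg|exact: continuous_add].
Qed.

Lemma torus_continuousN f : torus_continuous f ->
  torus_continuous (fun x => - f x).
Proof.
by move=> [pf cf]; split; [move=> x; rewrite pf|exact: continuous_opp].
Qed.

Lemma torus_continuousM f g : torus_continuous f -> torus_continuous g ->
  torus_continuous (fun x => f x * g x).
Proof.
by move=> [pf cf] [pg cg]; split; [move=> x; rewrite pf pg|exact: continuous_mul].
Qed.

Lemma torus_continuousV f : (forall x, 0 < f x) -> torus_continuous f ->
  torus_continuous (fun x => (f x)^-1).
Proof.
move=> f0 [pf cf]; split; first by move=> x; rewrite pf.
by apply: continuous_inv => // x; rewrite gt_eqF.
Qed.

Lemma torus_continuous_norm f : torus_continuous f ->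
  torus_continuous (fun x => `|f x|).
Proof.
by move=> [pf cf]; split; [move=> x; rewrite pf|exact: continuous_norm].
Qed.

Lemma torus_continuous_max f g : torus_continuous f -> torus_continuous g ->
  torus_continuous (fun x => Num.max (f x) (g x)).
Proof.
by move=> [pf cf] [pg cg]; split; [move=> x; rewrite pf pg|exact: continuous_maxr].
Qed.

Lemma torus_continuous_min f g : torus_continuous f -> torus_continuous g ->
  torus_continuous (fun x => Num.min (f x) (g x)).
Proof.
by move=> [pf cf] [pg cg]; split; [move=> x; rewrite pf pg|exact: continuous_minr].
Qed.

Lemma torus_continuous_shift f c : torus_continuous f ->
  torus_continuous (fun x => f (x + c)).
Proof.
move=> [pf cf]; split; first by move=> x; rewrite addrAC pf.
have := continuous_comp_affine f 1 c cf.
by under eq_fun do rewrite mul1r.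
Qed.

Lemma torus_continuous_powR f c : (forall x, 0 < f x) -> torus_continuous f ->
  torus_continuous (fun x => f x `^ c).
Proof.
move=> f0 [pf cf]; split; first by move=> x; rewrite pf.
exact: continuous_powR.
Qed.

Lemma torus_continuous_velocity f g : (forall x, 0 < f x) ->
  torus_continuous f -> torus_continuous g -> torus_continuous (velocity f g).
Proof.
by move=> f0 cf cg; apply: torus_continuousM => //; exact: torus_continuousV.
Qed.

Lemma torus_continuous_pos u : torus_continuous u -> torus_continuous u^\+.
Proof. by move=> cu; apply: torus_continuous_max => //; exact: torus_continuous_cst. Qed.

Lemma torus_continuous_neg u : torus_continuous u -> torus_continuous u^\-.
Proof.
move=> cu; apply: torus_continuous_max; last exact: torus_continuous_cst.
exact: torus_continuousN.
Qed.

Lemma torus_continuous_transport eps u w :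
  torus_continuous u -> torus_continuous w -> torus_continuous (transport eps u w).
Proof.
move=> cu cw; apply: torus_continuousM; first exact: torus_continuous_cst.
have cwp := torus_continuousM _ _ cw (torus_continuous_pos _ cu).
have cwn := torus_continuousM _ _ cw (torus_continuous_neg _ cu).
apply: torus_continuousD; last exact: (torus_continuous_shift _ eps cwn).
apply: torus_continuousD; first exact: (torus_continuous_shift _ (- eps) cwp).
by apply/torus_continuousN/torus_continuousM => //; exact: torus_continuous_norm.
Qed.

Lemma normr_funrpos_funrneg u x : `|u x| = u^\+ x + u^\- x.
Proof. by have /(congr1 (fun h => h x)) := funrposDneg u. Qed.

(** What leaves [x] arrives at [x + eps] or [x - eps]: after a shift, which preserves integrals over
    a period, the inflow terms cancel [w * |u|], since [|u|] is the sum of the positive and negative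
    parts. *)
Lemma Rintegral_transport eps u w :
  torus_continuous u -> torus_continuous w ->
  \int[lebesgue_measure]_(x in `[0, pi *+ 2]) transport eps u w x = 0.
Proof.
move=> cu cw.
have [pwp cwp] := torus_continuousM _ _ cw (torus_continuous_pos _ cu).
have [pwn cwn] := torus_continuousM _ _ cw (torus_continuous_neg _ cu).
have [_ cwps] := torus_continuous_shift _ (- eps) (conj pwp cwp).
have [_ cwns] := torus_continuous_shift _ eps (conj pwn cwn).
have T0 := ltW (@pi2_gt0 R).
rewrite Rintegral_segmentZ; last first.
  apply: continuous_add => //; apply: continuous_sub => //.
  exact: (torus_continuousM _ _ cw (torus_continuous_norm _ cu)).2.
rewrite (_ : Rintegral _ _ _ = 0) ?mulr0//.
under eq_Rintegral do rewrite normr_funrpos_funrneg mulrDr.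
rewrite Rintegral_segmentD//; last first.
  by apply: continuous_sub => //; exact: continuous_add.
rewrite Rintegral_segmentB//; last exact: continuous_add.
rewrite Rintegral_segmentD//.
rewrite (Rintegral_periodic_shift _ _ (- eps) T0 cwp pwp).
rewrite (Rintegral_periodic_shift _ _ eps T0 cwn pwn).
by rewrite opprD addrA subrr add0r addNr.
Qed.

End TorusContinuous.

Section PowerFunction.
Context {R : realType}.
Implicit Types (x y a m : R).

(** Here [gamma <= 2] enters, as [a = gamma - 1 <= 1]: the integral of r^(gamma - 1) over a window
    is controlled by the mass. *)
Lemma powR_le_1D x a : 0 < x -> 0 < a <= 1 -> x `^ a <= 1 + x.
Proof.
move=> x0 /andP[a0 a1]; have [x1|x1] := leP x 1.
  apply: (@le_trans _ _ (x `^ 0)); last by rewrite powRr0 lerDl ltW.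
  by apply: ger_powR; [rewrite x0 x1|exact: ltW].
by apply: le_trans (ler1_powR (ltW x1) a1) _; rewrite lerDr.
Qed.

(** At the intermediate point the derivative is at most c^a / c, hence at most
    [(1 + c) / c <= 1 + m^-1]. For [a < 1] it blows up at the vacuum, whence the lower bound [m]. *)
Lemma powR_lipschitz x y a m : 0 < m -> 0 < a <= 1 -> m <= x -> m <= y ->
  `|x `^ a - y `^ a| <= (1 + m^-1) * `|x - y|.
Proof.
move=> m0 a01; have /andP[a0 a1] := a01.
wlog xy : x y / x <= y.
  move=> h; have [xy|yx] := leP x y; first exact: h.
  by move=> mx my; rewrite distrC (distrC x); apply: h => //; exact: ltW.
move=> mx my.
have D z : m <= z -> is_derive z 1 (fun z => z `^ a) (a * z `^ (a - 1)).
  by move=> mz; apply: is_derive1_powR; exact: lt_le_trans mz.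
have [c + e] : exists2 c, c \in `[x, y] &
    y `^ a - x `^ a = a * c `^ (a - 1) * (y - x).
  apply: (MVT_segment (f := fun z => z `^ a) (df := fun c => a * c `^ (a - 1))) => //.
    move=> z; rewrite in_itv/= => /andP[xz _]; apply: D.
    by apply: le_trans mx _; exact: ltW.
  apply: derivable_within_continuous => z; rewrite in_itv/= => /andP[xz _].
  by have [] := D z (le_trans mx xz).
rewrite in_itv/= => /andP[xc cy].
have c0 : 0 < c by apply: lt_le_trans m0 _; exact: le_trans xc.
rewrite distrC e normrM (distrC x) ler_wpM2r//.
rewrite ger0_norm ?mulr_ge0 ?powR_ge0 ?(ltW a0)//.
apply: (@le_trans _ _ (c `^ (a - 1))); first by rewrite ler_piMl ?powR_ge0.
rewrite -(ler_pM2l c0) mulr_powRB1 ?(ltW c0)//.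
apply: le_trans (powR_le_1D _ _ c0 a01) _.
rewrite mulrDr mulr1 addrC lerD2l -ler_pdivrMl//.
by rewrite mulr1 lef_pV2 ?posrE//; apply: le_trans xc.
Qed.

End PowerFunction.

(** * The pressure force *)

Section Force.
Context {R : realType}.
Local Notation mu := (@lebesgue_measure R).
Implicit Types (K gamma alpha eps A D x : R) (phi r : R -> R).

Lemma is_derive_potential K gamma alpha eps A D phi phi1 phi2 r x :
  bump A D phi phi1 phi2 -> 0 < eps -> torus_continuous r -> (forall x, 0 < r x) ->
  is_derive x 1 (potential K gamma alpha phi eps r)
    (K * gamma / (gamma - 1) * convolution (fun y => r y `^ (gamma - 1))
      (fun x => (eps `^ alpha)^-1 ^+ 2 * phi1 (x / eps `^ alpha)) x).
Proof.
move=> bphi eps0 cr r0.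
have bm := bump_mollifier _ _ _ _ _ _ (powR_gt0 alpha eps0) bphi.
have [_ ch] := torus_continuous_powR _ (gamma - 1) r0 cr.
have h := is_deriveZ (K * gamma / (gamma - 1))
  (is_derive_convolution _ _ _ _ _ _ x bm ch).
exact: h.
Qed.

Lemma derive1_potential K gamma alpha eps A D phi phi1 phi2 r :
  bump A D phi phi1 phi2 -> 0 < eps -> torus_continuous r -> (forall x, 0 < r x) ->
  derive1 (potential K gamma alpha phi eps r) = fun x =>
    K * gamma / (gamma - 1) * convolution (fun y => r y `^ (gamma - 1))
      (fun x => (eps `^ alpha)^-1 ^+ 2 * phi1 (x / eps `^ alpha)) x.
Proof.
move=> bphi eps0 cr r0; apply/funext => x; rewrite derive1E.
by have [] := is_derive_potential K gamma alpha _ _ _ _ _ _ _ x bphi eps0 cr r0.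
Qed.

Lemma torus_continuous_force K gamma alpha eps A D phi phi1 phi2 r :
  bump A D phi phi1 phi2 -> 0 < eps -> torus_continuous r -> (forall x, 0 < r x) ->
  torus_continuous (derive1 (potential K gamma alpha phi eps r)).
Proof.
move=> bphi eps0 cr r0; rewrite (derive1_potential _ _ _ _ _ _ _ _ _ _ bphi eps0 cr r0).
have bm := bump_mollifier _ _ _ _ _ _ (powR_gt0 alpha eps0) bphi.
have [ph ch] := torus_continuous_powR _ (gamma - 1) r0 cr.
apply: torus_continuousM; first exact: torus_continuous_cst.
split; first exact: periodic_convolution.
exact: continuous_convolution1 bm ch.
Qed.

(** The shrinking support of the kernel brings no gain for the density part: the mass may
    concentrate in a window of width eps^alpha, so all of it is counted, [N] times if the window
    exceeds one period. *)
Lemma force_le K gamma alpha eps A D phi phi1 phi2 r x (N : nat) :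
  0 <= K -> 1 < gamma <= 2 ->
  bump A D phi phi1 phi2 -> 0 < eps -> torus_continuous r -> (forall x, 0 < r x) ->
  2 * (eps `^ alpha * A) <= (pi *+ 2) *+ N ->
  `|derive1 (potential K gamma alpha phi eps r) x| <=
  K * gamma / (gamma - 1) * ((eps `^ alpha)^-1 ^+ 2 * D *
    (2 * (eps `^ alpha * A) + (\int[mu]_(x in `[0, pi *+ 2]) r x) *+ N)).
Proof.
move=> K0 /andP[gamma1 gamma2] bphi eps0 cr r0 hN.
rewrite (derive1_potential _ _ _ _ _ _ _ _ _ _ bphi eps0 cr r0).
have m0 := powR_gt0 alpha eps0.
have bm := bump_mollifier _ _ _ _ _ _ m0 bphi.
have A0 := bump_radius _ _ _ _ _ bphi.
have D0 : 0 <= D := le_trans (normr_ge0 _) (bump_le _ _ _ _ _ bphi 0).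
have [ph ch] := torus_continuous_powR _ (gamma - 1) r0 cr.
have [pr cr'] := cr.
have c0 : 0 <= K * gamma / (gamma - 1).
  by rewrite divr_ge0 ?mulr_ge0//; lra.
rewrite normrM ger0_norm// ler_wpM2l//.
apply: le_trans (convolution1_le _ _ _ _ _ _ ((eps `^ alpha)^-1 ^+ 2 * D) x bm ch _) _.
  move=> y; rewrite normrM ger0_norm ?exprn_ge0 ?invr_ge0 ?powR_ge0//.
  rewrite ler_wpM2l ?exprn_ge0 ?invr_ge0 ?powR_ge0//.
  exact: (bump1_le _ _ _ _ _ bphi).
rewrite ler_wpM2l//.
  by rewrite mulr_ge0// exprn_ge0// invr_ge0 powR_ge0.
set B := eps `^ alpha * A.
have B0 : 0 < B by rewrite mulr_gt0.
apply: le_trans (_ : \int[mu]_(z in `[x - B, x + B]) (1 + r z) <= _).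
  apply: le_Rintegral_segment.
  - exact: continuous_norm.
  - by apply: continuous_add => // ?; exact: cvg_cst.
  - move=> z _; rewrite ger0_norm ?powR_ge0//; apply: powR_le_1D => //; lra.
rewrite Rintegral_segmentD//; last by move=> ?; exact: cvg_cst.
apply: lerD.
  by rewrite Rintegral_segment_cst; lra.
apply: le_Rintegral_periodic => //; [exact: ltW (pi2_gt0)|by move=> ?; exact: ltW|lra|].
by move: hN; rewrite -/B; lra.
Qed.

(** This serves well-posedness at fixed [eps], so a constant depending on [eps] and [m] is
    harmless. *)
Lemma force_lipschitz K gamma alpha eps A D phi phi1 phi2 r r' (m d : R) x :
  0 <= K -> 1 < gamma <= 2 ->
  bump A D phi phi1 phi2 -> 0 < eps -> torus_continuous r -> torus_continuous r' ->
  0 < m -> (forall x, m <= r x) -> (forall x, m <= r' x) ->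
  (forall x, `|r x - r' x| <= d) ->
  `|derive1 (potential K gamma alpha phi eps r) x -
    derive1 (potential K gamma alpha phi eps r') x| <=
  K * gamma / (gamma - 1) * (2 * (eps `^ alpha * A) *
    ((eps `^ alpha)^-1 ^+ 2 * D) * (1 + m^-1)) * d.
Proof.
move=> K0 /andP[gamma1 gamma2] bphi eps0 cr cr' m0 mr mr' rd.
have g01 : 0 < gamma - 1 <= 1 by lra.
have r0 y : 0 < r y by exact: lt_le_trans (mr y).
have r'0 y : 0 < r' y by exact: lt_le_trans (mr' y).
rewrite [in X in _ - X](derive1_potential _ _ _ _ _ _ _ _ _ _ bphi eps0 cr' r'0).
rewrite [in X in X - _](derive1_potential _ _ _ _ _ _ _ _ _ _ bphi eps0 cr r0).
have bm := bump_mollifier _ _ _ _ _ _ (powR_gt0 alpha eps0) bphi.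
have [_ ch] := torus_continuous_powR _ (gamma - 1) r0 cr.
have [_ ch'] := torus_continuous_powR _ (gamma - 1) r'0 cr'.
have c0 : 0 <= K * gamma / (gamma - 1).
  by rewrite divr_ge0 ?mulr_ge0//; lra.
rewrite -mulrBr normrM ger0_norm//.
set C := _ ^+ 2 * D.
have -> : K * gamma / (gamma - 1) * (2 * (eps `^ alpha * A) * C * (1 + m^-1)) * d =
  K * gamma / (gamma - 1) * (2 * (eps `^ alpha * A) * C * ((1 + m^-1) * d)).
  by rewrite !mulrA.
apply: ler_wpM2l => //.
apply: (convolution1_lipschitz _ _ _ _ _ _ _ _ _ x bm ch ch').
  move=> y; rewrite normrM ger0_norm ?exprn_ge0 ?invr_ge0 ?powR_ge0//.
  rewrite ler_wpM2l ?exprn_ge0 ?invr_ge0 ?powR_ge0//.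
  exact: (bump1_le _ _ _ _ _ bphi).
move=> y; apply: le_trans (powR_lipschitz _ _ _ _ m0 g01 (mr y) (mr' y)) _.
by rewrite ler_wpM2l// addr_ge0// invr_ge0 ltW.
Qed.

End Force.

(** * A priori estimates *)

Section CurveAlgebra.
Context {R : realType}.
Implicit Types (D : set R) (f g : R -> R -> R) (c e : R).

Lemma uniform_curve_add D f g : uniform_curve D f -> uniform_curve D g ->
  uniform_curve D (fun t x => f t x + g t x).
Proof.
move=> uf ug t Dt e e0; have e20 : 0 < e / 2 by rewrite divr_gt0.
have [d d0 hd] := uf t Dt _ e20; have [d' d'0 hd'] := ug t Dt _ e20.
exists (Num.min d d'); first by rewrite lt_min d0.
move=> s Ds; rewrite lt_min => /andP[sd sd'] x.
have -> : f s x + g s x - (f t x + g t x) =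
  (f s x - f t x) + (g s x - g t x) by ring.
apply: le_trans (ler_normD _ _) _; rewrite [e]splitr.
by apply: lerD; [exact: hd|exact: hd'].
Qed.

Lemma uniform_curve_mul D f g :
  (forall t, D t -> exists C, forall x, `|f t x| <= C) ->
  (forall t, D t -> exists C, forall x, `|g t x| <= C) ->
  uniform_curve D f -> uniform_curve D g ->
  uniform_curve D (fun t x => f t x * g t x).
Proof.
move=> bf bg uf ug t Dt e e0.
have [C hC] := bf t Dt; have [C' hC'] := bg t Dt.
have C0 : 0 <= C := le_trans (normr_ge0 _) (hC 0).
have C'0 : 0 <= C' := le_trans (normr_ge0 _) (hC' 0).
(* The bound [k <= 1] makes the product of the two increments at most [k], so it is absorbed in the
   summand 1 of [1 + C + C']. *)
pose k := Num.min 1 (e / (1 + C + C')).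
have k0 : 0 < k.
  by rewrite /k lt_min ltr01 divr_gt0// -addrA ltr_wpDr// addr_ge0.
have k1 : k <= 1 by rewrite /k ge_min lexx.
have ke : k * (1 + C + C') <= e.
  by rewrite -ler_pdivlMr ?/k ?ge_min ?lexx ?orbT// -addrA ltr_wpDr// addr_ge0.
have [d d0 hd] := uf t Dt _ k0; have [d' d'0 hd'] := ug t Dt _ k0.
exists (Num.min d d'); first by rewrite lt_min d0.
move=> s Ds; rewrite lt_min => /andP[sd sd'] x.
have -> : f s x * g s x - f t x * g t x =
  (f s x - f t x) * (g s x - g t x) +
  (f t x * (g s x - g t x) + (f s x - f t x) * g t x) by ring.
apply: le_trans ke.
have -> : k * (1 + C + C') = k * 1 + (C * k + k * C') by ring.
apply: le_trans (ler_normD _ _) (lerD _ _).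
  by rewrite normrM ler_pM//; [exact: hd|exact: le_trans (hd' _ Ds sd' x) k1].
apply: le_trans (ler_normD _ _) (lerD _ _).
  by rewrite normrM ler_pM//; exact: hd'.
by rewrite normrM ler_pM//; exact: hd.
Qed.

Lemma uniform_curve_inv D g :
  (forall t, D t -> exists2 m, 0 < m & forall x, m <= g t x) ->
  uniform_curve D g -> uniform_curve D (fun t x => (g t x)^-1).
Proof.
move=> bg ug t Dt e e0; have [m m0 hm] := bg t Dt.
(* The first term keeps [g s x] above [m / 2]; the second is [e] times the resulting lower bound of
   the denominator [g s x * g t x]. *)
pose k := Num.min (m / 2) (e * (m / 2 * m)).
have m20 : 0 < m / 2 by rewrite divr_gt0.
have k0 : 0 < k by rewrite /k lt_min m20/= !mulr_gt0.
have [d d0 hd] := ug t Dt _ k0.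
exists d => // s Ds sd x; have h := hd s Ds sd x.
have k1 : k <= m / 2 by rewrite /k ge_min lexx.
have k2 : k <= e * (m / 2 * m) by rewrite /k ge_min lexx orbT.
have gt : m <= g t x := hm x.
have gs : m / 2 <= g s x by move: h; rewrite ler_norml; lra.
have gt0 : 0 < g t x by exact: lt_le_trans gt.
have gs0 : 0 < g s x by exact: lt_le_trans gs.
have -> : (g s x)^-1 - (g t x)^-1 = - (g s x - g t x) / (g s x * g t x).
  by field; rewrite !gt_eqF.
rewrite normrM normrN normfV (gtr0_norm (mulr_gt0 gs0 gt0)).
rewrite ler_pdivrMr ?mulr_gt0//.
apply: le_trans h _; apply: le_trans k2 _.
by rewrite ler_pM2l// ler_pM// ltW.
Qed.

Lemma uniform_curve_time D (h : R -> R) : continuous h ->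
  uniform_curve D (fun t _ => h t).
Proof.
move=> ch t _ e e0; have /cvgrPdist_le/(_ e e0)/nbhs_ballP[d /= d0 hd] := ch t.
by exists d => // s _ std _; rewrite distrC; apply: hd; rewrite /ball/= distrC.
Qed.

(** This supplies the hypothesis of the maximum principle: a negative time derivative gives a larger
    value at an earlier time. Looking only backwards covers the final time too. *)
Lemma is_derive_lt0_left (f : R -> R) (t d : R) : is_derive t 1 f d -> d < 0 -> 0 < t ->
  exists2 s, 0 <= s <= t & f t < f s.
Proof.
move=> [df fd] d0 t0.
have lim : h^-1 *: ((f \o shift t) (h *: (1 : R)) - f t) @[h --> 0^'] --> d.
  by rewrite -fd; exact: df.
have : \forall h \near 0^', h^-1 *: ((f \o shift t) (h *: (1 : R)) - f t) < 0.
  by apply: (cvgr_lt d).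
move=> [k /= k0 hk]; pose h := Num.min (k / 2) t.
have h0 : 0 < h by rewrite lt_min divr_gt0.
have hk2 : h <= k / 2 by rewrite ge_min lexx.
have ht : h <= t by rewrite ge_min lexx orbT.
exists (t - h); first lra.
have := hk (- h); rewrite /ball/= sub0r opprK (gtr0_norm h0) oppr_eq0 gt_eqF//.
move=> /(_ ltac:(lra) isT); rewrite /GRing.scale/= mulr1 invrN mulNr oppr_lt0.
by rewrite pmulr_rgt0 ?invr_gt0// subr_gt0 addrC.
Qed.

End CurveAlgebra.

Section APriori.
Context {R : realType}.
Local Notation mu := (@lebesgue_measure R).
Implicit Types (K gamma alpha eps x t C U : R) (phi : R -> R)
  (T : \bar R) (r q : R -> R -> R).

Lemma nbhs_time_interval T t : 0 < t -> (t%:E < T)%E -> nbhs t (time_interval T).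
Proof.
move=> t0; case: T => [T| |]//; rewrite ?lte_fin => tT.
  have : \forall s \near t, 0 < s by exact: lt_nbhsr.
  apply: filterS2 (_ : \forall s \near t, s < T); last exact: lt_nbhsl.
  by move=> s sT s0; split; [exact: ltW|rewrite lte_fin].
have : \forall s \near t, 0 < s by exact: lt_nbhsr.
by apply: filterS => s s0; split; [exact: ltW|rewrite ltry].
Qed.

Lemma subset_time_interval T t : (t%:E < T)%E -> `[0, t] `<=` time_interval T.
Proof.
move=> tT s /=; rewrite in_itv/= => /andP[s0 st]; split => //.
by apply: le_lt_trans tT; rewrite lee_fin.
Qed.

Lemma time_interval_le T s t : time_interval T t -> 0 <= s <= t -> time_interval T s.
Proof.
move=> [t0 tT] st; apply: (subset_time_interval _ _ tT).
by rewrite /= in_itv.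
Qed.

Lemma ode_solution_curves {K gamma alpha phi eps} {r0 u0 : R -> R} {T r q} :
  ode_solution K gamma alpha phi eps r0 u0 T r q ->
  [/\ forall t, time_interval T t -> torus_continuous (r t),
      forall t, time_interval T t -> torus_continuous (q t),
      uniform_curve (time_interval T) r & uniform_curve (time_interval T) q].
Proof.
move=> [/C1_torus_curveP[cr cr' dr _] /C1_torus_curveP[cq cq' dq _] _ _ _].
split=> //; first exact: uniform_diff_curve_continuous dr cr'.
exact: uniform_diff_curve_continuous dq cq'.
Qed.

(** The derivative in the sup norm passes under the integral over a period, and the transport term
    has integral 0. *)
Lemma ode_solution_mass K gamma alpha phi eps (r0 u0 : R -> R) T r q t :
  ode_solution K gamma alpha phi eps r0 u0 T r q -> time_interval T t ->
  \int[mu]_(x in `[0, pi *+ 2]) r t x = \int[mu]_(x in `[0, pi *+ 2]) r0 x.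
Proof.
move=> sol Tt; have [t0 tT] := Tt.
have [cr cq ur uq] := ode_solution_curves sol.
have [/C1_torus_curveP[_ cr' dr _] _ r_gt0 <- _] := sol.
(* The mass is seen as a curve of constant functions on the torus, so that the calculus of curves
   applies to it. *)
pose M (s : R) (_ : R) := \int[mu]_(x in `[0, pi *+ 2]) r s x.
have P0 := @pi2_gt0 R.
have dM : uniform_diff_curve (time_interval T) M (fun _ _ => 0).
  move=> s Ts e e0.
  have [d d0 hd] := dr s Ts (e / (pi *+ 2)) ltac:(by rewrite divr_gt0).
  exists d => // s' Ts' s'd y; rewrite mulr0 subr0 /M.
  have [_ c1] := cr s' Ts'; have [_ c2] := cr s Ts; have [_ c3] := cr' s Ts.
  have I0 : \int[mu]_(x in `[0, pi *+ 2])
      ((s' - s) * density_rhs eps (r s) (q s) x) = 0.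
    rewrite Rintegral_segmentZ// Rintegral_transport ?mulr0//.
      by apply: torus_continuous_velocity; [exact: r_gt0|exact: cr|exact: cq].
    exact: cr.
  rewrite -[X in `|X|]subr0 -[X in _ - _ - X]I0 -Rintegral_segmentB//.
  have c4 : continuous (fun x => (s' - s) * density_rhs eps (r s) (q s) x).
    by apply: continuous_mul => // ?; exact: cvg_cst.
  rewrite -Rintegral_segmentB//; last exact: continuous_sub.
  have -> : e * `|s' - s| =
      \int[mu]_(x in `[0, pi *+ 2]) (e / (pi *+ 2) * `|s' - s|).
    rewrite Rintegral_segment_cst ?(ltW P0)// subr0 [RHS]mulrAC divfK //.
    by rewrite gt_eqF.
  apply: norm_Rintegral_segment_le.
  - by apply: continuous_sub => //; exact: continuous_sub.
  - by move=> ?; exact: cvg_cst.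
  - by move=> x _; exact: hd.
have uM : uniform_curve (time_interval T) M.
  by apply: uniform_diff_curve_continuous dM _ => s _; exact: torus_continuous_cst.
have : `|M t 0 - M 0 0| <= 0.
  apply: (derivative_comparison (fun s => M s 0 - M 0 0) (fun _ => 0)
     (fun _ => 0) (fun _ => 0) t t0).
  - have := uniform_curve_continuous _ _ 0 t uM (subset_time_interval _ _ tT).
    by move=> cM s; apply: cvgB; [exact: cM|exact: cvg_cst].
  - move=> s /andP[s0 st]; rewrite -[X in is_derive _ _ _ X]subr0.
    have sT : nbhs s (time_interval T).
      by apply: nbhs_time_interval => //; apply: lt_trans tT; rewrite lte_fin.
    have h := is_deriveB (uniform_diff_curve_is_derive _ _ _ s 0 dM sT)
      (is_derive_cst (M 0 0) s (1 : R)).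
    exact: h.
  - by move=> s _; rewrite normr0.
  - by rewrite subrr normr0.
by rewrite normr_le0 subr_eq0 => /eqP.
Qed.

Lemma ode_solution_is_derive K gamma alpha phi eps (r0 u0 : R -> R) T r q t x :
  ode_solution K gamma alpha phi eps r0 u0 T r q -> 0 < t -> (t%:E < T)%E ->
  is_derive t 1 (r ^~ x) (density_rhs eps (r t) (q t) x) /\
  is_derive t 1 (q ^~ x) (momentum_rhs K gamma alpha phi eps (r t) (q t) x).
Proof.
move=> [/C1_torus_curveP[_ _ dr _] /C1_torus_curveP[_ _ dq _] _ _ _] t0 tT.
have nT := nbhs_time_interval _ _ t0 tT.
split.
  exact: (uniform_diff_curve_is_derive _ _
    (fun t => density_rhs eps (r t) (q t)) t x dr nT).
exact: (uniform_diff_curve_is_derive _ _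
  (fun t => momentum_rhs K gamma alpha phi eps (r t) (q t)) t x dq nT).
Qed.

Lemma ode_solution_bounded_curves K gamma alpha phi eps (r0 u0 : R -> R) T r q :
  ode_solution K gamma alpha phi eps r0 u0 T r q ->
  [/\ forall t, time_interval T t -> exists C, forall x, `|r t x| <= C,
      forall t, time_interval T t -> exists C, forall x, `|q t x| <= C &
      forall t, time_interval T t -> exists2 m, 0 < m & forall x, m <= r t x].
Proof.
move=> sol; have [cr cq _ _] := ode_solution_curves sol.
have [_ _ r_gt0 _ _] := sol.
split=> t Tt.
- by have [C _ hC] := torus_bounded _ (cr t Tt); exists C.
- by have [C _ hC] := torus_bounded _ (cq t Tt); exists C.
- by apply: torus_lower_bound; [exact: cr|exact: r_gt0].
Qed.

Lemma uniform_curve_velocity K gamma alpha phi eps (r0 u0 : R -> R) T r q :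
  ode_solution K gamma alpha phi eps r0 u0 T r q ->
  uniform_curve (time_interval T) (fun t => velocity (r t) (q t)).
Proof.
move=> sol; have [cr cq ur uq] := ode_solution_curves sol.
have [br bq mr] := ode_solution_bounded_curves _ _ _ _ _ _ _ _ _ _ sol.
have [_ _ r_gt0 _ _] := sol.
apply: uniform_curve_mul => //; last exact: uniform_curve_inv.
move=> t Tt; have [m m0 hm] := mr t Tt; exists m^-1 => x.
rewrite ger0_norm ?invr_ge0 ?(ltW (r_gt0 t Tt x))//.
by rewrite lef_pV2 ?posrE//; exact: r_gt0.
Qed.

Lemma ler_addgt0_mul (a b t : R) : 0 <= t ->
  (forall d, 0 < d -> a <= b + d * t) -> a <= b.
Proof.
move=> t0 h; apply/ler_addgt0Pr => e e0.
apply: le_trans (h (e / (t + 1)) _) _; first by rewrite divr_gt0// ltr_wpDl.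
rewrite lerD2l mulrAC ler_pdivrMr ?ltr_wpDl// ler_pM2l//.
by rewrite lerDl.
Qed.

(* At a spatial maximum of u (or of -u) the transport part of du/dt, a sum of
   terms [a (u(x -+ eps) - u(x))] with [a >= 0], is nonpositive. *)
Lemma velocity_bound K gamma alpha phi eps (r0 u0 : R -> R) T r q C U :
  0 < eps -> ode_solution K gamma alpha phi eps r0 u0 T r q ->
  (forall x, `|u0 x| <= U) ->
  (forall t x, time_interval T t ->
    `|derive1 (potential K gamma alpha phi eps (r t)) x| <= C) ->
  forall t x, time_interval T t -> `|velocity (r t) (q t) x| <= U + C * t.
Proof.
move=> eps0 sol u0U FC t x Tt; have [t0 tT] := Tt.
have [cr cq ur uq] := ode_solution_curves sol.
have [_ _ r_gt0 r0E u0E] := sol.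
have uv := uniform_curve_velocity _ _ _ _ _ _ _ _ _ _ sol.
have tcv s : time_interval T s -> torus_continuous (velocity (r s) (q s)).
  by move=> Ts; apply: torus_continuous_velocity; [exact: r_gt0|exact: cr|exact: cq].
(* The sign [sg] handles the upper and the lower bound at once. *)
suff main sg : `|sg| = 1 -> sg * velocity (r t) (q t) x <= U + C * t.
  rewrite ler_norml; apply/andP; split; last first.
    by rewrite -[leLHS]mul1r; apply: main; rewrite normr1.
  by rewrite lerNl -mulN1r; apply: main; rewrite normrN1.
move=> sg1; apply: (ler_addgt0_mul _ _ _ t0) => d d0.
(* The slack [d] makes the time derivative at a spatial maximum strictly negative, as the maximum
   principle requires; it tends to 0 afterwards. *)
pose z s x := sg * velocity (r s) (q s) x + - (C + d) * s.
suff : z t x <= U by rewrite /z; lra.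
apply: (@torus_maximum_principle _ z t U t0) => //; last by rewrite t0 lexx.
- apply: (uniform_curve_subset (time_interval T)); first exact: subset_time_interval.
  apply: uniform_curve_add; last first.
    apply: (uniform_curve_time _ (fun s => - (C + d) * s)).
    by apply: continuous_mul => ?; [exact: cvg_cst|exact: cvg_id].
  apply: uniform_curve_mul.
  + by move=> s _; exists 1 => _; rewrite sg1.
  + by move=> s Ts; have [M _ hM] := torus_bounded _ (tcv s Ts); exists M.
  + by apply: (uniform_curve_time _ (fun => sg)) => ?; exact: cvg_cst.
  + exact: uv.
- move=> s st; have Ts := time_interval_le _ _ _ Tt st.
  apply: torus_continuousD; last exact: torus_continuous_cst.
  by apply: torus_continuousM; [exact: torus_continuous_cst|exact: tcv].
- move=> s y /andP[s0 st] zmax.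
  have Ts : time_interval T s.
    by apply: (time_interval_le _ _ _ Tt); rewrite st ltW.
  have [_ sT] := Ts.
  have [dr dq] := ode_solution_is_derive _ _ _ _ _ _ _ _ _ _ s y sol s0 sT.
  have ry0 := r_gt0 s Ts y.
  have ry1 : r s y != 0 by rewrite gt_eqF.
  have dz : is_derive s 1 (z ^~ y)
      (sg * (q s y * (- (r s y) ^- 2 * density_rhs eps (r s) (q s) y) +
        (r s y)^-1 * momentum_rhs K gamma alpha phi eps (r s) (q s) y) +
       - (C + d) * 1).
    have h1 := is_deriveZ sg (is_deriveM dq (is_deriveV ry1 dr)).
    have h2 := is_deriveZ (- (C + d)) (is_derive_id s (1 : R)).
    have h := is_deriveD h1 h2.
    exact: h.
  have [||s' hs' zs'] := is_derive_lt0_left _ _ _ dz; [|exact: s0|]; last first.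
    exists s' => //; case/andP: hs' => -> /= ss; exact: le_trans st.
  rewrite /density_rhs /momentum_rhs /transport mulr1.
  set F := derive1 _ y; set u := velocity (r s) (q s).
  have Fc : - (sg * F) <= C.
    apply: le_trans (FC s y Ts); rewrite -[leRHS]mul1r -sg1 -normrM -normrN.
    exact: ler_norm.
  have qE w : q s w = u w * r s w.
    by rewrite /u /velocity divfK// gt_eqF// r_gt0.
  have mx w : sg * u w <= sg * u y by have := zmax w; rewrite /z lerD2r.
  rewrite !qE.
  set a := u^\+ (y - eps); set b := u^\- (y + eps).
  have a0 : 0 <= r s (y - eps) * a by rewrite mulr_ge0 ?funrpos_ge0// ltW// r_gt0.
  have b0 : 0 <= r s (y + eps) * b by rewrite mulr_ge0 ?funrneg_ge0// ltW// r_gt0.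
  have ie : 0 < eps^-1 / r s y by rewrite divr_gt0 ?invr_gt0.
  (* In du/dt = (dq/dt - u dr/dt) / r the outflow terms with [|u y|] cancel, because [q = u * r];
     only differences of [u] with nonnegative weights remain, and the force. *)
  have -> : sg * (u y * r s y * (- (r s y) ^- 2 * (eps^-1 *
      (r s (y - eps) * a - r s y * `|u y| + r s (y + eps) * b))) +
      (r s y)^-1 * (eps^-1 * (u (y - eps) * r s (y - eps) * a -
         u y * r s y * `|u y| + u (y + eps) * r s (y + eps) * b) - r s y * F)) +
      - (C + d) =
    (eps^-1 / r s y) * ((r s (y - eps) * a) * (sg * u (y - eps) - sg * u y) +
      (r s (y + eps) * b) * (sg * u (y + eps) - sg * u y)) - sg * F - C - d.
    by field; rewrite ry1 gt_eqF.
  have k1 : r s (y - eps) * a * (sg * u (y - eps) - sg * u y) <= 0.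
    by rewrite mulr_ge0_le0// subr_le0.
  have k2 : r s (y + eps) * b * (sg * u (y + eps) - sg * u y) <= 0.
    by rewrite mulr_ge0_le0// subr_le0.
  have k3 : (eps^-1 / r s y) *
     (r s (y - eps) * a * (sg * u (y - eps) - sg * u y) +
      r s (y + eps) * b * (sg * u (y + eps) - sg * u y)) <= 0.
    by apply: mulr_ge0_le0; [exact: ltW|lra].
  move: k3 Fc; set X := _ * (_ + _); lra.
- move=> y; rewrite /z mulr0 addr0 u0E.
  apply: le_trans (ler_norm _) _; rewrite normrM sg1 mul1r; exact: u0U.
Qed.

(** At a spatial maximum of [r] the two inflows are at most [2 * U / eps] times [r]; at a spatial
    minimum the outflow is at most [U / eps] times [r] and the inflows are dropped. One exponent
    serves both sides, and its summand 1 makes the inequalities strict for the maximum principle. *)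
Lemma density_exponential_bounds K gamma alpha phi eps (r0 u0 : R -> R) T r q U m B :
  0 < eps -> ode_solution K gamma alpha phi eps r0 u0 T r q ->
  (forall t x, time_interval T t -> `|velocity (r t) (q t) x| <= U) ->
  (forall x, m <= r0 x <= B) ->
  forall t x, time_interval T t ->
    m * expR (- (2 * U / eps + 1) * t) <= r t x <= B * expR ((2 * U / eps + 1) * t).
Proof.
move=> eps0 sol uU r0mB t x Tt; have [t0 tT] := Tt.
have [cr cq ur uq] := ode_solution_curves sol.
have [_ _ r_gt0 r0E u0E] := sol.
have [br _ _] := ode_solution_bounded_curves _ _ _ _ _ _ _ _ _ _ sol.
set l := 2 * U / eps + 1.
have main sg M : sg ^+ 2 = 1 -> (forall y, sg * r0 y <= M) ->
    (forall s y, 0 < s <= t -> (forall w, sg * r s w <= sg * r s y) ->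
      sg * density_rhs eps (r s) (q s) y < l * r s y) ->
    sg * r t x <= M * expR (sg * l * t).
  move=> sg2 r0M hl.
  pose z s x := expR (- (sg * l) * s) * (sg * r s x).
  suff : z t x <= M.
    by rewrite /z mulNr expRN mulrC ler_pdivrMr ?expR_gt0.
  apply: (@torus_maximum_principle _ z t M t0) => //; last by rewrite t0 lexx.
  - apply: (uniform_curve_subset (time_interval T)); first exact: subset_time_interval.
    apply: uniform_curve_mul.
    + by move=> s _; exists `|expR (- (sg * l) * s)|.
    + move=> s Ts; have [C hC] := br s Ts; exists (`|sg| * C) => w.
      by rewrite normrM ler_wpM2l.
    + apply: (uniform_curve_time _ (fun s => expR (- (sg * l) * s))) => s.
      apply: continuous_comp; last exact: continuous_expR.
      by apply: cvgM; [exact: cvg_cst|exact: cvg_id].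
    + apply: uniform_curve_mul => //.
        by move=> s _; exists `|sg|.
      by apply: (uniform_curve_time _ (fun => sg)) => ?; exact: cvg_cst.
  - move=> s st; have Ts := time_interval_le _ _ _ Tt st.
    apply: torus_continuousM; first exact: torus_continuous_cst.
    by apply: torus_continuousM; [exact: torus_continuous_cst|exact: cr].
  - move=> s y /andP[s0 st] zmax.
    have Ts : time_interval T s.
      by apply: (time_interval_le _ _ _ Tt); rewrite st ltW.
    have [_ sT] := Ts.
    have [dr _] := ode_solution_is_derive _ _ _ _ _ _ _ _ _ _ s y sol s0 sT.
    have dz : is_derive s 1 (z ^~ y)
        (expR (- (sg * l) * s) * (sg * density_rhs eps (r s) (q s) y) +
         sg * r s y * (- (sg * l) * expR (- (sg * l) * s))).
      have h1 := is_deriveZ sg dr.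
      have h2 : is_derive s 1 (fun s => expR (- (sg * l) * s))
          (- (sg * l) * expR (- (sg * l) * s)).
        have := @is_derive_comp_affine R expR (expR (- (sg * l) * s)) (- (sg * l)) 0 s.
        under eq_fun do rewrite addr0.
        by rewrite addr0 => /(_ (is_derive_expR _)).
      have h := is_deriveM h2 h1.
      exact: h.
    have [||s' hs' zs'] := is_derive_lt0_left _ _ _ dz; [|exact: s0|]; last first.
      exists s' => //; case/andP: hs' => -> /= ss; exact: le_trans st.
    have -> : expR (- (sg * l) * s) * (sg * density_rhs eps (r s) (q s) y) +
         sg * r s y * (- (sg * l) * expR (- (sg * l) * s)) =
      expR (- (sg * l) * s) *
        (sg * density_rhs eps (r s) (q s) y - sg ^+ 2 * (l * r s y)) by ring.
    rewrite pmulr_rlt0 ?expR_gt0// sg2 mul1r subr_lt0.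
    apply: hl; first by rewrite s0.
    by move=> w; have := zmax w; rewrite /z ler_pM2l ?expR_gt0.
  - by move=> y; rewrite /z mulr0 expR0 mul1r r0E.
have U0 : 0 <= U := le_trans (normr_ge0 _) (uU t x Tt).
have step (s : R) : 0 < s <= t -> time_interval T s.
  move=> /andP[s0 st]; apply: (time_interval_le _ _ _ Tt).
  by rewrite st ltW.
have posU s w : time_interval T s -> (velocity (r s) (q s))^\+ w <= U.
  by move=> Ts; rewrite /funrpos ge_max U0 andbT (le_trans (ler_norm _))// uU.
have negU s w : time_interval T s -> (velocity (r s) (q s))^\- w <= U.
  by move=> Ts; rewrite /funrneg ge_max U0 andbT (le_trans (ler_norm _))// normrN uU.
have rhsE s y : density_rhs eps (r s) (q s) y = eps^-1 *
    (r s (y - eps) * (velocity (r s) (q s))^\+ (y - eps) -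
     r s y * `|velocity (r s) (q s) y| +
     r s (y + eps) * (velocity (r s) (q s))^\- (y + eps)) by [].
have lE s y : l * r s y = 2 * (eps^-1 * (r s y * U)) + r s y by rewrite /l; ring.
have Ur0 s y : time_interval T s -> 0 <= eps^-1 * (r s y * U).
  by move=> Ts; rewrite !mulr_ge0 ?invr_ge0 ?(ltW eps0)// ltW// r_gt0.
apply/andP; split.
  have := main (-1) (- m).
  rewrite sqrrN expr1n !mulN1r mulNr lerN2; apply => //.
    by move=> y; rewrite mulN1r lerN2; case/andP: (r0mB y).
  move=> s y /step Ts _; have ry0 := r_gt0 s Ts y.
  apply: (@le_lt_trans _ _ (eps^-1 * (r s y * U))).
    rewrite mulN1r rhsE -mulrN ler_wpM2l ?invr_ge0 ?(ltW eps0)//.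
    have a0 := mulr_ge0 (ltW (r_gt0 s Ts (y - eps)))
      (funrpos_ge0 (velocity (r s) (q s)) (y - eps)).
    have b0 := mulr_ge0 (ltW (r_gt0 s Ts (y + eps)))
      (funrneg_ge0 (velocity (r s) (q s)) (y + eps)).
    have := ler_wpM2l (ltW ry0) (uU s y Ts); lra.
  by rewrite lE; have := Ur0 s y Ts; lra.
have := main 1 B; rewrite expr1n !mul1r; apply => //.
  by move=> y; rewrite mul1r; case/andP: (r0mB y).
move=> s y /step Ts mx; have ry0 := r_gt0 s Ts y.
apply: (@le_lt_trans _ _ (2 * (eps^-1 * (r s y * U)))).
  rewrite mul1r rhsE mulrCA ler_wpM2l ?invr_ge0 ?(ltW eps0)//.
  have h w V : 0 <= V -> V <= U -> r s w * V <= r s y * U.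
    move=> V0 VU; apply: ler_pM => //; first exact: ltW (r_gt0 s Ts w).
    by have := mx w; rewrite !mul1r.
  have := h (y - eps) _ (funrpos_ge0 _ _) (posU s (y - eps) Ts).
  have := h (y + eps) _ (funrneg_ge0 _ _) (negU s (y + eps) Ts).
  have := mulr_ge0 (ltW ry0) (normr_ge0 (velocity (r s) (q s) y)); lra.
by rewrite lE; lra.
Qed.

End APriori.

(** * Global existence and uniqueness *)

Section PicardUniqueness.
Context {R : realType} {I : Type}.

(** A bound [K / 2 ^ n * expR (2 * L * t)] on the difference implies, by comparison of derivatives,
    the same bound with [n + 1]; the rough bound [K] starts the induction. *)
Lemma picard_unique (P : (I -> R) -> Prop) (G : (I -> R) -> I -> R) (L K b : R)
    (w v : R -> I -> R) :
  0 < L -> 0 <= b ->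
  (forall f g (d : R) i, P f -> P g ->
    (forall j, `|f j - g j| <= d) -> `|G f i - G g i| <= L * d) ->
  (forall t, 0 <= t <= b -> P (w t)) -> (forall t, 0 <= t <= b -> P (v t)) ->
  w 0 = v 0 ->
  (forall i, {within `[0, b], continuous (w ^~ i)}) ->
  (forall i, {within `[0, b], continuous (v ^~ i)}) ->
  (forall t i, 0 < t < b -> is_derive t 1 (w ^~ i) (G (w t) i)) ->
  (forall t i, 0 < t < b -> is_derive t 1 (v ^~ i) (G (v t) i)) ->
  (forall t i, 0 <= t <= b -> `|w t i - v t i| <= K) ->
  w b = v b.
Proof.
move=> L0 b0 GL Pw Pv wv0 cw cv dw dv wvK.
pose l := 2 * L.
have l0 : 0 < l by rewrite mulr_gt0.
have dexp n (t : R) : is_derive t 1 (fun t => K / 2 ^+ n * expR (l * t))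
    (K / 2 ^+ n * (l * expR (l * t))).
  have := @is_derive_comp_affine R expR (expR (l * t)) l 0 t.
  under eq_fun do rewrite addr0.
  rewrite addr0 => /(_ (is_derive_expR _)) h.
  exact: (is_deriveZ (K / 2 ^+ n) h).
suff main n (t : R) i : 0 <= t <= b -> `|w t i - v t i| <= K / 2 ^+ n * expR (l * t).
  apply/funext => i; apply/eqP; rewrite -subr_eq0 -normr_le0.
  apply: (@ler_geometric_half _ _ _ (K * expR (l * b))) => n.
  by rewrite add0r mulrAC; apply: main; rewrite b0 lexx.
elim: n t i => [|n ih] t i tb.
  rewrite expr0 divr1; apply: le_trans (wvK t i tb) _.
  have K0 : 0 <= K := le_trans (normr_ge0 _) (wvK t i tb).
  rewrite ler_peMr// -expR0 ler_expR mulr_ge0 ?(ltW l0)//.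
  by case/andP: tb.
case/andP: (tb) => t0 tb'.
have K0 : 0 <= K := le_trans (normr_ge0 _) (wvK t i tb).
have sub : `[0, t] `<=` `[0, b].
  by move=> s /=; rewrite !in_itv/= => /andP[-> st]; exact: le_trans tb'.
apply: (derivative_comparison (fun t => w t i - v t i)
  (fun t => G (w t) i - G (v t) i)
  (fun t => K / 2 ^+ n.+1 * expR (l * t)) _ t t0 _ _ (dexp n.+1)).
- move=> s; apply: cvgB; first exact: (continuous_subspaceW sub (cw i)).
  exact: (continuous_subspaceW sub (cv i)).
- move=> s /andP[s0 st]; have sb : 0 < s < b by rewrite s0 (lt_le_trans st).
  have h1 := dw s i sb; have h2 := dv s i sb.
  exact: is_deriveB h1 h2.
- move=> s /andP[s0 st].
  have sb : 0 <= s <= b by rewrite (ltW s0) (le_trans (ltW st)).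
  have -> : K / 2 ^+ n.+1 * (l * expR (l * s)) = L * (K / 2 ^+ n * expR (l * s)).
    by rewrite /l exprS; field; rewrite expf_neq0 ?andbT//; lra.
  by apply: GL; [exact: Pw|exact: Pv|move=> j; exact: ih].
- rewrite wv0 subrr normr0 mulr_ge0 ?expR_ge0// divr_ge0// exprn_ge0//.
Qed.

End PicardUniqueness.

(** * Bounded Lipschitz functionals and the clamped right-hand side *)

Section BoundedLipschitz.
Context {R : realType} {I : Type}.
Variable P : (I -> R) -> Prop.
Implicit Types (F H : (I -> R) -> R -> R) (c m : R).

(** Boundedness is carried along because a product of Lipschitz functionals is Lipschitz only where
    the factors are bounded. The class is closed under every operation of the right-hand side. *)
Definition bounded_lipschitz F := exists2 C : R, 0 <= C &
  (forall w x, P w -> `|F w x| <= C) /\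
  (forall w v (d : R) x, 0 <= d -> P w -> P v -> (forall i, `|w i - v i| <= d) ->
     `|F w x - F v x| <= C * d).

Lemma bounded_lipschitz_cst c : bounded_lipschitz (fun _ _ => c).
Proof.
exists `|c| => //; split=> // w v d x d0 _ _ _.
by rewrite subrr normr0 mulr_ge0.
Qed.

Lemma bounded_lipschitzD F H : bounded_lipschitz F -> bounded_lipschitz H ->
  bounded_lipschitz (fun w x => F w x + H w x).
Proof.
move=> [C C0 [bF lF]] [C' C'0 [bH lH]]; exists (C + C'); first exact: addr_ge0.
split=> [w x Pw|w v d x d0 Pw Pv wv].
  by apply: le_trans (ler_normD _ _) (lerD _ _); [exact: bF|exact: bH].
have -> : F w x + H w x - (F v x + H v x) =
  (F w x - F v x) + (H w x - H v x) by ring.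
rewrite mulrDl; apply: le_trans (ler_normD _ _) (lerD _ _).
  exact: lF.
exact: lH.
Qed.

Lemma bounded_lipschitzN F : bounded_lipschitz F ->
  bounded_lipschitz (fun w x => - F w x).
Proof.
move=> [C C0 [bF lF]]; exists C => //.
split=> [w x Pw|w v d x d0 Pw Pv wv]; first by rewrite normrN bF.
by rewrite -opprD normrN lF.
Qed.

Lemma bounded_lipschitzM F H : bounded_lipschitz F -> bounded_lipschitz H ->
  bounded_lipschitz (fun w x => F w x * H w x).
Proof.
move=> [C C0 [bF lF]] [C' C'0 [bH lH]].
exists (C * C' + C * C'); first by rewrite addr_ge0 ?mulr_ge0.
split=> [w x Pw|w v d x d0 Pw Pv wv].
  rewrite normrM; apply: (@le_trans _ _ (C * C')).
    by apply: ler_pM => //; [exact: bF|exact: bH].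
  by rewrite lerDl mulr_ge0.
have -> : F w x * H w x - F v x * H v x =
  (F w x - F v x) * H w x + F v x * (H w x - H v x) by ring.
have -> : (C * C' + C * C') * d = (C * d) * C' + C * (C' * d) by ring.
apply: le_trans (ler_normD _ _) (lerD _ _); rewrite normrM; apply: ler_pM => //.
- exact: lF.
- exact: bH.
- exact: bF.
- exact: lH.
Qed.

Lemma bounded_lipschitz_norm F : bounded_lipschitz F ->
  bounded_lipschitz (fun w x => `|F w x|).
Proof.
move=> [C C0 [bF lF]]; exists C => //.
split=> [w x Pw|w v d x d0 Pw Pv wv]; first by rewrite normr_id bF.
by apply: le_trans (lF w v d x d0 Pw Pv wv); exact: ler_dist_dist.
Qed.

Lemma ler_dist_max (a b c : R) : `|Num.max a c - Num.max b c| <= `|a - b|.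
Proof.
have := ler_norm (a - b); have := ler_norm (b - a); rewrite (distrC b).
by rewrite ler_norml; case: (leP a c); case: (leP b c); lra.
Qed.

Lemma ler_dist_min (a b c : R) : `|Num.min c a - Num.min c b| <= `|a - b|.
Proof.
have := ler_norm (a - b); have := ler_norm (b - a); rewrite (distrC b).
by rewrite ler_norml; case: (leP c a); case: (leP c b); lra.
Qed.

Lemma bounded_lipschitz_pos F : bounded_lipschitz F ->
  bounded_lipschitz (fun w x => (F w)^\+ x).
Proof.
move=> [C C0 [bF lF]]; exists C => //.
split=> [w x Pw|w v d x d0 Pw Pv wv].
  rewrite ger0_norm ?funrpos_ge0// /funrpos ge_max C0 andbT.
  by apply: le_trans (ler_norm _) _; exact: bF.
by apply: le_trans (lF w v d x d0 Pw Pv wv); exact: ler_dist_max.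
Qed.

Lemma bounded_lipschitz_shift F c : bounded_lipschitz F ->
  bounded_lipschitz (fun w x => F w (x + c)).
Proof.
move=> [C C0 [bF lF]]; exists C => //.
by split=> [w x Pw|w v d x d0 Pw Pv wv]; [exact: bF|exact: lF].
Qed.

Lemma bounded_lipschitz_inv F m : 0 < m ->
  (forall w x, P w -> m <= F w x) -> bounded_lipschitz F ->
  bounded_lipschitz (fun w x => (F w x)^-1).
Proof.
move=> m0 mF [C C0 [bF lF]]; exists (m^-1 + C / m ^+ 2).
  by rewrite addr_ge0 ?divr_ge0 ?exprn_ge0 ?invr_ge0 ?(ltW m0).
have F0 w x : P w -> 0 < F w x by move=> Pw; exact: lt_le_trans (mF w x Pw).
split=> [w x Pw|w v d x d0 Pw Pv wv].
  rewrite ger0_norm ?invr_ge0 ?(ltW (F0 w x Pw))//.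
  apply: (@le_trans _ _ m^-1).
    by rewrite lef_pV2 ?posrE//; [exact: mF|exact: F0].
  by rewrite lerDl divr_ge0 ?exprn_ge0 ?(ltW m0).
have Fw := F0 w x Pw; have Fv := F0 v x Pv.
have -> : (F w x)^-1 - (F v x)^-1 = - (F w x - F v x) / (F w x * F v x).
  by field; rewrite !gt_eqF.
rewrite normrM normrN normfV (gtr0_norm (mulr_gt0 Fw Fv)).
apply: (@le_trans _ _ (C * d / m ^+ 2)).
  apply: ler_pM => //; first by rewrite invr_ge0 ltW// mulr_gt0.
    exact: lF.
  rewrite lef_pV2 ?posrE ?mulr_gt0 ?exprn_gt0// expr2.
  by apply: ler_pM; rewrite ?(ltW m0)// mF.
by rewrite mulrDl mulrAC lerDr mulr_ge0// invr_ge0 ltW.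
Qed.

Lemma bounded_lipschitz_transport eps F H :
  bounded_lipschitz F -> bounded_lipschitz H ->
  bounded_lipschitz (fun w => transport eps (F w) (H w)).
Proof.
move=> lF lH; apply: bounded_lipschitzM; first exact: bounded_lipschitz_cst.
have lFp := bounded_lipschitz_pos _ lF.
have lFn : bounded_lipschitz (fun w x => (F w)^\- x).
  have := bounded_lipschitz_pos _ (bounded_lipschitzN _ lF).
  by under eq_fun do rewrite funrposN.
apply: bounded_lipschitzD.
  apply: bounded_lipschitzD.
    exact: (bounded_lipschitz_shift _ (- eps) (bounded_lipschitzM _ _ lH lFp)).
  apply/bounded_lipschitzN/bounded_lipschitzM => //.
  exact: bounded_lipschitz_norm.
exact: (bounded_lipschitz_shift _ eps (bounded_lipschitzM _ _ lH lFn)).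
Qed.

End BoundedLipschitz.

Section ClampedSystem.
Context {R : realType}.
Implicit Types (w v : bool * R -> R) (m B Q x : R).

(* A state (rho, rho u) is a single function on [bool * R]. *)
Definition torus_state w := torus_continuous (fun x => w (false, x)) /\
  torus_continuous (fun x => w (true, x)).

Definition clamp m B (f : R -> R) x := Num.max (Num.min B (f x)) m.

Lemma clamp_id m B f x : m <= f x <= B -> clamp m B f x = f x.
Proof. by move=> /andP[mf fB]; rewrite /clamp min_r// max_l. Qed.

Lemma clamp_bounds m B f x : m <= B -> m <= clamp m B f x <= B.
Proof.
by move=> mB; rewrite /clamp le_max lexx orbT/= ge_max mB andbT ge_min lexx.
Qed.

Lemma torus_continuous_clamp m B f : torus_continuous f ->
  torus_continuous (clamp m B f).
Proof.
move=> cf; apply: torus_continuous_max; last exact: torus_continuous_cst.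
by apply: torus_continuous_min => //; exact: torus_continuous_cst.
Qed.

Lemma bounded_lipschitz_clamp m B b : m <= B ->
  bounded_lipschitz torus_state (fun w => clamp m B (fun x => w (b, x))).
Proof.
move=> mB; exists (1 + `|m| + `|B|); first by rewrite !addr_ge0.
split=> [w x _|w v d x d0 _ _ wv].
  have /andP[] := clamp_bounds m B (fun x => w (b, x)) x mB.
  have := ler_norm B; have := ler_norm (- m); rewrite normrN ler_norml.
  have := normr_ge0 m; have := normr_ge0 B; lra.
apply: (@le_trans _ _ d); last first.
  by rewrite ler_peMl// -addrA lerDl addr_ge0.
apply: le_trans (ler_dist_max _ _ _) _.
by apply: le_trans (ler_dist_min _ _ _) _; exact: wv.
Qed.

Lemma torus_state_closed w :
  (forall e : R, 0 < e -> exists2 v, torus_state v & forall i, `|w i - v i| <= e) ->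
  torus_state w.
Proof.
move=> h.
suff main b : (forall v, torus_state v -> torus_continuous (fun x => v (b, x))) ->
    torus_continuous (fun x => w (b, x)).
  by split; apply: main => v [].
move=> hv; split.
  move=> x /=; apply/eqP; rewrite -subr_eq0 -normr_le0.
  apply/ler_addgt0Pr => e e0; rewrite add0r.
  have [v /hv[pv _] wv] := h (e / 2) ltac:(by rewrite divr_gt0).
  have -> : w (b, x + pi *+ 2) - w (b, x) =
    (w (b, x + pi *+ 2) - v (b, x + pi *+ 2)) - (w (b, x) - v (b, x)).
    by have /= -> := pv x; ring.
  by apply: le_trans (ler_normB _ _) _; rewrite [e]splitr lerD.
move=> x; apply/cvgrPdist_le => e e0.
have e30 : 0 < e / 3 by rewrite divr_gt0.
have [v /hv[_ cv] wv] := h _ e30.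
have /cvgrPdist_le/(_ _ e30) := cv x; apply: filterS => y vxy.
have -> : w (b, x) - w (b, y) = (w (b, x) - v (b, x)) +
  ((v (b, x) - v (b, y)) - (w (b, y) - v (b, y))) by ring.
have -> : e = e / 3 + (e / 3 + e / 3) by field.
apply: le_trans (ler_normD _ _) (lerD (wv _) _).
by apply: le_trans (ler_normB _ _) (lerD vxy (wv _)).
Qed.

Lemma torus_state_linear a w v : torus_state w -> torus_state v ->
  torus_state (fun i => w i + a * v i).
Proof.
move=> [w1 w2] [v1 v2]; split; apply: torus_continuousD => //;
  by apply: torus_continuousM => //; exact: torus_continuous_cst.
Qed.

End ClampedSystem.

Section ClampedRhs.
Context {R : realType}.
Implicit Types (K gamma alpha eps m B Q x t : R) (phi f : R -> R).
Implicit Types (w v : bool * R -> R).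

(** The arguments are clamped, not the values: the result is the original right-hand side at another
    torus-continuous state with positive density, so the facts on transport and force apply to it
    directly. *)
Definition clamped_rhs K gamma alpha phi eps m B Q w (i : bool * R) : R :=
  let r := clamp m B (fun x => w (false, x)) in
  let q := clamp (- Q) Q (fun x => w (true, x)) in
  if i.1 then momentum_rhs K gamma alpha phi eps r q i.2
  else density_rhs eps r q i.2.

Definition in_box m B Q w := forall x,
  m <= w (false, x) <= B /\ - Q <= w (true, x) <= Q.

Lemma clamped_rhs_in_box K gamma alpha phi eps m B Q w : in_box m B Q w ->
  clamped_rhs K gamma alpha phi eps m B Q w = fun i =>
    let r x := w (false, x) in let q x := w (true, x) in
    if i.1 then momentum_rhs K gamma alpha phi eps r q i.2
    else density_rhs eps r q i.2.
Proof.
move=> wbox; apply/funext => i; rewrite /clamped_rhs.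
have -> : clamp m B (fun x => w (false, x)) = fun x => w (false, x).
  by apply/funext => x; apply: clamp_id; case: (wbox x).
have -> // : clamp (- Q) Q (fun x => w (true, x)) = fun x => w (true, x).
by apply/funext => x; apply: clamp_id; case: (wbox x).
Qed.

Lemma exists_period_multiple (a : R) : exists N : nat, a <= (pi *+ 2) *+ N.
Proof.
exists (Num.trunc (Num.max 0 (a / (pi *+ 2)))).+1.
rewrite -mulr_natl -ler_pdivrMr ?pi2_gt0//.
apply: le_trans (_ : Num.max 0 (a / (pi *+ 2)) <= _).
  by rewrite le_max lexx orbT.
by apply/ltW/truncnS_gt.
Qed.

Lemma torus_state_clamped_rhs K gamma alpha phi phi1 phi2 A D eps m B Q w :
  bump A D phi phi1 phi2 -> 0 < eps -> 0 < m -> m <= B -> torus_state w ->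
  torus_state (clamped_rhs K gamma alpha phi eps m B Q w).
Proof.
move=> bphi eps0 m0 mB [cr cq].
have ccr := torus_continuous_clamp m B _ cr.
have ccq := torus_continuous_clamp (- Q) Q _ cq.
have r0 x : 0 < clamp m B (fun x => w (false, x)) x.
  by apply: lt_le_trans m0 _; case/andP: (clamp_bounds m B (fun x => w (false, x)) x mB).
have cu := torus_continuous_velocity _ _ r0 ccr ccq.
split; first exact: torus_continuous_transport.
apply: torus_continuousD; first exact: torus_continuous_transport.
apply: torus_continuousN; apply: torus_continuousM; first exact: ccr.
exact: torus_continuous_force bphi eps0 ccr r0.
Qed.

Lemma clamped_rhs_lipschitz K gamma alpha phi phi1 phi2 A D eps m B Q :
  0 <= K -> 1 < gamma <= 2 -> bump A D phi phi1 phi2 ->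
  0 < eps -> 0 < m -> m <= B -> 0 <= Q ->
  exists2 C : R, 0 < C &
    (forall w i, torus_state w -> `|clamped_rhs K gamma alpha phi eps m B Q w i| <= C) /\
    (forall w v (d : R) i, torus_state w -> torus_state v ->
      (forall j, `|w j - v j| <= d) ->
      `|clamped_rhs K gamma alpha phi eps m B Q w i -
        clamped_rhs K gamma alpha phi eps m B Q v i| <= C * d).
Proof.
move=> K0 gamma12 bphi eps0 m0 mB Q0.
pose cr w := clamp m B (fun x => w (false, x)).
pose cq w := clamp (- Q) Q (fun x => w (true, x)).
have lr : bounded_lipschitz torus_state cr by exact: bounded_lipschitz_clamp.
have lq : bounded_lipschitz torus_state cq.
  by apply: bounded_lipschitz_clamp; lra.
have mr w x : m <= cr w x by case/andP: (clamp_bounds m B (fun x => w (false, x)) x mB).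
have rB w x : cr w x <= B by case/andP: (clamp_bounds m B (fun x => w (false, x)) x mB).
have r0 w x : 0 < cr w x by exact: lt_le_trans (mr w x).
have tr w : torus_state w -> torus_continuous (cr w).
  by move=> [? _]; exact: torus_continuous_clamp.
have lu : bounded_lipschitz torus_state (fun w => velocity (cr w) (cq w)).
  apply: bounded_lipschitzM => //; apply: (bounded_lipschitz_inv _ _ m) => //.
have c0 : 0 <= K * gamma / (gamma - 1).
  by case/andP: gamma12 => g1 g2; rewrite divr_ge0 ?mulr_ge0//; lra.
have D0 : 0 <= D := le_trans (normr_ge0 _) (bump_le _ _ _ _ _ bphi 0).
have A0 := bump_radius _ _ _ _ _ bphi.
have e0 : 0 < eps `^ alpha := powR_gt0 alpha eps0.
have lF : bounded_lipschitz torus_state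
    (fun w => derive1 (potential K gamma alpha phi eps (cr w))).
  have [N hN] := exists_period_multiple (2 * (eps `^ alpha * A)).
  have [C C0 [_ lr']] := lr.
  (* [C1] is the bound of [force_le] with the mass replaced by [B * (pi *+ 2)], the largest mass of
     a clamped density; [C2] is the constant of [force_lipschitz]. *)
  set C1 := K * gamma / (gamma - 1) * ((eps `^ alpha)^-1 ^+ 2 * D *
    (2 * (eps `^ alpha * A) + (B * (pi *+ 2)) *+ N)).
  set C2 := K * gamma / (gamma - 1) * (2 * (eps `^ alpha * A) *
    ((eps `^ alpha)^-1 ^+ 2 * D) * (1 + m^-1)).
  have B0 : 0 <= B by lra.
  have P0 := @pi2_gt0 R.
  have i0 : 0 <= (eps `^ alpha)^-1 ^+ 2 by rewrite exprn_ge0// invr_ge0 ltW.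
  have eA : 0 <= 2 * (eps `^ alpha * A) by rewrite !mulr_ge0// ltW.
  have C10 : 0 <= C1.
    apply: mulr_ge0 => //; apply: mulr_ge0; first exact: mulr_ge0.
    by apply: addr_ge0 => //; apply: mulrn_wge0; apply: mulr_ge0 => //; exact: ltW.
  have C20 : 0 <= C2.
    apply: mulr_ge0 => //; apply: mulr_ge0; last by rewrite addr_ge0// invr_ge0 ltW.
    by apply: mulr_ge0 => //; exact: mulr_ge0.
  exists (C1 + C2 * C); first by rewrite addr_ge0// mulr_ge0.
  split=> [w x Pw|w v d x d0 Pw Pv wv].
    apply: le_trans (force_le _ _ _ _ _ _ _ _ _ _ x N K0 gamma12 bphi eps0
      (tr w Pw) (r0 w) hN) _.
    apply: (@le_trans _ _ C1); last by rewrite lerDl mulr_ge0.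
    apply: ler_wpM2l => //; apply: ler_wpM2l; first exact: mulr_ge0.
    rewrite lerD2l lerMn2r; apply/orP; right.
    have -> : B * (pi *+ 2) = \int[lebesgue_measure]_(x in `[0, pi *+ 2 : R]) B.
      by rewrite Rintegral_segment_cst ?subr0// ltW.
    apply: le_Rintegral_segment; [exact: (tr w Pw).2| |by move=> y _; exact: rB].
    by move=> ?; exact: cvg_cst.
  have h : `|derive1 (potential K gamma alpha phi eps (cr w)) x -
      derive1 (potential K gamma alpha phi eps (cr v)) x| <= C2 * (C * d).
    exact: (force_lipschitz K gamma alpha _ _ _ _ _ _ _ _ m (C * d) x K0 gamma12 bphi eps0
      (tr w Pw) (tr v Pv) m0 (mr w) (mr v) (fun y => lr' w v d y d0 Pw Pv wv)).
  apply: (le_trans h); clearbody C1 C2.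
  by rewrite mulrDl -mulrA lerDr mulr_ge0.
have [C C0 [bd lip]] : bounded_lipschitz torus_state
    (fun w => density_rhs eps (cr w) (cq w)).
  exact: bounded_lipschitz_transport.
have [C' C'0 [bd' lip']] : bounded_lipschitz torus_state
    (fun w => momentum_rhs K gamma alpha phi eps (cr w) (cq w)).
  apply: bounded_lipschitzD; first exact: bounded_lipschitz_transport.
  by apply/bounded_lipschitzN/bounded_lipschitzM.
(* The iteration asks for a strictly positive constant. *)
exists (C + C' + 1); first by rewrite ltr_wpDl// addr_ge0.
split=> [w [[] x] Pw|w v d [[] x] Pw Pv wv]; rewrite /clamped_rhs/=.
- by apply: le_trans (bd' w x Pw) _; lra.
- by apply: le_trans (bd w x Pw) _; lra.
- have d0 : 0 <= d := le_trans (normr_ge0 _) (wv (true, x)).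
  apply: le_trans (lip' w v d x d0 Pw Pv wv) _.
  by rewrite ler_wpM2r//; lra.
- have d0 : 0 <= d := le_trans (normr_ge0 _) (wv (true, x)).
  apply: le_trans (lip w v d x d0 Pw Pv wv) _.
  by rewrite ler_wpM2r//; lra.
Qed.

End ClampedRhs.

Section Existence.
Context {R : realType}.
Local Notation mu := (@lebesgue_measure R).
Implicit Types (K gamma alpha eps m B Q x t : R) (phi : R -> R) (T : \bar R).

Lemma ode_solution_restrict K gamma alpha phi eps (r0 u0 : R -> R) T T' r q :
  (T' <= T)%E -> ode_solution K gamma alpha phi eps r0 u0 T r q ->
  ode_solution K gamma alpha phi eps r0 u0 T' r q.
Proof.
move=> TT' [/C1_torus_curveP[a1 a2 a3 a4] /C1_torus_curveP[b1 b2 b3 b4] r_gt0 r0E u0E].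
have sub : time_interval T' `<=` time_interval T.
  by move=> t [t0 tT']; split => //; exact: lt_le_trans TT'.
split; [| | |exact: r0E|exact: u0E].
- apply/C1_torus_curveP; split.
  + by move=> t /sub; exact: a1.
  + by move=> t /sub; exact: a2.
  + exact: uniform_diff_curve_subset sub a3.
  + exact: uniform_curve_subset sub a4.
- apply/C1_torus_curveP; split.
  + by move=> t /sub; exact: b1.
  + by move=> t /sub; exact: b2.
  + exact: uniform_diff_curve_subset sub b3.
  + exact: uniform_curve_subset sub b4.
- by move=> t /sub; exact: r_gt0.
Qed.

(** The box depends only on the data and the horizon [H], and is chosen before the solution and its
    interval of existence. It can therefore be used on a curve known to be a solution only for a
    short time, and on two solutions at once. *)
Lemma ode_solution_box K gamma alpha phi phi1 phi2 A D eps (r0 u0 : R -> R) (H : R) :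
  0 <= K -> 1 < gamma <= 2 -> bump A D phi phi1 phi2 -> 0 < eps ->
  torus_continuous r0 -> torus_continuous u0 -> (forall x, 0 < r0 x) -> 0 < H ->
  exists m B Q, [/\ [/\ 0 < m, m <= B & 0 <= Q],
    forall x, m <= r0 x <= B /\ - Q <= r0 x * u0 x <= Q &
    forall T r q, ode_solution K gamma alpha phi eps r0 u0 T r q ->
      forall t x, time_interval T t -> t < H ->
        m <= r t x <= B /\ - Q <= q t x <= Q].
Proof.
move=> K0 gamma12 bphi eps0 cr0 cu0 r0_gt0 H0.
have [m0 m00 hm0] := torus_lower_bound _ cr0 r0_gt0.
have [B0 B00 hB0] := torus_bounded _ cr0.
have [U0 U00 hU0] := torus_bounded _ cu0.
have [N hN] := exists_period_multiple (2 * (eps `^ alpha * A)).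
set C := K * gamma / (gamma - 1) * ((eps `^ alpha)^-1 ^+ 2 * D *
    (2 * (eps `^ alpha * A) + (\int[mu]_(x in `[0, pi *+ 2]) r0 x) *+ N)).
have C0 : 0 <= C.
  exact: le_trans (normr_ge0 _) (force_le _ _ _ _ _ _ _ _ _ r0 0 N K0 gamma12 bphi eps0
    cr0 r0_gt0 hN).
pose U := U0 + C * H.
have U0U : U0 <= U by rewrite /U lerDl mulr_ge0// ltW.
have U_ge0 : 0 <= U by exact: le_trans U0U.
pose l := 2 * U / eps + 1.
have l0 : 0 <= l by rewrite /l addr_ge0// divr_ge0// ?mulr_ge0// ltW.
pose m := m0 * expR (- l * H); pose B := B0 * expR (l * H).
have e1 : expR (- l * H) <= 1 by rewrite -expR0 ler_expR mulNr oppr_le0 mulr_ge0// ltW.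
have e2 : 1 <= expR (l * H) by rewrite -expR0 ler_expR mulr_ge0// ltW.
have r0m x : m <= r0 x by apply: le_trans (hm0 x); rewrite /m ger_pMr.
have r0B x : r0 x <= B.
  apply: le_trans (ler_norm _) _; apply: le_trans (hB0 x) _.
  by rewrite /B ler_peMr.
have box r' u' : m <= r' <= B -> `|u'| <= U -> 0 < r' -> - (B * U) <= r' * u' <= B * U.
  move=> /andP[_ r'B] u'U r'0; rewrite -ler_norml normrM.
  by apply: ler_pM => //; rewrite gtr0_norm.
have mpos : 0 < m by rewrite /m mulr_gt0// expR_gt0.
exists m, B, (B * U); split.
- split=> //; first exact: le_trans (r0m 0) (r0B 0).
  by rewrite mulr_ge0// /B mulr_ge0// expR_ge0.
- move=> x; split; first by rewrite r0m r0B.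
  apply: box => //; first by rewrite r0m r0B.
  by apply: le_trans (hU0 x) _.
move=> T r q sol t x [t0 tT] tH.
(* Cutting the interval at [H] turns the bounds growing with time into the constants [U] and [l]
   fixed above. *)
pose T' := Order.min T H%:E.
have sol' : ode_solution K gamma alpha phi eps r0 u0 T' r q.
  by apply: ode_solution_restrict sol; rewrite ge_min lexx.
have Tt : time_interval T' t by split => //; rewrite lt_min tT lte_fin.
have [cr cq _ _] := ode_solution_curves sol'.
have [_ _ r_gt0 _ _] := sol'.
have FC s y : time_interval T' s ->
    `|derive1 (potential K gamma alpha phi eps (r s)) y| <= C.
  move=> Ts; have := force_le _ _ _ _ _ _ _ _ _ (r s) y N K0 gamma12 bphi eps0
    (cr s Ts) (r_gt0 s Ts) hN.
  by rewrite (ode_solution_mass _ _ _ _ _ _ _ _ _ _ s sol' Ts).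
have uU s y : time_interval T' s -> `|velocity (r s) (q s) y| <= U.
  move=> Ts; apply: le_trans (velocity_bound _ _ _ _ _ _ _ _ _ _ _ _ eps0 sol' hU0 FC s y Ts) _.
  rewrite lerD2l ler_wpM2l//; have [_] := Ts.
  by rewrite lt_min lte_fin => /andP[_ /ltW].
have r0mB y : m0 <= r0 y <= B0.
  by rewrite hm0 (le_trans (ler_norm _) (hB0 y)).
have /andP[rl ru] := density_exponential_bounds _ _ _ _ _ _ _ _ _ _ _ _ _ eps0 sol' uU r0mB t x Tt.
have rmB : m <= r t x <= B.
  apply/andP; split.
    apply: le_trans rl; rewrite /m ler_pM2l// ler_expR -/l !mulNr lerN2.
    by rewrite ler_wpM2l// ltW.
  apply: le_trans ru _; rewrite /B ler_wpM2l// ler_expR -/l.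
  by rewrite ler_wpM2l// ltW.
split=> //.
have rt0 := r_gt0 t Tt x.
have -> : q t x = r t x * velocity (r t) (q t) x.
  by rewrite /velocity mulrC divfK// gt_eqF.
by apply: box => //; exact: uU.
Qed.

End Existence.

(** * Continuation, uniqueness and gluing *)

Section WellPosedness.
Context {R : realType}.
Local Notation mu := (@lebesgue_measure R).
Implicit Types (K gamma alpha eps m B Q L C x t : R) (phi : R -> R) (T : \bar R).

Lemma state_C1_torus_curve (D : set R) (w : R -> bool * R -> R)
    (G : (bool * R -> R) -> bool * R -> R)
    (f' : R -> R -> R) (b : bool) L C :
  0 <= L -> 0 <= C ->
  (forall t, D t -> torus_continuous (fun x => w t (b, x))) ->
  (forall t, D t -> torus_continuous (fun x => G (w t) (b, x))) ->
  (forall s t i, D s -> D t -> `|w s i - w t i - (s - t) * G (w t) i| <= C * `|s - t| ^+ 2) ->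
  (forall s t i, D s -> D t -> `|G (w s) i - G (w t) i| <= L * `|s - t|) ->
  (forall t, D t -> f' t = fun x => G (w t) (b, x)) ->
  C1_torus_curve D (fun t x => w t (b, x)) f'.
Proof.
move=> L0 C0 cw cG wC GL f'E; apply/C1_torus_curveP; split.
- exact: cw.
- by move=> t Dt; rewrite f'E//; exact: cG.
- move=> t Dt e e0; exists (e / (C + 1)); first by rewrite divr_gt0// ltr_wpDl.
  move=> s Ds; rewrite ltr_pdivlMr ?ltr_wpDl// => st x; rewrite f'E//.
  apply: le_trans (wC s t (b, x) Ds Dt) _; rewrite expr2 mulrA ler_wpM2r//.
  have := normr_ge0 (s - t); nra.
- move=> t Dt e e0; exists (e / (L + 1)); first by rewrite divr_gt0// ltr_wpDl.
  move=> s Ds; rewrite ltr_pdivlMr ?ltr_wpDl// => st x; rewrite !f'E//.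
  apply: le_trans (GL s t (b, x) Ds Dt) _.
  have := normr_ge0 (s - t); nra.
Qed.

(** Continuation by steps: as long as the clamped curve stays in the enlarged box it solves the true
    system, so the a priori bounds put it back in the small box, from where it cannot leave the
    enlarged one for a fixed time. *)
Lemma ode_solution_horizon K gamma alpha phi phi1 phi2 A D eps (r0 u0 : R -> R) (H : R) :
  0 <= K -> 1 < gamma <= 2 -> bump A D phi phi1 phi2 -> 0 < eps ->
  torus_continuous r0 -> torus_continuous u0 -> (forall x, 0 < r0 x) -> 0 < H ->
  exists r q, ode_solution K gamma alpha phi eps r0 u0 H%:E r q.
Proof.
move=> K0 gamma12 bphi eps0 cr0 cu0 r0_gt0 H0.
have [m' [B' [Q' [[m'0 m'B' Q'0] box0 boxsol]]]] :=
  ode_solution_box K gamma alpha _ _ _ _ _ _ _ _ H K0 gamma12 bphi eps0 cr0 cu0 r0_gt0 H0.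
(* A margin of at most [m' / 2] keeps the enlarged box away from the vacuum. *)
pose k := Num.min (m' / 2) 1.
have k0 : 0 < k by rewrite lt_min ltr01 divr_gt0.
have km : k <= m' / 2 by rewrite ge_min lexx.
pose m := m' - k; pose B := B' + k; pose Q := Q' + k.
have m0 : 0 < m by rewrite /m; lra.
have mB : m <= B by rewrite /m /B; lra.
have Q0 : 0 <= Q by rewrite /Q; lra.
have [C C0 [GB GL]] := clamped_rhs_lipschitz K gamma alpha _ _ _ _ _ _ m B Q
  K0 gamma12 bphi eps0 m0 mB Q0.
set G := clamped_rhs K gamma alpha phi eps m B Q in GB GL.
have GP w : torus_state w -> torus_state (G w).
  exact: torus_state_clamped_rhs bphi eps0 m0 mB.
pose w0 (i : bool * R) := if i.1 then r0 i.2 * u0 i.2 else r0 i.2.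
have Pw0 : torus_state w0.
  by split; [exact: cr0|exact: torus_continuousM].
have [w [w00 Pw wlip wtaylor]] := picard_lindelof _ _ _ _ _ torus_state_closed
  torus_state_linear (ltW C0) C0 GP (fun w i Pw => GB w i Pw) GL Pw0.
have sol (T : R) : (forall t, 0 <= t < T -> in_box m B Q (w t)) ->
    ode_solution K gamma alpha phi eps r0 u0 T%:E
      (fun t x => w t (false, x)) (fun t x => w t (true, x)).
  move=> wbox.
  have DT t : time_interval T%:E t -> 0 <= t < T.
    by move=> [t0]; rewrite lte_fin t0.
  have D0 t : time_interval T%:E t -> 0 <= t by move=> [].
  have GE t : time_interval T%:E t -> _ := fun Tt =>
    clamped_rhs_in_box K gamma alpha phi eps m B Q (w t) (wbox t (DT t Tt)).
  have curve b f' : (forall t, time_interval T%:E t -> f' t = fun x => G (w t) (b, x)) ->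
      C1_torus_curve (time_interval T%:E) (fun t x => w t (b, x)) f'.
    apply: (state_C1_torus_curve _ w G f' b (C * C) (C * C)).
    - exact: mulr_ge0 (ltW C0) (ltW C0).
    - exact: mulr_ge0 (ltW C0) (ltW C0).
    - by move=> t /D0/Pw[]; case: b.
    - by move=> t /D0/Pw/GP[]; case: b.
    - by move=> s t i /D0 s0 /D0 t0; exact: wtaylor.
    - move=> s t i /D0 s0 /D0 t0; rewrite -mulrA.
      by apply: GL; [exact: Pw|exact: Pw|move=> j; exact: wlip].
  split.
  - by apply: curve => t Tt; rewrite /G GE.
  - by apply: curve => t Tt; rewrite /G GE.
  - move=> t Tt x; have [/andP[mw _] _] := wbox t (DT t Tt) x.
    exact: lt_le_trans mw.
  - by apply/funext => x; rewrite w00.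
  - by apply/funext => x; rewrite /velocity w00 /w0/= mulrC mulKf// gt_eqF.
exists (fun t x => w t (false, x)), (fun t x => w t (true, x)).
apply: (sol H) => t /andP[t0 tH].
pose h := k / C / 2.
have h0 : 0 < h by rewrite !divr_gt0.
(* The curve has speed at most [C], so it needs time [2 * h] to cross the
   margin [k] between the a priori bounds and the box. *)
have near_box s u : 0 <= s -> 0 <= u -> `|u - s| <= 2 * h ->
    (forall x, m' <= w s (false, x) <= B' /\ - Q' <= w s (true, x) <= Q') ->
    in_box m B Q (w u).
  move=> s0 u0' us sbox x; have [/andP[b1 b2] /andP[b3 b4]] := sbox x.
  have dk b : `|w u (b, x) - w s (b, x)| <= k.
    apply: le_trans (wlip u s (b, x) u0' s0) _.
    rewrite -ler_pdivlMl//; apply: le_trans us _; rewrite /h le_eqVlt.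
    by apply/orP; left; apply/eqP; field; rewrite gt_eqF.
  have := dk true; have := dk false; rewrite !ler_norml.
  move=> /andP[c1 c2] /andP[c3 c4].
  by split; apply/andP; split; rewrite /m /B /Q; lra.
have main (n : nat) u : 0 <= u < H -> u <= n%:R * h -> in_box m B Q (w u).
  elim: n u => [|n ih] u /andP[u0' uH] un.
    have -> : u = 0 by apply/eqP; rewrite eq_le u0' andbT -[leRHS](mul0r h).
    apply: (near_box 0) => //; first by rewrite subrr normr0 mulr_ge0// ltW.
    by move=> x; rewrite w00; exact: box0.
  have [uh|uh] := leP u (2 * h).
    apply: (near_box 0) => //; first by rewrite subr0 ger0_norm.
    by move=> x; rewrite w00; exact: box0.
  (* Going back by [2 * h] while the induction advances by [h] lands strictly before [n * h], as
     needed because the interval of the known solution is open on the right. *)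
  apply: (near_box (u - 2 * h)) => //; first lra.
    by rewrite opprB addrC subrK ger0_norm// mulr_ge0// ltW.
  move=> x.
  have sn : ode_solution K gamma alpha phi eps r0 u0 (Num.min (n%:R * h) H)%:E
      (fun t x => w t (false, x)) (fun t x => w t (true, x)).
    apply: (sol) => s /andP[s0]; rewrite lt_min => /andP[sn sH].
    by apply: ih; [rewrite s0|exact: ltW].
  have uH' : u - 2 * h < H by lra.
  apply: (boxsol _ _ _ sn (u - 2 * h) x) => //; split; first lra.
  by rewrite lte_fin lt_min uH' andbT; move: un; rewrite -natr1; lra.
apply: (main (Num.trunc (t / h)).+1); first by rewrite t0.
by rewrite -ler_pdivrMr//; apply/ltW/truncnS_gt.
Qed.

(** Up to time [t] both solutions stay in one common box, where the clamped and the true right-hand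
    sides agree; so both solve the same globally Lipschitz equation. *)
Lemma ode_solution_unique K gamma alpha phi phi1 phi2 A D eps (r0 u0 : R -> R)
    (T T' : \bar R) (r q r' q' : R -> R -> R) t :
  0 <= K -> 1 < gamma <= 2 -> bump A D phi phi1 phi2 -> 0 < eps ->
  torus_continuous r0 -> torus_continuous u0 -> (forall x, 0 < r0 x) ->
  ode_solution K gamma alpha phi eps r0 u0 T r q ->
  ode_solution K gamma alpha phi eps r0 u0 T' r' q' ->
  time_interval T t -> time_interval T' t -> r t = r' t /\ q t = q' t.
Proof.
move=> K0 gamma12 bphi eps0 cr0 cu0 r0_gt0 sol sol' Tt T't.
have [t0 tT] := Tt; have [_ tT'] := T't.
(* The box holds strictly before its horizon; [t + 1] includes the time [t]. *)
have t10 : 0 < t + 1 by rewrite ltr_wpDl.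
have [m [B [Q [[m0 mB Q0] box0 boxsol]]]] :=
  ode_solution_box K gamma alpha _ _ _ _ _ _ _ _ (t + 1) K0 gamma12 bphi eps0 cr0 cu0 r0_gt0 t10.
have [C C0 [_ GL]] := clamped_rhs_lipschitz K gamma alpha _ _ _ _ _ _ m B Q
  K0 gamma12 bphi eps0 m0 mB Q0.
pose st (f g : R -> R -> R) s (i : bool * R) := if i.1 then g s i.2 else f s i.2.
have facts S f g : time_interval S t -> ode_solution K gamma alpha phi eps r0 u0 S f g ->
  [/\ forall s, 0 <= s <= t -> torus_state (st f g s),
      forall s, 0 <= s <= t -> in_box m B Q (st f g s),
      st f g 0 = (fun i : bool * R => if i.1 then r0 i.2 * u0 i.2 else r0 i.2),
      forall i, {within `[0, t], continuous (st f g ^~ i)} &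
      forall s i, 0 < s < t -> is_derive s 1 (st f g ^~ i)
        (clamped_rhs K gamma alpha phi eps m B Q (st f g s) i)].
  move=> St sl; have [_ tS] := St.
  have [cf cg uf ug] := ode_solution_curves sl.
  have [_ _ f_gt0 f0 g0] := sl.
  have sub := subset_time_interval _ _ tS.
  have bx s : 0 <= s <= t -> in_box m B Q (st f g s).
    move=> s0t x; have Ss := time_interval_le _ _ _ St s0t.
    apply: (boxsol _ _ _ sl s x Ss).
    by case/andP: s0t => _ /le_lt_trans; apply; rewrite ltrDl.
  split.
  - by move=> s s0t; have Ss := time_interval_le _ _ _ St s0t; split; [exact: cf|exact: cg].
  - exact: bx.
  - apply/funext => -[[] x]; rewrite /st/=; last by rewrite f0.
    have D0 : time_interval S 0 by apply: (time_interval_le _ _ _ St); rewrite lexx.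
    by rewrite -f0 -g0 /velocity mulrC divfK// gt_eqF//; exact: f_gt0.
  - move=> -[[] x].
      exact: uniform_curve_continuous _ _ x t ug sub.
    exact: uniform_curve_continuous _ _ x t uf sub.
  - move=> s [b x] /andP[s0 st'].
    have s0t : 0 <= s <= t by rewrite !ltW.
    have [_ sS] := time_interval_le _ _ _ St s0t.
    have [df dg] := ode_solution_is_derive _ _ _ _ _ _ _ _ _ _ s x sl s0 sS.
    rewrite (clamped_rhs_in_box _ _ _ _ _ _ _ _ _ (bx s s0t)).
    by case: b; [exact: dg|exact: df].
have [P1 bx1 i1 c1 d1] := facts _ _ _ Tt sol.
have [P2 bx2 i2 c2 d2] := facts _ _ _ T't sol'.
have e : st r q t = st r' q' t.
  (* The initial distance bound is the sum of the two side lengths of the box. *)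
  apply: (picard_unique torus_state (clamped_rhs K gamma alpha phi eps m B Q) C
    ((B - m) + (Q + Q)) t) => //.
  - by rewrite i1 i2.
  - move=> s [b x] s0t; have [/andP[? ?] /andP[? ?]] := bx1 s s0t x.
    have [/andP[? ?] /andP[? ?]] := bx2 s s0t x.
    by case: b; rewrite ler_norml; apply/andP; split; lra.
split; apply/funext => x.
  exact: (congr1 (fun h => h (false, x)) e).
exact: (congr1 (fun h => h (true, x)) e).
Qed.

(** Being continuously differentiable is local in time. The comparison curve [g] and its domain may
    vary with [t], which is what gluing solutions with different horizons requires. *)
Lemma C1_torus_curve_local (D : set R) (f f' : R -> R -> R) :
  (forall t, D t -> exists2 d, 0 < d & exists D' g g',
    [/\ C1_torus_curve D' g g', D' t & forall s, D s -> `|s - t| < d ->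
      [/\ D' s, f s = g s & f' s = g' s]]) ->
  C1_torus_curve D f f'.
Proof.
move=> h; apply/C1_torus_curveP; split.
- move=> t Dt; have [d d0 [D' [g [g' [/C1_torus_curveP[c1 _ _ _] D't fg]]]]] := h t Dt.
  by have [|_ -> _] := fg t Dt; [rewrite subrr normr0|exact: c1].
- move=> t Dt; have [d d0 [D' [g [g' [/C1_torus_curveP[_ c2 _ _] D't fg]]]]] := h t Dt.
  by have [|_ _ ->] := fg t Dt; [rewrite subrr normr0|exact: c2].
- move=> t Dt e e0; have [d d0 [D' [g [g' [/C1_torus_curveP[_ _ c3 _] D't fg]]]]] := h t Dt.
  have [|_ -> ->] := fg t Dt; first by rewrite subrr normr0.
  have [d' d'0 hd'] := c3 t D't e e0.
  exists (Num.min d d'); first by rewrite lt_min d0.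
  move=> s Ds; rewrite lt_min => /andP[sd sd'] x.
  by have [D's -> _] := fg s Ds sd; exact: hd'.
- move=> t Dt e e0; have [d d0 [D' [g [g' [/C1_torus_curveP[_ _ _ c4] D't fg]]]]] := h t Dt.
  have [|_ _ ->] := fg t Dt; first by rewrite subrr normr0.
  have [d' d'0 hd'] := c4 t D't e e0.
  exists (Num.min d d'); first by rewrite lt_min d0.
  move=> s Ds; rewrite lt_min => /andP[sd sd'] x.
  by have [D's _ ->] := fg s Ds sd; exact: hd'.
Qed.

Lemma ode_solution_global K gamma alpha phi phi1 phi2 A D eps (r0 u0 : R -> R) :
  0 <= K -> 1 < gamma <= 2 -> bump A D phi phi1 phi2 -> 0 < eps ->
  torus_continuous r0 -> torus_continuous u0 -> (forall x, 0 < r0 x) ->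
  exists r q, ode_solution K gamma alpha phi eps r0 u0 +oo%E r q.
Proof.
move=> K0 gamma12 bphi eps0 cr0 cu0 r0_gt0.
have /choice[S hS] : forall H : R, exists p : (R -> R -> R) * (R -> R -> R), 0 < H ->
    ode_solution K gamma alpha phi eps r0 u0 H%:E p.1 p.2.
  move=> H; have [H0|_] := ltP 0 H; last by exists ((fun _ _ => 0), (fun _ _ => 0)).
  have [r [q sol]] := ode_solution_horizon K gamma alpha _ _ _ _ _ _ _ _ H
    K0 gamma12 bphi eps0 cr0 cu0 r0_gt0 H0.
  by exists (r, q).
(* Each time reads its value from a solution whose horizon lies beyond it; by uniqueness any other
   such horizon gives the same value. *)
pose r t := (S (t + 1)).1 t; pose q t := (S (t + 1)).2 t.
have SE H t : 0 <= t < H -> r t = (S H).1 t /\ q t = (S H).2 t.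
  move=> /andP[t0 tH]; have H0 : 0 < H by exact: le_lt_trans tH.
  have t10 : 0 < t + 1 by rewrite ltr_wpDl.
  apply: (ode_solution_unique _ _ _ _ _ _ _ _ _ _ _ _ _ _ _ _ _ t K0 gamma12 bphi eps0
    cr0 cu0 r0_gt0 (hS _ t10) (hS _ H0)).
    by split => //; rewrite lte_fin ltrDl.
  by split => //; rewrite lte_fin.
have near t s : `|s - t| < 1 -> s < t + 2.
  by rewrite ltr_norml => /andP[_]; lra.
exists r, q; split.
(* The horizon in the definition of [r] varies with time; on the unit neighbourhood of [t] the
   single solution with horizon [t + 2] represents it. *)
- apply: C1_torus_curve_local => t [t0 _]; exists 1 => //.
  have t20 : 0 < t + 2 by rewrite ltr_wpDl.
  have [c1 _ _ _ _] := hS _ t20.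
  eexists; eexists; eexists; split; [exact: c1|by split => //; rewrite lte_fin ltrDl|].
  move=> s [s0 _] /near st.
  have [-> ->] := SE (t + 2) s ltac:(by rewrite s0).
  by split => //; split => //; rewrite lte_fin.
- apply: C1_torus_curve_local => t [t0 _]; exists 1 => //.
  have t20 : 0 < t + 2 by rewrite ltr_wpDl.
  have [_ c1 _ _ _] := hS _ t20.
  eexists; eexists; eexists; split; [exact: c1|by split => //; rewrite lte_fin ltrDl|].
  move=> s [s0 _] /near st.
  have [-> ->] := SE (t + 2) s ltac:(by rewrite s0).
  by split => //; split => //; rewrite lte_fin.
- move=> t [t0 _] x; have t10 : 0 < t + 1 by rewrite ltr_wpDl.
  have [_ _ c _ _] := hS _ t10; apply: c.
  by split => //; rewrite lte_fin ltrDl.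
- have t10 : 0 < 0 + 1 :> R by rewrite add0r.
  by have [_ _ _ c _] := hS _ t10; exact: c.
- have t10 : 0 < 0 + 1 :> R by rewrite add0r.
  by have [_ _ _ _ c] := hS _ t10; exact: c.
Qed.

End WellPosedness.

(** * Weak asymptotics *)

Section WeakEstimates.
Context {R : realType}.
Local Notation mu := (@lebesgue_measure R).
Implicit Types (f g h u w p : R -> R) (a b c d x y A D eps : R).

Lemma continuous_shift f c : continuous f -> continuous (fun x => f (x + c)).
Proof.
move=> cf; have := continuous_comp_affine f 1 c cf.
by under eq_fun do rewrite mul1r.
Qed.

Lemma continuous_funrpos f : continuous f -> continuous f^\+.
Proof. by move=> cf; apply: continuous_maxr => // ?; exact: cvg_cst. Qed.

Lemma continuous_funrneg f : continuous f -> continuous f^\-.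
Proof.
move=> cf; apply: continuous_maxr; last by move=> ?; exact: cvg_cst.
exact: continuous_opp.
Qed.

Lemma funrpos_sub_funrneg f x : f^\+ x - f^\- x = f x.
Proof. by have /(congr1 (fun h => h x)) := funrposBneg f. Qed.

(** After summation by parts the positive part of the flux meets a forward difference of [p] and the
    negative part a backward one. Their first-order terms add up to [w * u * p1], since the
    difference of the two parts is [w * u]; the remainders are weighted by their sum [|w * u|]. The
    margin 1 of the window contains the shifts by [eps]. *)
Lemma transport_weak_error A D p p1 p2 eps u w :
  bump A D p p1 p2 -> 0 < eps <= 1 -> continuous u -> continuous w ->
  `|\int[mu]_x (transport eps u w x * p x) - \int[mu]_x (w x * u x * p1 x)| <=
  eps * D * \int[mu]_(x in `[- (A + 1), A + 1]) `|w x * u x|.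
Proof.
move=> bp /andP[eps0 eps1] cu cw.
have A0 := bump_radius _ _ _ _ _ bp.
have cp := is_derive_continuous _ _ (bump_derive _ _ _ _ _ bp).
have cp1 := is_derive_continuous _ _ (bump_derive1 _ _ _ _ _ bp).
have D0 : 0 <= D := le_trans (normr_ge0 _) (bump_le _ _ _ _ _ bp 0).
pose a x := w x * u^\+ x; pose b x := w x * u^\- x.
have ca : continuous a by apply: continuous_mul => //; exact: continuous_funrpos.
have cb : continuous b by apply: continuous_mul => //; exact: continuous_funrneg.
have out x c : ~~ (- (A + 1) <= x <= A + 1) -> `|c| <= 1 -> A < `|x + c|.
  move=> xo c1; rewrite ltNge; apply/negP => xcA; move/negP: xo; apply.
  by move: c1 xcA; rewrite !ler_norml => /andP[? ?] /andP[? ?]; apply/andP; split; lra.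
have p0 x c : ~~ (- (A + 1) <= x <= A + 1) -> `|c| <= 1 -> p (x + c) = 0.
  by move=> xo c1; have [] := bump_support _ _ _ _ _ bp _ (out x c xo c1).
have p0' x : ~~ (- (A + 1) <= x <= A + 1) -> p x = 0.
  by move=> xo; rewrite -[x]addr0; apply: p0 => //; rewrite normr0.
have p10 x : ~~ (- (A + 1) <= x <= A + 1) -> p1 x = 0.
  move=> xo; have [] // := bump_support _ _ _ _ _ bp (x + 0).
    by apply: out => //; rewrite normr0.
  by rewrite addr0.
have ne c : c = eps \/ c = - eps -> `|c| <= 1.
  by case=> ->; rewrite ?normrN gtr0_norm.
have A1 : - (A + 1) <= A + 1 by lra.
have shiftE (k : R -> R) c : continuous k -> `|c| <= 1 ->
    \int[mu]_(x in `[- (A + 1), A + 1]) (k (x - c) * p x) =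
    \int[mu]_(x in `[- (A + 1), A + 1]) (k x * p (x + c)).
  move=> ck c1.
  rewrite -(@Rintegral_supportE _ (fun x => k (x - c) * p x)); last first.
    by move=> x /p0' ->; rewrite mulr0.
  rewrite -(@Rintegral_shift _ (fun x => k (x - c) * p x) (- (A + 1)) (A + 1) c)//.
  - rewrite (@Rintegral_supportE _ _ (- (A + 1)) (A + 1)); last first.
      by move=> x xo; rewrite p0// mulr0.
    by apply: eq_Rintegral => x _; rewrite addrK.
  - by apply: continuous_mul => //; exact: continuous_shift.
  - by move=> x /p0' ->; rewrite mulr0.
have c1 : continuous (fun x => a x * p (x + eps)).
  by apply: continuous_mul => //; exact: continuous_shift.
have c3 : continuous (fun x => b x * p (x - eps)).
  by apply: continuous_mul => //; exact: (continuous_shift _ (- eps)).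
have c2 : continuous (fun x => (a x + b x) * p x).
  by apply: continuous_mul => //; exact: continuous_add.
have c1' : continuous (fun x => a (x - eps) * p x).
  by apply: continuous_mul => //; exact: (continuous_shift _ (- eps)).
have c3' : continuous (fun x => b (x + eps) * p x).
  by apply: continuous_mul => //; exact: continuous_shift.
have -> : \int[mu]_x (transport eps u w x * p x) =
    \int[mu]_(x in `[- (A + 1), A + 1]) (eps^-1 *
      (a x * p (x + eps) - (a x + b x) * p x + b x * p (x - eps))).
  rewrite (@Rintegral_supportE _ _ (- (A + 1)) (A + 1)); last first.
    by move=> x /p0' ->; rewrite mulr0.
  rewrite Rintegral_segmentZ; last by apply: continuous_add => //; exact: continuous_sub.
  rewrite Rintegral_segmentD//; last exact: continuous_sub.
  rewrite Rintegral_segmentB//.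
  rewrite -(shiftE a eps)//; last by apply: ne; left.
  rewrite -(shiftE b (- eps))//; last by apply: ne; right.
  rewrite -Rintegral_segmentB//.
  under [X in _ = _ * (_ + X)]eq_Rintegral do rewrite opprK.
  rewrite -Rintegral_segmentD//; last exact: continuous_sub.
  rewrite -Rintegral_segmentZ; last by apply: continuous_add => //; exact: continuous_sub.
  apply: eq_Rintegral => x _; rewrite /transport normr_funrpos_funrneg /a /b; ring.
rewrite (@Rintegral_supportE _ (fun x => w x * u x * p1 x) (- (A + 1)) (A + 1)); last first.
  by move=> x /p10 ->; rewrite mulr0.
have c4 : continuous (fun x => eps^-1 *
      (a x * p (x + eps) - (a x + b x) * p x + b x * p (x - eps))).
  apply: continuous_mul; first by move=> ?; exact: cvg_cst.
  by apply: continuous_add => //; exact: continuous_sub.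
have c5 : continuous (fun x => w x * u x * p1 x).
  by apply: continuous_mul => //; exact: continuous_mul.
have c6 : continuous (fun x => `|w x * u x|).
  by apply: continuous_norm; exact: continuous_mul.
rewrite -Rintegral_segmentB// -Rintegral_segmentZ//.
apply: norm_Rintegral_segment_le.
- exact: continuous_sub.
- by apply: continuous_mul => // ?; exact: cvg_cst.
move=> x _.
have -> : eps^-1 * (a x * p (x + eps) - (a x + b x) * p x + b x * p (x - eps)) -
    w x * u x * p1 x =
  eps^-1 * (a x * (p (x + eps) - p x - eps * p1 x) +
            b x * (p (x + - eps) - p x - (- eps) * p1 x)).
  rewrite -[in X in _ - w x * X * _](funrpos_sub_funrneg u x) /a /b.
  by move: (u^\+ x) (u^\- x) => v1 v2; field; rewrite gt_eqF.
have -> : eps * D * `|w x * u x| = eps^-1 * (`|a x| * (D * eps ^+ 2) + `|b x| * (D * eps ^+ 2)).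
  rewrite normrM (normr_funrpos_funrneg u x) /a /b !normrM.
  rewrite (ger0_norm (funrpos_ge0 _ _)) (ger0_norm (funrneg_ge0 _ _)).
  by move: (u^\+ x) (u^\- x) => v1 v2;  field; rewrite gt_eqF.
rewrite normrM gtr0_norm ?invr_gt0// ler_wpM2l ?invr_ge0 ?(ltW eps0)//.
have ee : eps ^+ 2 = `|eps| ^+ 2 by rewrite gtr0_norm.
have ee' : eps ^+ 2 = `|- eps| ^+ 2 by rewrite normrN gtr0_norm.
apply: le_trans (ler_normD _ _) (lerD _ _); rewrite normrM ler_wpM2l//.
  rewrite ee; exact: derivative_taylor (bump_derive _ _ _ _ _ bp)
    (bump_derive1 _ _ _ _ _ bp) (bump2_le _ _ _ _ _ bp).
rewrite ee'; exact: derivative_taylor (bump_derive _ _ _ _ _ bp)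
    (bump_derive1 _ _ _ _ _ bp) (bump2_le _ _ _ _ _ bp).
Qed.

Lemma continuous_support_integrable f a b : continuous f ->
  (forall x, ~~ (a <= x <= b) -> f x = 0) ->
  mu.-integrable setT (EFin \o f).
Proof.
move=> cf f0.
have := (@integrable_mkcond _ (measurableTypeR R) R mu `[a, b] (EFin \o f)
  (measurable_itv `[a, b])).1
  (continuous_integrable_segment f a b cf).
congr (mu.-integrable setT _); apply/funext => x; rewrite patchE; case: ifPn => //.
by rewrite notin_setE/= in_itv/= => /negP/f0 ->.
Qed.

(** Integrability on the product comes from boundedness on a rectangle; continuity of the sections
    makes the inner integrals finite, so that Fubini's theorem for extended reals descends to real
    integrals. *)
Lemma Fubini_compact_support (F : R -> R -> R) a b c d M :
  measurable_fun setT (fun z : measurableTypeR R * measurableTypeR R => F z.1 z.2) ->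
  (forall x, continuous (F x)) -> (forall y, continuous (F ^~ y)) ->
  (forall x y, `|F x y| <= M) ->
  (forall x y, ~~ (a <= x <= b) -> F x y = 0) ->
  (forall x y, ~~ (c <= y <= d) -> F x y = 0) ->
  \int[mu]_x \int[mu]_y F x y = \int[mu]_y \int[mu]_x F x y.
Proof.
move=> mF cF1 cF2 FM F0 F0'.
pose Fp (z : measurableTypeR R * measurableTypeR R) := F z.1 z.2.
have iF : (mu \x mu)%E.-integrable setT (EFin \o Fp).
  have mab : measurable
      (`[a, b] `*` `[c, d] : set (measurableTypeR R * measurableTypeR R)).
    exact: measurableX.
  have fin : ((mu \x mu)%E (`[a, b] `*` `[c, d]) < +oo)%E.
    rewrite product_measure1E//= !lebesgue_measure_itv/=.
    by case: ifP => _; case: ifP => _; rewrite ?mule0 ?mul0e// -!EFinD -EFinM ltry.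
  have := @measurable_bounded_integrable _ _ _ (mu \x mu)%E
    Fp _ mab fin (measurable_funTS mF).
  move=> h; have {}h : (mu \x mu)%E.-integrable (`[a, b] `*` `[c, d])
      (EFin \o Fp).
    apply: h; exists M; split; first exact: num_real.
    by move=> M' MM' z _ /=; apply: le_trans (FM _ _) (ltW MM').
  have := (@integrable_mkcond _ _ R (mu \x mu)%E _ (EFin \o Fp) mab).1 h.
  congr (_.-integrable setT _); apply/funext => -[x y]; rewrite patchE; case: ifPn => //.
  rewrite notin_setE/= => /not_andP[]; rewrite /= in_itv/= => /negP.
    by move=> /F0 Fxy; rewrite /Fp/= Fxy.
  by move=> /F0' Fxy; rewrite /Fp/= Fxy.
have i1 x : mu.-integrable setT (EFin \o F x).
  by apply: (continuous_support_integrable _ c d) => // y; exact: F0'.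
have i2 y : mu.-integrable setT (EFin \o F ^~ y).
  by apply: (continuous_support_integrable _ a b) => // x; exact: F0.
have := Fubini iF; rewrite /= => Fub.
rewrite /Rintegral; congr fine.
transitivity (\int[mu]_x \int[mu]_y (F x y)%:E)%E.
  apply: eq_integral => x _; rewrite fineK//.
  by apply: integrable_fin_num => //; exact: i1.
rewrite Fub; apply: eq_integral => y _; rewrite fineK//.
by apply: integrable_fin_num => //; exact: i2.
Qed.

Lemma measurable_convolution_kernel h g p : continuous h -> continuous g ->
  continuous p ->
  measurable_fun setT (fun z : measurableTypeR R * measurableTypeR R =>
    (h (z.1 - z.2) - h z.1) * g z.2 * p z.1).
Proof.
move=> ch cg cp.
have m1 : measurable_fun setT
    (fst : measurableTypeR R * measurableTypeR R -> measurableTypeR R).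
  exact: measurable_fst.
have m2 : measurable_fun setT
    (snd : measurableTypeR R * measurableTypeR R -> measurableTypeR R).
  exact: measurable_snd.
apply: measurable_funM; last first.
  by apply: (measurableT_comp (continuous_measurable_fun cp) m1).
apply: measurable_funM; last first.
  by apply: (measurableT_comp (continuous_measurable_fun cg) m2).
apply: measurable_funB; last first.
  by apply: (measurableT_comp (continuous_measurable_fun ch) m1).
apply: (measurableT_comp (continuous_measurable_fun ch)).
exact: measurable_funB.
Qed.

(* Moving the convolution onto the test function: the error is
   [\int g(y) (\int h(x) (p(x + y) - p(x)) dx) dy]. *)
Lemma convolution_weak_error A D g g1 g2 A' D' p p1 p2 h :
  bump A D g g1 g2 -> bump A' D' p p1 p2 -> torus_continuous h ->
  (forall x, 0 <= h x) -> (forall x, 0 <= g x) ->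
  \int[mu]_(y in `[- A, A]) g y = 1 ->
  `|\int[mu]_x ((convolution h g x - h x) * p x)| <=
  D' * A * \int[mu]_(x in `[- (A + A'), A + A']) h x.
Proof.
move=> bg bp th h0 g_ge0 g1_int.
have [_ ch] := th.
have A0 := bump_radius _ _ _ _ _ bg; have A'0 := bump_radius _ _ _ _ _ bp.
have cg := is_derive_continuous _ _ (bump_derive _ _ _ _ _ bg).
have cp := is_derive_continuous _ _ (bump_derive _ _ _ _ _ bp).
have D0 : 0 <= D := le_trans (normr_ge0 _) (bump_le _ _ _ _ _ bg 0).
have D'0 : 0 <= D' := le_trans (normr_ge0 _) (bump_le _ _ _ _ _ bp 0).
have g0 y : ~~ (- A <= y <= A) -> g y = 0.
  by rewrite -ler_norml -ltNge => /(bump_support _ _ _ _ _ bg)[].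
have p0 x : ~~ (- A' <= x <= A') -> p x = 0.
  by rewrite -ler_norml -ltNge => /(bump_support _ _ _ _ _ bp)[].
have [H H0 hH] := torus_bounded _ th.
have chx x : continuous (fun y => h (x - y)).
  have := continuous_comp_affine h (- 1) x ch.
  by under eq_fun do rewrite mulN1r addrC.
(* As [g] has integral 1, the term [h x] can be brought under the convolution integral. *)
pose F x y := (h (x - y) - h x) * g y * p x.
have cF1 x : continuous (F x).
  apply: continuous_mul; last by move=> ?; exact: cvg_cst.
  apply: continuous_mul => //; apply: continuous_sub => //.
  by move=> ?; exact: cvg_cst.
have cF2 y : continuous (F ^~ y).
  apply: continuous_mul => //; apply: continuous_mul; last by move=> ?; exact: cvg_cst.
  apply: continuous_sub => //; exact: (continuous_shift _ (- y)).
have E1 x : (convolution h g x - h x) * p x = \int[mu]_y F x y.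
  rewrite (@Rintegral_supportE _ (F x) (- A) A); last first.
    by move=> y /g0; rewrite /F => ->; rewrite mulr0 mul0r.
  have cI : continuous (fun y => h (x - y) * g y) by exact: continuous_mul.
  have cJ : continuous (fun y => h x * g y).
    by apply: continuous_mul => // ?; exact: cvg_cst.
  transitivity (\int[mu]_(y in `[- A, A]) (p x * (h (x - y) * g y - h x * g y))).
    rewrite Rintegral_segmentZ; last exact: continuous_sub.
    rewrite Rintegral_segmentB// Rintegral_segmentZ// g1_int mulr1 mulrC.
    congr (_ * (_ - _)); apply: Rintegral_supportE => y /g0 ->.
    by rewrite mulr0.
  by apply: eq_Rintegral => y _; rewrite /F; ring.
under eq_Rintegral do rewrite E1.
rewrite (@Fubini_compact_support F (- A') A' (- A) A ((H + H) * D * D')); last 6 first.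
- exact: measurable_convolution_kernel.
- exact: cF1.
- exact: cF2.
- move=> x y; rewrite /F !normrM ler_pM//; last exact: (bump_le _ _ _ _ _ bp).
  rewrite ler_pM//; last exact: (bump_le _ _ _ _ _ bg).
  by apply: le_trans (ler_normB _ _) _; rewrite lerD.
- by move=> x y /p0; rewrite /F => ->; rewrite mulr0.
- by move=> x y /g0; rewrite /F => ->; rewrite mulr0 mul0r.
pose W := A + A'.
have W0 : - W <= W by rewrite /W; lra.
(* [k] is the effect of translating the test function by [y]: it vanishes at 0 and is Lipschitz with
   constant [D'] times the integral of [h], while [g] sees only [|y| <= A]. The window contains the
   supports of [p] and of all these translates. *)
pose k y := \int[mu]_(x in `[- W, W]) (h x * (p (x + y) - p x)).
have cint y : continuous (fun x => h x * (p (x + y) - p x)).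
  apply: continuous_mul => //; apply: continuous_sub => //.
  exact: continuous_shift.
have plip x y : `|p x - p y| <= D' * `|x - y|.
  exact: derivative_bound_lipschitz _ _ _ x y (bump_derive _ _ _ _ _ bp)
    (bump1_le _ _ _ _ _ bp).
set I := \int[mu]_(x in `[- W, W]) h x.
have I0 : 0 <= I by apply: Rintegral_ge0 => x _; exact: h0.
have klip y y' : `|k y - k y'| <= D' * I * `|y - y'|.
  rewrite /k -Rintegral_segmentB//.
  have -> : D' * I * `|y - y'| =
      \int[mu]_(x in `[- W, W]) (D' * `|y - y'| * h x).
    by rewrite Rintegral_segmentZ// /I; ring.
  apply: norm_Rintegral_segment_le.
  - by apply: continuous_sub; exact: cint.
  - by apply: continuous_mul => // ?; exact: cvg_cst.
  move=> x _.
  have -> : h x * (p (x + y) - p x) - h x * (p (x + y') - p x) =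
    h x * (p (x + y) - p (x + y')) by ring.
  rewrite normrM ger0_norm// mulrC ler_wpM2r//.
  by apply: le_trans (plip _ _) _; rewrite opprD addrACA subrr add0r.
have ck : continuous k.
  move=> y; apply/cvgrPdist_le => e e0; apply/nbhs_ballP.
  exists (e / (D' * I + 1)); first by rewrite /= divr_gt0// ltr_wpDl// mulr_ge0.
  move=> z; rewrite /ball/= ltr_pdivlMr ?ltr_wpDl ?mulr_ge0// => yz.
  apply: le_trans (klip _ _) _; have := normr_ge0 (y - z); nra.
have E2 y : \int[mu]_x F x y = g y * k y.
  have [yA|yA] := boolP (- A <= y <= A); last first.
    rewrite g0// mul0r (@Rintegral_supportE _ (F ^~ y) 0 0).
      by rewrite set_itv1 Rintegral_set1.
    by move=> x _; rewrite /F g0// mulr0 mul0r.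
  have cs : continuous (fun x => h (x - y) * p x).
    by apply: continuous_mul => //; exact: (continuous_shift _ (- y)).
  have cs' : continuous (fun x => h x * p x) by exact: continuous_mul.
  have cs2 : continuous (fun x => h x * p (x + y)).
    by apply: continuous_mul => //; exact: continuous_shift.
  have pW x : ~~ (- W <= x <= W) -> p x = 0.
    move=> xW; apply: p0; apply/negP => xA; move/negP: xW; apply.
    by move: xA => /andP[? ?]; apply/andP; split; rewrite /W; lra.
  have pWy x : ~~ (- W <= x <= W) -> p (x + y) = 0.
    move=> xW; apply: p0; apply/negP => xA; move/negP: xW; apply.
    by move: xA yA => /andP[? ?] /andP[? ?]; apply/andP; split; rewrite /W; lra.
  have Esh : \int[mu]_(x in `[- W, W]) (h (x - y) * p x) =
      \int[mu]_(x in `[- W, W]) (h x * p (x + y)).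
    rewrite -(@Rintegral_supportE _ (fun x => h (x - y) * p x)); last first.
      by move=> x /pW ->; rewrite mulr0.
    rewrite -(@Rintegral_shift _ (fun x => h (x - y) * p x) (- W) W y)//; last first.
      by move=> x /pW ->; rewrite mulr0.
    rewrite (@Rintegral_supportE _ _ (- W) W); last first.
      by move=> x /pWy ->; rewrite mulr0.
    by apply: eq_Rintegral => x _; rewrite addrK.
  rewrite (@Rintegral_supportE _ (F ^~ y) (- W) W); last first.
    by move=> x /pW; rewrite /F => ->; rewrite mulr0.
  transitivity (\int[mu]_(x in `[- W, W]) (g y * (h (x - y) * p x - h x * p x))).
    by apply: eq_Rintegral => x _; rewrite /F; ring.
  rewrite Rintegral_segmentZ; last exact: continuous_sub.
  rewrite Rintegral_segmentB// Esh -Rintegral_segmentB//; congr (_ * _).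
  by apply: eq_Rintegral => x _; ring.
under eq_Rintegral do rewrite E2.
rewrite (@Rintegral_supportE _ _ (- A) A); last by move=> y /g0 ->; rewrite mul0r.
have -> : D' * A * I = \int[mu]_(y in `[- A, A]) (D' * A * I * g y).
  by rewrite Rintegral_segmentZ// g1_int mulr1.
apply: norm_Rintegral_segment_le.
- exact: continuous_mul.
- by apply: continuous_mul => // ?; exact: cvg_cst.
move=> y yA; rewrite normrM ger0_norm// mulrC ler_wpM2r//.
have k0 : k 0 = 0.
  rewrite /k; under eq_Rintegral do rewrite addr0 subrr mulr0.
  by rewrite Rintegral_segment_cst// mul0r.
have := klip y 0; rewrite k0 !subr0 => /le_trans; apply.
rewrite mulrAC; apply: ler_wpM2r => //; apply: ler_wpM2l => //.
by rewrite ler_norml.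
Qed.

End WeakEstimates.

(** * Rates in eps for the three weak relations *)

Section WeakErrorBounds.
Context {R : realType}.
Local Notation mu := (@lebesgue_measure R).
Implicit Types (K gamma alpha eps A D M U x t : R) (phi psi : R -> R).

Lemma mul_inv_powR4 alpha eps : 0 < eps ->
  eps * (eps `^ alpha)^-1 ^+ 4 = eps `^ (1 - 4 * alpha).
Proof.
move=> eps0; rewrite powRB ?(gt_eqF eps0) ?implybT// powRr1 ?(ltW eps0)//.
congr (_ * _); rewrite exprVn; congr (_^-1).
by rewrite mulrC powRrM powR_mulrn ?powR_ge0.
Qed.

(** [C] is chosen before [eps] and the initial data, which enter only through [M] and [U]; this
    uniformity lets the data vary with [eps]. *)
Lemma weak_error_bounds K gamma alpha phi phi1 phi2 A D psi psi1 psi2 A' D' M U t :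
  0 <= K -> 1 < gamma <= 2 -> 0 < alpha -> bump A D phi phi1 phi2 ->
  bump A' D' psi psi1 psi2 -> (forall x, 0 <= phi x) -> \int[mu]_x phi x = 1 ->
  0 < t -> 0 <= M -> 0 <= U ->
  exists C : R, forall eps (r0 u0 : R -> R) (r q : R -> R -> R), 0 < eps <= 1 ->
    \int[mu]_(x in `[0, pi *+ 2]) r0 x <= M -> (forall x, `|u0 x| <= U) ->
    ode_solution K gamma alpha phi eps r0 u0 +oo%E r q ->
    [/\ `|\int[mu]_x (derive1 (fun s => r s x) t * psi x) -
          \int[mu]_x (q t x * psi1 x)| <= C * eps `^ (1 - 4 * alpha),
        `|\int[mu]_x (derive1 (fun s => q s x) t * psi x) -
          \int[mu]_x (r t x * velocity (r t) (q t) x ^+ 2 * psi1 x) +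
          \int[mu]_x (r t x * derive1 (potential K gamma alpha phi eps (r t)) x * psi x)|
          <= C * eps `^ (1 - 4 * alpha) &
        `|\int[mu]_x ((potential K gamma alpha phi eps (r t) x -
            K * gamma / (gamma - 1) * r t x `^ (gamma - 1)) * psi x)|
          <= C * eps `^ alpha].
Proof.
move=> K0 gamma12 alpha0 bphi bpsi phi_ge0 phi_int t0 M0 U0.
have A0 := bump_radius _ _ _ _ _ bphi; have A'0 := bump_radius _ _ _ _ _ bpsi.
have D0 : 0 <= D := le_trans (normr_ge0 _) (bump_le _ _ _ _ _ bphi 0).
have D'0 : 0 <= D' := le_trans (normr_ge0 _) (bump_le _ _ _ _ _ bpsi 0).
have cphi := is_derive_continuous _ _ (bump_derive _ _ _ _ _ bphi).
have cpsi := is_derive_continuous _ _ (bump_derive _ _ _ _ _ bpsi).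
have cpsi1 := is_derive_continuous _ _ (bump_derive1 _ _ _ _ _ bpsi).
have psi0 x : ~~ (- A' <= x <= A') -> psi x = 0.
  by rewrite -ler_norml -ltNge => /(bump_support _ _ _ _ _ bpsi)[].
have phi0 x : ~~ (- A <= x <= A) -> phi x = 0.
  by rewrite -ler_norml -ltNge => /(bump_support _ _ _ _ _ bphi)[].
have c0 : 0 <= K * gamma / (gamma - 1).
  by case/andP: gamma12 => g1 g2; rewrite divr_ge0 ?mulr_ge0//; lra.
set c := K * gamma / (gamma - 1) in c0 *.
(* One number of periods covers all windows met below, for every [eps <= 1]: the support of the
   kernel, that of [psi] widened by 1, and the sum of both supports. *)
have [N hN] := exists_period_multiple (2 * (A + A' + 1)).
have P0 := @pi2_gt0 R.
have MN0 : 0 <= M *+ N by exact: mulrn_wge0.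
pose F := c * (D * (2 * A + M *+ N)).
have F0 : 0 <= F.
  apply: mulr_ge0 => //; apply: mulr_ge0 => //.
  by apply: addr_ge0 => //; apply: mulr_ge0 => //; exact: ltW.
(* The velocity is at most U + F t s^(-2) with [s] the mollification scale; since [s <= 1], this is
   at most V s^(-2). *)
pose V := U + F * t.
have V0 : 0 <= V by rewrite addr_ge0// mulr_ge0// ltW.
pose C1 := D' * V * (M *+ N); pose C2 := D' * V ^+ 2 * (M *+ N).
pose C3 := c * (D' * A * (2 * (A + A') + M *+ N)).
have C10 : 0 <= C1 by apply: mulr_ge0 => //; exact: mulr_ge0.
have C20 : 0 <= C2 by apply: mulr_ge0 => //; apply: mulr_ge0 => //; exact: exprn_ge0.
have C30 : 0 <= C3.
  apply: mulr_ge0 => //; apply: mulr_ge0; first by apply: mulr_ge0 => //; exact: ltW.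
  by apply: addr_ge0 => //; apply: mulr_ge0 => //; apply: addr_ge0; exact: ltW.
exists (C1 + C2 + C3) => eps r0 u0 r q eps01 r0M u0U sol.
have /andP[eps0 eps1] := eps01.
set s := eps `^ alpha.
have s0 : 0 < s := powR_gt0 alpha eps0.
have s1 : s <= 1.
  by rewrite -(powRr0 eps); apply: ger_powR; [rewrite eps0|exact: ltW].
have is1 : 1 <= s^-1 by rewrite invf_ge1.
have is0 : 0 <= s^-1 by rewrite invr_ge0 ltW.
have Tt x : 0 <= x -> time_interval +oo%E x by move=> x0; split; rewrite ?ltry.
have tT := Tt t (ltW t0).
have [cr cq _ _] := ode_solution_curves sol.
have [_ _ r_gt0 _ _] := sol.
have rt0 := r_gt0 t tT; have crt := cr t tT; have cqt := cq t tT.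
have [prt crt'] := crt; have [pqt cqt'] := cqt.
have mass x : time_interval +oo%E x -> \int[mu]_(y in `[0, pi *+ 2]) r x y <= M.
  by move=> Tx; rewrite (ode_solution_mass _ _ _ _ _ _ _ _ _ _ x sol Tx).
have sA : s * A <= A by rewrite ger_pMl.
have force x y : time_interval +oo%E x ->
    `|derive1 (potential K gamma alpha phi eps (r x)) y| <= F * s^-1 ^+ 2.
  move=> Tx.
  have h := force_le K gamma alpha _ _ _ _ _ _ (r x) y N K0 gamma12 bphi eps0
    (cr x Tx) (r_gt0 x Tx) ltac:(rewrite -/s; move: sA hN A0 A'0; lra).
  apply: le_trans h _; rewrite -/s -/c.
  have -> : F * s^-1 ^+ 2 = c * (s^-1 ^+ 2 * D * (2 * A + M *+ N)).
    by rewrite /F; ring.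
  apply: ler_wpM2l => //; apply: ler_wpM2l.
    by apply: mulr_ge0 => //; exact: exprn_ge0.
  apply: lerD; first by rewrite ler_pM2l.
  by rewrite lerMn2r; apply/orP; right; exact: mass.
have uV y : `|velocity (r t) (q t) y| <= V * s^-1 ^+ 2.
  apply: le_trans (velocity_bound _ _ _ _ _ _ _ _ _ _ _ _ eps0 sol u0U force t y tT) _.
  rewrite /V mulrDl; apply: lerD; last by rewrite mulrAC.
  by rewrite ler_peMr// exprn_ege1.
set u := velocity (r t) (q t) in uV *.
have cu : torus_continuous u by exact: torus_continuous_velocity.
have [_ cu'] := cu.
have qE x : q t x = r t x * u x by rewrite /u /velocity mulrC divfK// gt_eqF.
have window : \int[mu]_(x in `[- (A' + 1), A' + 1]) r t x <= M *+ N.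
  apply: (@le_trans _ _ ((\int[mu]_(y in `[0, pi *+ 2]) r t y) *+ N)); last first.
    by rewrite lerMn2r mass ?orbT.
  apply: le_Rintegral_periodic => //; [exact: ltW|by move=> ?; exact: ltW|lra|].
  by move: hN; lra.
have w4 : eps * s^-1 ^+ 4 = eps `^ (1 - 4 * alpha) := mul_inv_powR4 alpha eps eps0.
(* Used with [w = r], where [B] is the velocity bound, and with [w = q], where it is the square of
   that bound; the integral left over is the mass in both cases. *)
have fluxbound (w : R -> R) (B : R) : continuous w -> 0 <= B ->
    (forall x, `|w x * u x| <= B * r t x) ->
    `|\int[mu]_x (transport eps u w x * psi x) - \int[mu]_x (w x * u x * psi1 x)| <=
    eps * D' * (B * (M *+ N)).
  move=> cw B0 wB.
  apply: le_trans (transport_weak_error _ _ _ _ _ _ _ _ bpsi eps01 cu' cw) _.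
  apply: ler_wpM2l; first by apply: mulr_ge0 => //; exact: ltW.
  apply: (@le_trans _ _ (B * \int[mu]_(x in `[- (A' + 1), A' + 1]) r t x)); last first.
    exact: ler_wpM2l.
  rewrite -Rintegral_segmentZ//; apply: le_Rintegral_segment.
  - by apply: continuous_norm; exact: continuous_mul.
  - by apply: continuous_mul => // ?; exact: cvg_cst.
  - by move=> x _; exact: wB.
have drt x : derive1 (fun s => r s x) t = transport eps u (r t) x.
  rewrite derive1E.
  by have [[_ ->] _] := ode_solution_is_derive _ _ _ _ _ _ _ _ _ _ t x sol t0 (ltry t).
have dqt x : derive1 (fun s => q s x) t = transport eps u (q t) x -
    r t x * derive1 (potential K gamma alpha phi eps (r t)) x.
  rewrite derive1E.
  by have [_ [_ ->]] := ode_solution_is_derive _ _ _ _ _ _ _ _ _ _ t x sol t0 (ltry t).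
have p4 : 0 <= eps `^ (1 - 4 * alpha) by exact: powR_ge0.
split.
- under eq_Rintegral do rewrite drt.
  under [X in _ - X]eq_Rintegral do rewrite qE.
  apply: le_trans (fluxbound (r t) (V * s^-1 ^+ 2) crt' _ _) _.
  + by apply: mulr_ge0 => //; exact: exprn_ge0.
  + move=> x; rewrite normrM (gtr0_norm (rt0 x)) [leRHS]mulrC; apply: ler_wpM2l => //.
    exact: ltW.
  rewrite -w4.
  (* The density flux is linear in [u] and has the better rate eps^(1 - 2 alpha); it is weakened to
     the common rate of the momentum flux. *)
  have -> : eps * D' * (V * s^-1 ^+ 2 * (M *+ N)) = C1 * (eps * s^-1 ^+ 2).
    by rewrite /C1; ring.
  apply: ler_pM => //.
  + by apply: mulr_ge0; [exact: ltW|exact: exprn_ge0].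
  + by rewrite -addrA lerDl addr_ge0.
  + by apply: ler_wpM2l; [exact: ltW|exact: ler_weXn2l].
- under eq_Rintegral do rewrite dqt.
  have cF : continuous (derive1 (potential K gamma alpha phi eps (r t))).
    exact: (torus_continuous_force _ _ _ _ _ _ _ _ _ _ bphi eps0 crt rt0).2.
  have c1 : continuous (fun x => transport eps u (q t) x * psi x).
    by apply: continuous_mul => //; exact: (torus_continuous_transport eps _ _ cu cqt).2.
  have c2 : continuous (fun x => r t x *
      derive1 (potential K gamma alpha phi eps (r t)) x * psi x).
    by apply: continuous_mul => //; exact: continuous_mul.
  have -> : \int[mu]_x ((transport eps u (q t) x -
      r t x * derive1 (potential K gamma alpha phi eps (r t)) x) * psi x) =
    \int[mu]_x (transport eps u (q t) x * psi x) -
    \int[mu]_x (r t x * derive1 (potential K gamma alpha phi eps (r t)) x * psi x).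
    rewrite -RintegralB//.
    - by apply: eq_Rintegral => x _; rewrite mulrBl.
    - by apply: (continuous_support_integrable _ (- A') A') => // x /psi0 ->; rewrite mulr0.
    - by apply: (continuous_support_integrable _ (- A') A') => // x /psi0 ->; rewrite mulr0.
  rewrite addrAC subrK.
  have -> : \int[mu]_x (r t x * u x ^+ 2 * psi1 x) = \int[mu]_x (q t x * u x * psi1 x).
    by apply: eq_Rintegral => x _; rewrite qE expr2 mulrA.
  apply: le_trans (fluxbound (q t) ((V * s^-1 ^+ 2) ^+ 2) cqt' _ _) _.
  + by apply: exprn_ge0; apply: mulr_ge0 => //; exact: exprn_ge0.
  + move=> x; rewrite qE -mulrA -expr2 normrM (gtr0_norm (rt0 x)) [leRHS]mulrC.
    apply: ler_wpM2l.
      exact: ltW.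
    by rewrite normrX ler_pXn2r// nnegrE// mulr_ge0// exprn_ge0.
  rewrite -w4.
  have -> : eps * D' * ((V * s^-1 ^+ 2) ^+ 2 * (M *+ N)) = C2 * (eps * s^-1 ^+ 4).
    by rewrite /C2; ring.
  apply: ler_wpM2r; first by apply: mulr_ge0; [exact: ltW|exact: exprn_ge0].
  by rewrite addrAC lerDr addr_ge0.
- have bm := bump_mollifier _ _ _ _ _ s s0 bphi.
  have th := torus_continuous_powR _ (gamma - 1) rt0 crt.
  have [ph ch] := th.
  set h := fun x => r t x `^ (gamma - 1) in th ph ch *.
  have h0 x : 0 <= h x by exact: powR_ge0.
  have conv_cont := is_derive_continuous _ _
    (fun x => is_derive_convolution _ _ _ _ _ h x bm ch).
  have ci : continuous (fun x => (convolution h (mollifier phi s) x - h x) * psi x).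
    by apply: continuous_mul => //; exact: continuous_sub.
  have -> : \int[mu]_x ((potential K gamma alpha phi eps (r t) x - c * h x) * psi x) =
      c * \int[mu]_x ((convolution h (mollifier phi s) x - h x) * psi x).
    rewrite -RintegralZl//; last first.
      by apply: (continuous_support_integrable _ (- A') A') => // x /psi0 ->; rewrite mulr0.
    by apply: eq_Rintegral => x _; rewrite /potential -/c -/s -/h; ring.
  rewrite normrM ger0_norm//.
  apply: (@le_trans _ _ (C3 * s)); last first.
    by apply: ler_wpM2r; [exact: ltW|rewrite lerDr addr_ge0].
  rewrite /C3 -mulrA; apply: ler_wpM2l => //.
  have m_int : \int[mu]_(y in `[- (s * A), s * A]) mollifier phi s y = 1.
    rewrite -mulrN Rintegral_segment_scale//; last lra.
    by rewrite -(@Rintegral_supportE _ phi (- A) A).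
  apply: le_trans (convolution_weak_error _ _ _ _ _ _ _ _ _ _ h bm bpsi th h0 _ m_int) _.
    by move=> x; rewrite /mollifier mulr_ge0.
  have -> : D' * A * (2 * (A + A') + M *+ N) * s = D' * (s * A) * (2 * (A + A') + M *+ N).
    by ring.
  apply: ler_wpM2l; first by apply: mulr_ge0 => //; apply: mulr_ge0; exact: ltW.
  set W := s * A + A'.
  have W0 : 0 < W by rewrite addr_gt0// mulr_gt0.
  have WA : W <= A + A' by rewrite lerD2r.
  apply: (@le_trans _ _ (\int[mu]_(x in `[- W, W]) (1 + r t x))).
    apply: le_Rintegral_segment => //.
      by apply: continuous_add => // ?; exact: cvg_cst.
    move=> x _; apply: powR_le_1D => //.
    by case/andP: gamma12 => *; apply/andP; split; lra.
  rewrite Rintegral_segmentD//; last by move=> ?; exact: cvg_cst.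
  apply: lerD; first by rewrite Rintegral_segment_cst; lra.
  apply: (@le_trans _ _ ((\int[mu]_(y in `[0, pi *+ 2]) r t y) *+ N)); last first.
    by rewrite lerMn2r mass ?orbT.
  apply: le_Rintegral_periodic => //; [exact: ltW|by move=> ?; exact: ltW|lra|].
  by move: hN; lra.
Qed.

End WeakErrorBounds.

(** * Uniform bounds from the convergence of the initial data *)

Section InitialData.
Context {R : realType}.
Local Notation mu := (@lebesgue_measure R).
Implicit Types (f g : R -> R) (C M : R).

Lemma ball_measure_gt0 (x e : R) : 0 < e -> (0 < mu (ball x e))%E.
Proof.
move=> e0; rewrite lebesgue_measure_ball ?ltW// lte_fin.
by rewrite pmulrn_lgt0.
Qed.

Lemma torus_Linfty_norm_ae_le f C : (torus_Linfty_norm f <= C%:E)%E ->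
  {ae mu, forall x, `|f x| <= C}.
Proof.
rewrite /torus_Linfty_norm unlock.
have -> : (0 < mu setT)%E.
  apply: lt_le_trans (ball_measure_gt0 0 1 ltr01) _.
  by apply: le_measure; rewrite ?inE//; exact: measurable_ball.
move=> /ess_supP; apply: filterS => x /=.
by rewrite lee_fin.
Qed.

(** The set where [|f|] exceeds [C] is open, and every ball has positive measure. *)
Lemma continuous_ae_le f C : continuous f -> {ae mu, forall x, `|f x| <= C} ->
  forall x, `|f x| <= C.
Proof.
move=> cf [N [mN N0 sub]] x; rewrite leNgt; apply/negP => xC.
have := continuous_norm f cf x => /cvgr_gt/(_ _ xC)/nbhs_ballP[e /= e0 he].
have bN : ball x e `<=` N by move=> y /he fy; apply: sub => /=; rewrite leNgt fy.
have := ball_measure_gt0 x e e0; apply/negP; rewrite -leNgt -N0.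
by apply: le_measure; rewrite ?inE//; exact: measurable_ball.
Qed.

(** Closeness in the essential supremum yields only an almost everywhere bound; continuity of the
    approximations upgrades it to every point, as the maximum principle requires at time 0. *)
Lemma torus_Linfty_approx_bounded (u0 : R -> R) (u0e : R -> R -> R) :
  torus_Linfty u0 -> (forall eps, 0 < eps -> torus_continuous (u0e eps)) ->
  torus_Linfty_norm (fun x => u0 x - u0e eps x) @[eps --> 0^'+] --> 0%E ->
  exists2 U, 0 <= U & \forall eps \near 0^'+, forall x, `|u0e eps x| <= U.
Proof.
move=> [_ _ u0oo] cu lim.
have u0fin : torus_Linfty_norm u0 \is a fin_num.
  by rewrite ge0_fin_numE// /torus_Linfty_norm Lnorm_ge0.
pose C := fine (torus_Linfty_norm u0).
have C0 : 0 <= C by apply: fine_ge0; exact: Lnorm_ge0.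
exists (C + 1); first by rewrite addr_ge0.
have near1 : \forall eps \near 0^'+, (torus_Linfty_norm (fun x => (u0 x - u0e eps x)%R) < 1%:E)%E.
  by apply: (lim [set y | (y < 1%:E)%E]); apply: open_ereal_lt'; rewrite lte_fin.
have u0C : {ae mu, forall x, `|u0 x| <= C}.
  by apply: torus_Linfty_norm_ae_le; rewrite fineK.
near=> eps.
have eps0 : 0 < eps by near: eps; exact: nbhs_right_gt.
apply: continuous_ae_le; first exact: (cu eps eps0).2.
have d1 : {ae mu, forall x, `|u0 x - u0e eps x| <= 1}.
  apply: torus_Linfty_norm_ae_le; apply: ltW; near: eps; exact: near1.
have := @filterS2 _ _ (ae_filter_ringOfSetsType mu) _ _ _ _ u0C d1; apply => x h1 h2.
have -> : u0e eps x = u0 x - (u0 x - u0e eps x) by ring.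
by apply: le_trans (ler_normB _ _) (lerD h1 h2).
Unshelve. all: by end_near. Qed.

(** The bounded mass is all that the estimates retain of the approximation of the density. For a
    measure it follows by testing against the constant 1, for a function from the triangle
    inequality in L1. *)
Lemma density_approximation_mass (rho0 : @initial_density R) (rho0e : R -> R -> R) :
  nonneg_initial_density rho0 ->
  (forall eps, 0 < eps -> torus_continuous (rho0e eps)) ->
  (forall eps, 0 < eps -> forall x, 0 < rho0e eps x) ->
  density_approximation rho0 rho0e ->
  exists2 M, 0 <= M & \forall eps \near 0^'+,
    \int[mu]_(x in `[0, pi *+ 2]) rho0e eps x <= M.
Proof.
case: rho0 => [f|m] hrho0 cr r_gt0 /= lim; last first.
  have c1 : torus_continuous (fun _ : R => 1 : R) by exact: torus_continuous_cst.
  have := lim _ c1; set I := Rintegral _ _ _ => {}lim.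
  exists (`|I| + 1); first by rewrite addr_ge0.
  have I1 : I < `|I| + 1 by rewrite (le_lt_trans (ler_norm _))// ltrDl.
  have /cvgr_le/(_ _ I1) := lim; apply: filterS => eps.
  by under eq_Rintegral do rewrite mul1r.
have [[_ /integrableP[mf fint]] _] := hrho0.
pose If := (\int[mu]_(x in `[0%R, (pi *+ 2)%R]) `|(f x)%:E|)%E.
have If_fin : If \is a fin_num by rewrite ge0_fin_numE// integral_ge0.
have near1 : \forall eps \near 0^'+, (torus_L1_norm (fun x => (f x - rho0e eps x)%R) < 1%:E)%E.
  by apply: (lim [set y | (y < 1%:E)%E]); apply: open_ereal_lt'; rewrite lte_fin.
exists (fine If + 1); first by rewrite addr_ge0// fine_ge0// integral_ge0.
near=> eps.
have eps0 : 0 < eps by near: eps; exact: nbhs_right_gt.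
have [_ cre] := cr eps eps0.
have ire := continuous_integrable_segment _ 0 (pi *+ 2) cre.
have mre : measurable_fun `[0, pi *+ 2] (EFin \o rho0e eps).
  exact: measurable_int ire.
have d1 : (torus_L1_norm (fun x => (f x - rho0e eps x)%R) < 1%:E)%E.
  by near: eps; exact: near1.
rewrite -lee_fin /Rintegral fineK; last exact: integrable_fin_num.
rewrite EFinD fineK//.
apply: le_trans (leeD (lexx If) (ltW d1)).
have mf' : measurable_fun `[0, pi *+ 2] f by exact/measurable_EFinP.
have mr' : measurable_fun `[0, pi *+ 2] (rho0e eps) by exact/measurable_EFinP.
have md : measurable_fun `[0, pi *+ 2] (fun x => (`|f x - rho0e eps x|)%:E).
  apply/measurable_EFinP; apply: measurableT_comp => //.
  exact: measurable_funB.
have mn : measurable_fun `[0, pi *+ 2] (fun x => `|(f x)%:E|%E).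
  by apply: measurableT_comp.
rewrite /If /torus_L1_norm -ge0_integralD//.
apply: ge0_le_integral => //.
- by move=> x _; rewrite lee_fin ltW// r_gt0.
- exact: emeasurable_funD.
move=> x _; rewrite lee_fin.
rewrite [leLHS](_ : _ = f x - (f x - rho0e eps x)); last by ring.
exact: le_trans (ler_norm _) (ler_normB _ _).
Unshelve. all: by end_near. Qed.

Lemma cvg0_of_powR_bound (E : R -> R) C (a : R) : 0 < a ->
  (\forall eps \near 0^'+, `|E eps| <= C * eps `^ a) ->
  E eps @[eps --> 0^'+] --> 0.
Proof.
move=> a0 hE; apply/cvgrPdist_le => e e0.
have lim : C * eps `^ a @[eps --> 0^'+] --> (C * 0).
  by apply: cvgM; [exact: cvg_cst|exact: powR_cvg0].
rewrite mulr0 in lim; have /cvgr_le/(_ _ e0) := lim.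
apply: filterS2 hE => eps h1 h2; rewrite sub0r normrN.
exact: le_trans h2.
Qed.

End InitialData.

Theorem theorem2 (R : realType) (K gamma alpha : R) (phi : R -> R)
    (rho0 : @initial_density R) (u0 : R -> R) (rho0e u0e : R -> R -> R)
    (hK : 0 <= K) (hgamma : 1 < gamma <= 2) (halpha : 0 < alpha < 1 / 4)
    (hphi : test_function phi) (hphi0 : forall x, 0 <= phi x)
    (hphi_even : forall x, phi (- x) = phi x)
    (hphi1 : \int[lebesgue_measure]_x phi x = 1)
    (hrho0 : nonneg_initial_density rho0) (hu0 : torus_Linfty u0)
    (hrho0e : forall eps, 0 < eps -> torus_continuous (rho0e eps))
    (hu0e : forall eps, 0 < eps -> torus_continuous (u0e eps))
    (hrho0e_pos : forall eps, 0 < eps -> forall x, 0 < rho0e eps x)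
    (hrho0_lim : density_approximation rho0 rho0e)
    (hu0_lim : torus_Linfty_norm (fun x => u0 x - u0e eps x)
                 @[eps --> 0^'+] --> 0%E) :
  (forall eps, 0 < eps ->
     exists r q : R -> R -> R,
       ode_solution K gamma alpha phi eps (rho0e eps) (u0e eps) +oo%E r q /\
       forall (T : \bar R) (r' q' : R -> R -> R),
         ode_solution K gamma alpha phi eps (rho0e eps) (u0e eps) T r' q' ->
         forall t, time_interval T t -> r' t = r t /\ q' t = q t) /\
  (forall rho rhou : R -> R -> R -> R,
     (forall eps, 0 < eps ->
        ode_solution K gamma alpha phi eps (rho0e eps) (u0e eps) +oo%E
          (rho eps) (rhou eps)) ->
     weak_asymptotic_solution K gamma rho rhou
       (fun eps t => potential K gamma alpha phi eps (rho eps t))).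
Proof.
have [A [D bphi]] := test_function_bump _ hphi.
split=> [eps eps0|rho rhou sol t psi t0 hpsi].
  have [r [q sol]] := ode_solution_global K gamma alpha _ _ _ _ _ _ _ _
    hK hgamma bphi eps0 (hrho0e eps eps0) (hu0e eps eps0) (hrho0e_pos eps eps0).
  exists r, q; split; first exact: sol.
  move=> T r' q' sol' t Tt; have [t0 _] := Tt.
  have Tt' : time_interval +oo%E t by split; rewrite ?ltry.
  exact: (ode_solution_unique _ _ _ _ _ _ _ _ _ _ _ _ _ _ _ _ _ t hK hgamma bphi
    eps0 (hrho0e eps eps0) (hu0e eps eps0) (hrho0e_pos eps eps0) sol' sol Tt Tt').
have [A' [D' bpsi]] := test_function_bump _ hpsi.
have [U U0 hU] := torus_Linfty_approx_bounded _ _ hu0 hu0e hu0_lim.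
have [M M0 hM] := density_approximation_mass _ _ hrho0 hrho0e hrho0e_pos hrho0_lim.
have /andP[alpha0 alpha4] := halpha.
have [C hC] := weak_error_bounds K gamma alpha _ _ _ _ _ _ _ _ _ _ M U t
  hK hgamma alpha0 bphi bpsi hphi0 hphi1 t0 M0 U0.
have bounds : \forall eps \near 0^'+,
    [/\ 0 < eps <= 1, \int[lebesgue_measure]_(x in `[0, pi *+ 2]) rho0e eps x <= M &
        forall x, `|u0e eps x| <= U].
  near=> eps; split; last by near: eps; exact: hU.
    apply/andP; split; near: eps; first exact: nbhs_right_gt.
    exact: nbhs_right_le.
  by near: eps; exact: hM.
(* Here [alpha < 1 / 4] turns the rate of the two conservation laws into convergence to 0. *)
have a4 : 0 < 1 - 4 * alpha by lra.
split.
- apply: (cvg0_of_powR_bound _ C _ a4); apply: filterS bounds => eps [eps01 rM uU].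
  have /andP[eps0 _] := eps01.
  by have [] := hC eps _ _ _ _ eps01 rM uU (sol eps eps0).
- apply: (cvg0_of_powR_bound _ C _ a4); apply: filterS bounds => eps [eps01 rM uU].
  have /andP[eps0 _] := eps01.
  by have [] := hC eps _ _ _ _ eps01 rM uU (sol eps eps0).
- apply: (cvg0_of_powR_bound _ C _ alpha0); apply: filterS bounds => eps [eps01 rM uU].
  have /andP[eps0 _] := eps01.
  by have [] := hC eps _ _ _ _ eps01 rM uU (sol eps eps0).
Unshelve. all: by end_near. Qed.
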